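(* Let $\lambda\in\mathbb R$ and let $(S,T)$ be a closed triangulated surface. (a) A Euclidean circle packing metric on $(S,T)$ is determined up to triangulation fixing isometry and scaling by its $\lambda$-th discrete curvature $k_\lambda:V\to\mathbb R$. (That is, if two Euclidean circle packing metrics $l,l'$ on $(S,T)$ have the same $k_\lambda$, then $l'=cl$ for some $c>0$.) (b) A hyperbolic circle packing metric on $(S,T)$ is determined up to triangulation fixing isometry by its $\lambda$-th discrete curvature $k_\lambda$. (That is, if two such metrics have the same $k_\lambda$, then their edge length functions are equal.) (c) If $\lambda\le -1$, a Euclidean polyhedral metric on $(S,T)$ is determined up to triangulation fixing isometry and scaling by its edge invariant $\phi_\lambda:E\to\mathbb R$. (d) If $\lambda\le -1$ or $\lambda\ge 0$, a spherical polyhedral metric on $(S,T)$ is determined up to triangulation fixing isometry by its edge invariant $\phi_\lambda$. (e) If $\lambda\le -1$ or $\lambda\ge 0$, a hyperbolic polyhedral metric on $(S,T)$ is determined up to triangulation fixing isometry by its edge invariant $\psi_\lambda:E\to\mathbb R$.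
   Context: A closed triangulated surface $(S,T)$ is a connected closed surface obtained from a finite disjoint union of triangles by identifying all edges in pairs by homeomorphisms; $T$ is the resulting cell structure (cells need not be embedded), with sets $V$, $E$, $T^{(2)}$ of vertices, edges and triangles. Each triangle is counted as having three vertices, three edges and three corners, with multiplicity if some are identified in $S$. Each corner faces the opposite edge and is adjacent to the other two edges of its triangle; each edge is faced by exactly two corners. Let $K^2$ be $\mathbb E^2$, $\mathbb S^2$ or $\mathbb H^2$ (constant curvature $0,1,-1$). A $K^2$ polyhedral metric (Euclidean, spherical, hyperbolic respectively) on $(S,T)$ is identified, up to isometry preserving each simplex (triangulation fixing isometry), with its edge length function $l:E\to\mathbb R_{>0}$; the condition on $l$ is that for each triangle of $T$ with edges $e_i,e_j,e_k$ the numbers $l(e_i),l(e_j),l(e_k)$ are the edge lengths of a (non-degenerate) triangle in $K^2$. It assigns an inner angle to each corner. A circle packing metric is a polyhedral metric $l$ for which there is $r:V\to\mathbb R_{>0}$ with $l(e)=r(v)+r(v')$ for each edge $e$ with end points $v,v'$. For $\lambda\in\mathbb R$ and a polyhedral metric define: $\phi_\lambda(e)=\int_{\pi/2}^{a}\sin^\lambda(t)\,dt+\int_{\pi/2}^{a'}\sin^\lambda(t)\,dt$, where $a,a'$ are the two inner angles facing $e$; $\psi_\lambda(e)=\int_0^{(b+c-a)/2}\cos^\lambda(t)\,dt+\int_0^{(b'+c'-a')/2}\cos^\lambda(t)\,dt$, where $a,a'$ are the angles facing $e$ and $b,c$ (resp. $b',c'$) are the other two angles of the triangle containing $a$ (resp.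 $a'$); $k_\lambda(v)=\sum_{i=1}^m\int_{\pi/2}^{\theta_i}\tan^\lambda(t/2)\,dt$, where $\theta_1,\dots,\theta_m$ are all the inner angles at the vertex $v$. *)

(* Defs.v *)
From mathcomp Require Import all_boot.
From Stdlib Require Import Reals.
From Coquelicot Require Import Coquelicot.

Set Implicit Arguments.
Unset Strict Implicit.
Unset Printing Implicit Defensive.

Local Open Scope R_scope.

(* A triangle has corners indexed by 'I_3, in cyclic order.  The pair (t, i)
   denotes both the i-th corner of t and the side of t which that corner faces,
   namely the side joining the corners (t, ordS i) and (t, ord_pred i).

   A gluing of two sides is a homeomorphism, up to isotopy: it either matches
   the ordS end with the ordS end (twist = false) or the ordS end with the
   ord_pred end (twist = true).  Both cases are allowed, so that non-orientable
   surfaces, and surfaces in which cells are not embedded, are covered. *)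
Record closed_triangulated_surface := ClosedTriangulatedSurface {
  triangle : finType;
  glue : triangle * 'I_3 -> triangle * 'I_3;
  twist : triangle * 'I_3 -> bool;
  glueK : involutive glue;
  glue_neq : forall s, glue s != s;
  twist_glue : forall s, twist (glue s) = twist s;
  triangle_inhabited : inhabited triangle;
  triangle_connected : forall t t' : triangle,
    connect (fun x y => [exists i, (glue (x, i)).1 == y]) t t'
}.

Section Cells.

Variable T : closed_triangulated_surface.

Definition corner : finType := (triangle T * 'I_3)%type.

Definition next (c : corner) : corner := (c.1, ordS c.2).
Definition prev (c : corner) : corner := (c.1, ord_pred c.2).

Definition edge_class (s : corner) : {set corner} := [set s; glue s].

Definition side_end (s : corner) (b : bool) : corner :=
  if b then next s else prev s.

Definition glued_corners : rel corner := fun c c' =>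
  [exists s : corner, exists b : bool,
    (c == side_end s b) && (c' == side_end (glue s) (b (+) twist s))].

Definition vertex_class (c : corner) : {set corner} :=
  [set c' | connect glued_corners c c'].

(* An edge is a pair of glued sides, that is, the pair of corners facing it;
   a vertex is the set of all corners at it. *)
Definition edge_set : {set {set corner}} := [set edge_class s | s in [set: corner]].
Definition vertex_set : {set {set corner}} :=
  [set vertex_class c | c in [set: corner]].

Definition edge : finType := {e : {set corner} | e \in edge_set}.
Definition vertex : finType := {v : {set corner} | v \in vertex_set}.

Definition edge_of (s : corner) : edge :=
  Sub (edge_class s) (imset_f edge_class (in_setT s)).

Definition vertex_of (c : corner) : vertex :=
  Sub (vertex_class c) (imset_f vertex_class (in_setT c)).

End Cells.

(* The three geometries, realized in coordinates of R^3: the plane z = 1, the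
   unit sphere, and the upper sheet of the hyperboloid of Minkowski space. *)
Variant geometry := Euclidean | Spherical | Hyperbolic.

Record point := Point { px : R; py : R; pz : R }.

Definition sub_scale (p : point) (a : R) (q : point) : point :=
  Point (px p - a * px q) (py p - a * py q) (pz p - a * pz q).

Definition form (K : geometry) (p q : point) : R :=
  match K with
  | Hyperbolic => px p * px q + py p * py q - pz p * pz q
  | _ => px p * px q + py p * py q + pz p * pz q
  end.

Definition in_model (K : geometry) (p : point) : Prop :=
  match K with
  | Euclidean => pz p = 1
  | Spherical => form Spherical p p = 1
  | Hyperbolic => form Hyperbolic p p = -1 /\ 0 < pz p
  end.

Definition arcosh (x : R) : R := ln (x + sqrt (x ^ 2 - 1)).

Definition dist (K : geometry) (p q : point) : R :=
  match K with
  | Euclidean => let u := sub_scale q 1 p in sqrt (form Euclidean u u)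
  | Spherical => acos (form Spherical p q)
  | Hyperbolic => arcosh (- form Hyperbolic p q)
  end.

(* A vector tangent at p, pointing along the geodesic from p to q: for the two
   curved models, the component of q orthogonal to p (form p p is 1 or -1). *)
Definition direction (K : geometry) (p q : point) : point :=
  match K with
  | Euclidean => sub_scale q 1 p
  | Spherical => sub_scale q (form Spherical p q) p
  | Hyperbolic => sub_scale q (- form Hyperbolic p q) p
  end.

Definition angle (K : geometry) (p q r : point) : R :=
  let u := direction K p q in
  let v := direction K p r in
  acos (form K u v / (sqrt (form K u u) * sqrt (form K v v))).

(* In each model the geodesics are the intersections with the planes through
   the origin, so three points lie on a common geodesic if and only if they are
   linearly dependent. *)
Definition det3 (p q r : point) : R :=
  px p * (py q * pz r - pz q * py r)
  - py p * (px q * pz r - pz q * px r)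
  + pz p * (px q * py r - py q * px r).

Definition is_triangle (K : geometry) (p q r : point) : Prop :=
  [/\ in_model K p, in_model K q, in_model K r & det3 p q r <> 0].

(* The inner angles are determined by the edge lengths; they are recorded
   together with them. *)
Record polyhedral_metric (K : geometry) (T : closed_triangulated_surface) :=
  PolyhedralMetric {
    len : edge T -> R;
    ang : corner T -> R;
    len_pos : forall e, 0 < len e;
    realized : forall t : triangle T, exists2 P : 'I_3 -> point,
      forall i, is_triangle K (P i) (P (ordS i)) (P (ord_pred i)) &
      forall i,
        len (edge_of (t, i)) = dist K (P (ordS i)) (P (ord_pred i)) /\
        ang (t, i) = angle K (P i) (P (ordS i)) (P (ord_pred i))
  }.

Definition is_circle_packing (K : geometry) (T : closed_triangulated_surface)
    (M : polyhedral_metric K T) : Prop :=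
  exists2 r : vertex T -> R,
    forall v, 0 < r v &
    forall s : corner T,
      len M (edge_of s) = r (vertex_of (next s)) + r (vertex_of (prev s)).

Section Invariants.

Variables (lambda : R) (K : geometry) (T : closed_triangulated_surface).
Variable M : polyhedral_metric K T.

(* All the bases of the powers below are positive inside the intervals of
   integration, where Rpower is the usual real power. *)
Definition phi (e : edge T) : R :=
  \big[Rplus/0]_(c in val e)
    RInt (fun t => Rpower (sin t) lambda) (PI / 2) (ang M c).

Definition psi (e : edge T) : R :=
  \big[Rplus/0]_(c in val e)
    RInt (fun t => Rpower (cos t) lambda) 0
      ((ang M (next c) + ang M (prev c) - ang M c) / 2).

Definition curvature (v : vertex T) : R :=
  \big[Rplus/0]_(c in val v)
    RInt (fun t => Rpower (tan (t / 2)) lambda) (PI / 2) (ang M c).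

End Invariants.

(* Main.v *)
(* Parts (a) and (b): all angles at the vertex where r'/r (Euclidean), respectively
   tanh r'/tanh r (hyperbolic), is maximal can only decrease, and k_lambda is increasing
   in the angles, so a maximum principle applies.

   Parts (c)-(e): let u be an antiderivative of l^(-1-lambda), sin^(-1-lambda) l,
   respectively tanh^(-1-lambda) (l/2), and let v be the integral entering the edge
   invariant. It suffices that within one triangle sum_i (u(l_i') - u(l_i)) (v_i' - v_i)
   has a strict sign: summing over all triangles and regrouping by edges gives
   sum_e (u(l'_e) - u(l_e)) (invariant'(e) - invariant(e)) = 0. To get the sign, join the
   two triangles by the path which is affine in the coordinates u (if lambda <= -1) or v
   (if lambda >= 0), along which non-degeneracy persists, and apply the mean value
   theorem: by the sine law the derivative is, up to a positive factor independent of
   lambda, sum_i l_i' theta_i' / sin theta_i (or its hyperbolic analogue), a definite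
   quadratic form, except that its kernel in the Euclidean case is the scalings. *)
From HB Require Import structures.
From mathcomp Require Import all_boot.
From Stdlib Require Import Reals Lra Ranalysis5.
From Coquelicot Require Import Coquelicot.
Require Import Defs.

Set Implicit Arguments.
Unset Strict Implicit.
Unset Printing Implicit Defensive.

Local Open Scope R_scope.

(** * Calculus on the unit interval *)

(* [assumption] comes first because [sinh x] is itself convertible to a product. *)
Ltac product_pos := repeat first [assumption | apply: Rmult_lt_0_compat].

(** The delicate point is that the path must stay among triangles. Along it each coordinate l has
    velocity D / g(l)^p, with g the identity, [sin], [cos] or tanh(l / 2), so its acceleration is -p
    g'/g times the squared velocity. For p = 0 a defect l2 + l3 - l1 is affine in time; for p > 0 it
    is strictly concave wherever it is critical and nonpositive. Either way it cannot dip to zero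
    between two positive ends. Side lengths move with p = -1 - lambda and angle coordinates with p =
    lambda, and the requirement p >= 0 is the origin of the two ranges of lambda. The Euclidean
    defect is borderline: strictness fails for motions by scaling, which are excluded by solving the
    path explicitly.

    For lambda >= 0, polar duality turns spherical angles into sides. The hyperbolic plane has no
    polar triangle of the same geometry, so the half differences (B + C - A) / 2 serve as
    coordinates; positivity of the angles is then preserved by a symmetry, and the bound on the
    angle sum is once more a spherical defect. *)

Lemma ratio_in_unit (x y : R) : 0 < y -> - y < x < y -> -1 < x / y < 1.
Proof.
move=> y0 Hx; have E : x / y * y = x by field; lra.
by split; apply: (Rmult_lt_reg_r y) => //; rewrite E; lra.
Qed.

Lemma is_derive_eq (f : R -> R) (x l l' : R) :
  is_derive f x l -> l = l' -> is_derive f x l'.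
Proof. by move=> H <-. Qed.

Lemma is_derive_continuity_pt (f : R -> R) (x l : R) :
  is_derive f x l -> continuity_pt f x.
Proof.
move=> /is_derive_Reals H; apply: derivable_continuous_pt; by exists l.
Qed.

Lemma mean_value (f f' : R -> R) (a b : R) :
  a < b -> (forall x, a <= x <= b -> is_derive f x (f' x)) ->
  exists2 c, a < c < b & f b - f a = f' c * (b - a).
Proof.
move=> ab H.
have cont x : a <= x <= b -> continuity_pt f x.
  by move=> Hx; exact: is_derive_continuity_pt (H x Hx).
pose pr x (Hx : a < x < b) : derivable_pt f x :=
  exist _ (f' x) (proj1 (is_derive_Reals _ _ _) (H x ltac:(lra))).
have [|c [Hc E]] := @MVT f id a b pr (fun x _ => derivable_pt_id x) ab cont.
  by move=> c _; exact: derivable_continuous_pt (derivable_pt_id c).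
exists c => //.
by move: E; rewrite derive_pt_id /= /id; lra.
Qed.

Lemma deriv_pos_increasing (f f' : R -> R) (lo hi : R) :
  (forall x, lo < x < hi -> is_derive f x (f' x) /\ 0 < f' x) ->
  forall x y, lo < x -> x < y -> y < hi -> f x < f y.
Proof.
move=> H x y lx xy yh.
have [z zxy|c cxy E] := @mean_value f f' x y xy; first by apply H; lra.
have [_ P] := H c ltac:(lra).
nra.
Qed.

Lemma segment_lower (lo a b t : R) :
  lo < a -> lo < b -> 0 <= t <= 1 -> lo < a + t * (b - a).
Proof. by move=> Ha Hb Ht; case: (Rle_lt_dec a b) => ab; nra. Qed.

Lemma segment_bounds (lo hi a b t : R) :
  lo < a < hi -> lo < b < hi -> 0 <= t <= 1 -> lo < a + t * (b - a) < hi.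
Proof.
move=> Ha Hb Ht; split; first by apply: segment_lower; lra.
have := @segment_lower (- hi) (- a) (- b) t ltac:(lra) ltac:(lra) Ht; lra.
Qed.

(** Since [U] is strictly increasing, the path is its inverse applied to the segment from U a to U
    b, and the derivative comes from the inverse function theorem. *)
Lemma affine_path (U w : R -> R) (lo hi a b : R) :
  lo < a < hi -> lo < b < hi ->
  (forall x, lo < x < hi -> is_derive U x (w x) /\ 0 < w x) ->
  exists L : R -> R, [/\ L 0 = a, L 1 = b &
    forall t, 0 <= t <= 1 ->
      [/\ lo < L t < hi, U (L t) = U a + t * (U b - U a) &
          is_derive L t ((U b - U a) / w (L t))]].
Proof.
move=> Ha Hb HU.
(* A closed interval inside (lo, hi) with room on both sides of [a] and [b]: the inverse is built on
   a compact interval, yet times 0 and 1 must be interior to its range. *)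
pose lo1 := (lo + Rmin a b) / 2; pose hi1 := (hi + Rmax a b) / 2.
have Hmin : lo < Rmin a b by apply: Rmin_glb_lt; lra.
have Hmax : Rmax a b < hi by apply: Rmax_lub_lt; lra.
have := Rmin_l a b; have := Rmin_r a b; have := Rmax_l a b; have := Rmax_r a b.
move=> Mb Ma mb ma.
have incr x y : lo < x -> x < y -> y < hi -> U x < U y.
  exact: (@deriv_pos_increasing _ w).
have cont x : lo < x < hi -> continuity_pt U x.
  by move=> Hx; apply: is_derive_continuity_pt; apply HU.
have lh1 : lo1 < hi1 by rewrite /lo1 /hi1; lra.
have ll1 : lo < lo1 by rewrite /lo1; lra.
have hh1 : hi1 < hi by rewrite /hi1; lra.
have ivt y : U lo1 <= y <= U hi1 -> {x : R | lo1 <= x <= hi1 /\ U x = y}.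
  by move=> Hy; apply: f_interv_is_interv => // z Hz; apply: cont; lra.
have [g Hg] : exists g, forall y, U lo1 <= y <= U hi1 ->
    lo1 <= g y <= hi1 /\ U (g y) = y.
  (* The value 0 is a default outside the range of [U], where [g] is never evaluated. *)
  exists (fun y => match Rle_dec (U lo1) y, Rle_dec y (U hi1) with
    | left p, left q => proj1_sig (ivt y (conj p q)) | _, _ => 0 end).
  move=> y Hy; case: Rle_dec => p; last by lra.
  by case: Rle_dec => q; [exact: proj2_sig (ivt y (conj p q)) | lra].
have gU x : lo1 <= x <= hi1 -> g (U x) = x.
  move=> Hx.
  have Hy : U lo1 <= U x <= U hi1.
    split.
    - case: (Rle_lt_or_eq_dec lo1 x); [lra| |by move=> ->; lra].
      by move=> ?; apply: Rlt_le; apply: incr; lra.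
    - case: (Rle_lt_or_eq_dec x hi1); [lra| |by move=> ->; lra].
      by move=> ?; apply: Rlt_le; apply: incr; lra.
  have [H1 H2] := Hg _ Hy.
  case: (Rtotal_order (g (U x)) x) => [lt|[//|gt]].
  - have := incr (g (U x)) x ltac:(lra) lt ltac:(lra); lra.
  - have := incr x (g (U x)) ltac:(lra) gt ltac:(lra); lra.
have inside x : lo1 < x < hi1 -> U lo1 < U x < U hi1.
  by move=> Hx; split; apply: incr; lra.
have aI : lo1 < a < hi1 by rewrite /lo1 /hi1; lra.
have bI : lo1 < b < hi1 by rewrite /lo1 /hi1; lra.
have Ia := inside a aI; have Ib := inside b bI.
have dg y : U lo1 < y < U hi1 -> is_derive g y (/ w (g y)).
  move=> Hy; apply/is_derive_Reals.
  have [gI Ugy] := Hg y ltac:(lra).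
  have gc : continuity_pt g y.
    apply: (@continuity_pt_recip_interv U g lo1 hi1) => //.
    - by move=> u v Hu Huv Hv; apply: incr; lra.
    - by move=> z H1 H2; rewrite /comp /id; apply Hg.
    - by move=> z H1 H2; apply Hg.
    - by move=> z Hz; apply: cont; lra.
  have Prf z : g (U lo1) <= z <= g (U hi1) -> derivable_pt U z.
    rewrite !gU; try lra; move=> Hz; exists (w z); apply/is_derive_Reals.
    by apply HU; lra.
  have Prg : g (U lo1) <= g y <= g (U hi1) by rewrite !gU; lra.
  have D : derive_pt U (g y) (Prf (g y) Prg) = w (g y).
    by apply: derive_pt_eq_0; apply/is_derive_Reals; apply HU; lra.
  have wpos : 0 < w (g y) by apply HU; lra.
  have := @derivable_pt_lim_recip_interv U g (U lo1) (U hi1) y Prf gc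
     ltac:(lra) Hy Prg.
  rewrite D /Rdiv Rmult_1_l; apply; last by lra.
  by move=> z Hz; rewrite /comp /id; apply Hg.
exists (fun t => g (U a + t * (U b - U a))); split.
- by rewrite Rmult_0_l Rplus_0_r gU; lra.
- by rewrite Rmult_1_l (_ : U a + (U b - U a) = U b) ?gU; lra.
move=> t Ht.
have Hy : U lo1 < U a + t * (U b - U a) < U hi1 by exact: segment_bounds.
have [H1 H2] := Hg _ (conj (Rlt_le _ _ (proj1 Hy)) (Rlt_le _ _ (proj2 Hy))).
split => //; first lra.
have := @is_derive_comp R_AbsRing R_NormedModule g
   (fun t => U a + t * (U b - U a)) t _ (U b - U a) (dg _ Hy).
rewrite /scal /= /mult /=; apply.
by auto_derive => //; lra.
Qed.

(* At an interior minimum with a nonpositive value, [h'] vanishes and decreases,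
   so [h] takes smaller values just to the right. *)
Lemma positive_of_critical_concave (h h' : R -> R) :
  (forall t, 0 <= t <= 1 -> is_derive h t (h' t)) ->
  0 < h 0 -> 0 < h 1 ->
  (forall t, 0 < t < 1 -> h t <= 0 -> h' t = 0 ->
     exists2 d, is_derive h' t d & d < 0) ->
  forall t, 0 <= t <= 1 -> 0 < h t.
Proof.
move=> dh h0 h1 crit.
have [m [Hmin mI]] := @continuity_ab_min h 0 1 ltac:(lra)
   (fun c Hc => is_derive_continuity_pt (dh c Hc)).
case: (Rlt_le_dec 0 (h m)) => [pos t Ht|neg].
  by have := Hmin t Ht; lra.
exfalso.
have mI' : 0 < m < 1.
  split.
  - by case: (Rle_lt_or_eq_dec 0 m) => [||E]; [lra|lra|subst m; lra].
  - by case: (Rle_lt_or_eq_dec m 1) => [||E]; [lra|lra|subst m; lra].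
have D : derivable_pt h m.
  by exists (h' m); apply/is_derive_Reals; apply: dh; lra.
have h'0 : h' m = 0.
  have E : derive_pt h m D = h' m.
    by apply: derive_pt_eq_0; apply/is_derive_Reals; apply: dh; lra.
  rewrite -E; apply: (@deriv_minimum h 0 1 m D); try lra.
  by move=> x H0 H1; apply: Hmin; lra.
have [d /is_derive_Reals dd dneg] := crit m mI' neg h'0.
have [delta Hd] := dd (- d / 2) ltac:(lra).
have dpos := cond_pos delta.
(* Small enough both for the difference quotient of h' to stay close to d and for m + e to remain in
   [0, 1]. *)
pose e := Rmin (delta / 2) ((1 - m) / 2).
have e1 : e <= delta / 2 by exact: Rmin_l.
have e2 : e <= (1 - m) / 2 by exact: Rmin_r.
have epos : 0 < e by apply: Rmin_glb_lt; lra.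
have neg' x : 0 < x <= e -> h' (m + x) < 0.
  move=> Hx.
  have := Hd x ltac:(lra) ltac:(rewrite Rabs_right; lra).
  rewrite h'0 Rminus_0_r => /Rabs_def2 [H _].
  have : h' (m + x) / x < d / 2 by lra.
  move=> H2.
  have -> : h' (m + x) = h' (m + x) / x * x by field; lra.
  nra.
have [z zI|c cI E] := @mean_value h h' m (m + e) ltac:(lra).
  by apply: dh; lra.
have := Hmin (m + e) ltac:(lra).
have := neg' (c - m) ltac:(lra).
rewrite (_ : m + (c - m) = c); last by lra.
nra.
Qed.

Lemma constant_derivative01 (h : R -> R) (k : R) :
  (forall t, 0 <= t <= 1 -> is_derive h t k) ->
  forall t, 0 <= t <= 1 -> h t = h 0 + t * k.
Proof.
move=> dh t Ht.
case: (Rle_lt_or_eq_dec 0 t (proj1 Ht)) => [t0|<-]; last by lra.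
have [z zI|c cI E] := @mean_value h (fun=> k) 0 t t0; first by apply: dh; lra.
lra.
Qed.

(** Sylvester's criterion: the three hypotheses are the leading principal minors, and multiplying by
    the first two lets the squares be completed without division. *)
Lemma ternary_form_pos (A B C D E F x y z : R) :
  0 < A -> 0 < A * B - D ^ 2 ->
  0 < A * B * C + 2 * D * E * F - A * F ^ 2 - B * E ^ 2 - C * D ^ 2 ->
  x <> 0 \/ y <> 0 \/ z <> 0 ->
  0 < A * x ^ 2 + B * y ^ 2 + C * z ^ 2
      + 2 * D * x * y + 2 * E * x * z + 2 * F * y * z.
Proof.
set M := A * B - D ^ 2; set G := (X in _ -> _ -> 0 < X -> _).
set Q := (X in _ -> _ -> _ -> _ -> 0 < X).
move=> HA HM HG nz.
have id1 : A * M * Q = M * (A * x + D * y + E * z) ^ 2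
    + (M * y + (A * F - D * E) * z) ^ 2 + A * G * z ^ 2.
  by rewrite /Q /M /G; ring.
have AM : 0 < A * M by nra.
have sq u : 0 <= u ^ 2 by nra.
suff : 0 < A * M * Q by nra.
rewrite id1.
have s1 := sq (A * x + D * y + E * z).
have s2 := sq (M * y + (A * F - D * E) * z).
have s3 := sq z.
have AG : 0 < A * G by nra.
case: (Req_dec z 0) => z0; last first.
  have : 0 < z ^ 2 by have := Rsqr_pos_lt z z0; rewrite /Rsqr; lra.
  nra.
subst z; rewrite !Rmult_0_r !Rplus_0_r in s1 s2 *.
case: (Req_dec y 0) => y0; last first.
  have y2 : 0 < y ^ 2 by have := Rsqr_pos_lt y y0; rewrite /Rsqr; lra.
  have -> : (M * y) ^ 2 = M ^ 2 * y ^ 2 by ring.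
  have : 0 < M ^ 2 * y ^ 2 by apply: Rmult_lt_0_compat => //; nra.
  nra.
subst y; have x0 : x <> 0 by case: nz => [//|[]].
have x2 : 0 < x ^ 2 by have := Rsqr_pos_lt x x0; rewrite /Rsqr; lra.
rewrite !Rmult_0_r !Rplus_0_r.
have : 0 < (A * x) ^ 2.
  have -> : (A * x) ^ 2 = A ^ 2 * x ^ 2 by ring.
  by apply: Rmult_lt_0_compat => //; nra.
nra.
Qed.

(** * Real powers and motion along a path *)

Lemma Rpower_pos (x p : R) : 0 < Rpower x p.
Proof. exact: exp_pos. Qed.

Lemma is_derive_Rpower (g : R -> R) (p x g' : R) :
  0 < g x -> is_derive g x g' ->
  is_derive (fun t => Rpower (g t) p) x (p * (g' / g x) * Rpower (g x) p).
Proof.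
move=> gx dg; rewrite /Rpower; auto_derive.
  by split; [exists g' | split].
rewrite (is_derive_unique _ _ _ dg); field; lra.
Qed.

Lemma is_derive_RInt_Rpower (g : R -> R) (p lo hi x0 x : R) :
  (forall y, lo < y < hi -> 0 < g y /\ ex_derive g y) ->
  lo < x0 < hi -> lo < x < hi ->
  is_derive (fun y => RInt (fun t => Rpower (g t) p) x0 y) x (Rpower (g x) p).
Proof.
move=> Hg H0 Hx.
have cont y : lo < y < hi -> continuous (fun t => Rpower (g t) p) y.
  move=> Hy; apply: ex_derive_continuous.
  have [gy [g' dg]] := Hg y Hy.
  by exists (p * (g' / g y) * Rpower (g y) p); exact: is_derive_Rpower.
apply: (@is_derive_RInt _ (fun t => Rpower (g t) p) _ x0 x); last exact: cont.
have pos : 0 < Rmin (x - lo) (hi - x) by apply: Rmin_glb_lt; lra.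
exists (mkposreal _ pos) => y; rewrite /ball /= /AbsRing_ball /= => By.
apply: RInt_correct; apply: ex_RInt_continuous => z Hz; apply: cont.
have B1 := Rmin_l (x - lo) (hi - x); have B2 := Rmin_r (x - lo) (hi - x).
move/Rabs_def2: By; rewrite /minus /plus /opp /= => By.
have M1 := Rmin_glb_lt x0 y lo ltac:(lra) ltac:(lra).
have M2 := Rmax_lub_lt x0 y hi ltac:(lra) ltac:(lra).
lra.
Qed.

Lemma is_derive_const_div (q : R -> R) (D t q' : R) :
  q t <> 0 -> is_derive q t q' ->
  is_derive (fun s => D / q s) t (- D * q' / q t ^ 2).
Proof.
move=> q0 dq; auto_derive; first by split; [exists q' | split].
rewrite (is_derive_unique _ _ _ dq); field; lra.
Qed.

Lemma is_derive_velocity (g l : R -> R) (p D t g' : R) :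
  0 < g (l t) -> is_derive g (l t) g' ->
  is_derive l t (D / Rpower (g (l t)) p) ->
  is_derive (fun s => D / Rpower (g (l s)) p) t
    (- p * (g' / g (l t)) * (D / Rpower (g (l t)) p) ^ 2).
Proof.
move=> gl dg dl.
have P := Rpower_pos (g (l t)) p.
have dgl : is_derive (fun s => g (l s)) t (D / Rpower (g (l t)) p * g').
  exact: (@is_derive_comp R_AbsRing R_NormedModule g l t _ _ dg dl).
have dw := is_derive_Rpower p gl dgl.
have P0 : Rpower (g (l t)) p <> 0 by lra.
apply: (is_derive_eq (@is_derive_const_div (fun s => Rpower (g (l s)) p) D t _ P0 dw)).
by field; lra.
Qed.

Lemma div_Rpower_neq0 (D x p : R) : D <> 0 -> D / Rpower x p <> 0.
Proof.
move=> D0; apply: Rmult_integral_contrapositive_currified => //.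
by apply: Rinv_neq_0_compat; apply: Rgt_not_eq; exact: Rpower_pos.
Qed.

(* Along the path [l'' = - p * (g' l / g l) * l' ^ 2], so the hypothesis on [0 < t < 1]
   makes [l2 + l3 - l1] strictly concave at its critical points where it is nonpositive. *)
Lemma triangle_inequality_path (g g' : R -> R) (p lo hi D1 D2 D3 : R)
    (l1 l2 l3 : R -> R) :
  let y D (l : R -> R) t := D / Rpower (g (l t)) p in
  0 <= p ->
  (forall x, lo < x < hi -> 0 < g x /\ is_derive g x (g' x)) ->
  (forall t, 0 <= t <= 1 -> lo < l1 t < hi /\ is_derive l1 t (y D1 l1 t)) ->
  (forall t, 0 <= t <= 1 -> lo < l2 t < hi /\ is_derive l2 t (y D2 l2 t)) ->
  (forall t, 0 <= t <= 1 -> lo < l3 t < hi /\ is_derive l3 t (y D3 l3 t)) ->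
  (forall t, 0 < t < 1 -> l2 t + l3 t <= l1 t -> y D1 l1 t = y D2 l2 t + y D3 l3 t ->
    y D2 l2 t <> 0 \/ y D3 l3 t <> 0 ->
    g' (l1 t) / g (l1 t) * (y D1 l1 t) ^ 2
      < g' (l2 t) / g (l2 t) * (y D2 l2 t) ^ 2
        + g' (l3 t) / g (l3 t) * (y D3 l3 t) ^ 2) ->
  l1 0 < l2 0 + l3 0 -> l1 1 < l2 1 + l3 1 ->
  forall t, 0 <= t <= 1 -> l1 t < l2 t + l3 t.
Proof.
move=> y p0 Hg H1 H2 H3 crit T0 T1 t Ht.
pose h s := l2 s + l3 s - l1 s.
pose h' s := y D2 l2 s + y D3 l3 s - y D1 l1 s.
have dh s : 0 <= s <= 1 -> is_derive h s (h' s).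
  move=> Hs; have [_ d1] := H1 s Hs; have [_ d2] := H2 s Hs; have [_ d3] := H3 s Hs.
  apply: (@is_derive_minus _ R_NormedModule _ _ _ _ _ _ d1).
  exact: (@is_derive_plus _ R_NormedModule _ _ _ _ _ d2 d3).
suff : 0 < h t by rewrite /h; lra.
have h0 : 0 < h 0 by rewrite /h; lra.
have h1 : 0 < h 1 by rewrite /h; lra.
have linear k : (forall s, h' s = k) -> 0 < h t.
  move=> Hk.
  have E s : 0 <= s <= 1 -> h s = h 0 + s * k.
    by apply: constant_derivative01 => u Hu; rewrite -(Hk u); apply: dh.
  have E1 := E 1 ltac:(lra).
  have Et : h t = (1 - t) * h 0 + t * h 1 by rewrite (E t Ht) E1; lra.
  by rewrite Et; case: (Req_dec t 1) => [->|]; nra.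
case: (Rle_lt_or_eq_dec 0 p p0) => [ppos|pz]; last first.
  apply: (linear (D2 + D3 - D1)) => s.
  by rewrite /h' /y -pz /Rpower !Rmult_0_l exp_0; lra.
(* The concavity hypothesis asks for a moving [l2] or [l3]. If only [l1] moves there is no critical
   point at all; if nothing moves the defect is constant. *)
case: (Req_dec D2 0) => [D20|D2n]; first case: (Req_dec D3 0) => [D30|D3n];
  first case: (Req_dec D1 0) => [D10|D1n].
- by apply: (linear 0) => s; rewrite /h' /y D20 D30 D10 /Rdiv !Rmult_0_l; lra.
- apply: (positive_of_critical_concave dh) => // s Hs neg.
  rewrite /h' /y D20 D30 /Rdiv !Rmult_0_l => E.
  by have := @div_Rpower_neq0 D1 (g (l1 s)) p D1n; rewrite /Rdiv; lra.
all: apply: (positive_of_critical_concave dh) => // s Hs neg h's.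
all: have Hs' : 0 <= s <= 1 by lra.
all: have [I1 d1] := H1 s Hs'; have [I2 d2] := H2 s Hs'; have [I3 d3] := H3 s Hs'.
all: have [g1 dg1] := Hg _ I1; have [g2 dg2] := Hg _ I2; have [g3 dg3] := Hg _ I3.
all: have v1 := is_derive_velocity g1 dg1 d1.
all: have v2 := is_derive_velocity g2 dg2 d2.
all: have v3 := is_derive_velocity g3 dg3 d3.
all: eexists; first
  by apply: (@is_derive_minus _ R_NormedModule _ _ _ _ _ _ v1);
     exact: (@is_derive_plus _ R_NormedModule _ _ _ _ _ v2 v3).
all: have Y : y D2 l2 s <> 0 \/ y D3 l3 s <> 0
  by [left; exact: div_Rpower_neq0 | right; exact: div_Rpower_neq0].
all: have /Rlt_0_minus /(Rmult_lt_0_compat _ _ ppos) :=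
  crit s Hs ltac:(rewrite /h in neg; lra) ltac:(rewrite /h' in h's; lra) Y.
all: rewrite /minus /plus /opp /= -/(y D1 l1 s) -/(y D2 l2 s) -/(y D3 l3 s); lra.
Qed.

(** The mean value theorem is applied to the weighted sum as a single function of time, so that one
    t serves all three terms and a quadratic form in the velocities appears there. *)
Lemma weighted_mean_value (P : R -> Prop) (V v : R -> R) (D1 D2 D3 : R)
    (x1 x2 x3 : R -> R) :
  (forall x, P x -> is_derive V x (v x)) ->
  (forall t, 0 <= t <= 1 -> P (x1 t) /\ ex_derive x1 t) ->
  (forall t, 0 <= t <= 1 -> P (x2 t) /\ ex_derive x2 t) ->
  (forall t, 0 <= t <= 1 -> P (x3 t) /\ ex_derive x3 t) ->
  exists2 t, 0 < t < 1 &
    D1 * (V (x1 1) - V (x1 0)) + D2 * (V (x2 1) - V (x2 0)) + D3 * (V (x3 1) - V (x3 0))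
    = D1 * (Derive x1 t * v (x1 t)) + D2 * (Derive x2 t * v (x2 t))
      + D3 * (Derive x3 t * v (x3 t)).
Proof.
move=> dV H1 H2 H3.
have comp (x : R -> R) t : P (x t) /\ ex_derive x t ->
    is_derive (fun s => V (x s)) t (Derive x t * v (x t)).
  case=> Hx ex; exact: (@is_derive_comp R_AbsRing R_NormedModule V x t _ _
    (dV _ Hx) (Derive_correct _ _ ex)).
have [t Ht|t Ht E] := @mean_value (fun s => D1 * V (x1 s) + D2 * V (x2 s) + D3 * V (x3 s))
  (fun t => D1 * (Derive x1 t * v (x1 t)) + D2 * (Derive x2 t * v (x2 t))
      + D3 * (Derive x3 t * v (x3 t))) 0 1 ltac:(lra).
  apply: (@is_derive_plus _ R_NormedModule); last exact: is_derive_scal (comp _ _ (H3 t Ht)).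
  by apply: (@is_derive_plus _ R_NormedModule);
    [exact: is_derive_scal (comp _ _ (H1 t Ht)) | exact: is_derive_scal (comp _ _ (H2 t Ht))].
by exists t => //; lra.
Qed.

(** This is why the exponents -1 - p and p are paired: once a sine law provides X = k x with the
    same k for all three sides, the exponent survives only in the common factor k^p. *)
Lemma Rpower_ratio (x k p : R) : 0 < x -> 0 < k ->
  Rpower x (-1 - p) * Rpower (k * x) p = Rpower k p / x.
Proof.
move=> Hx Hk.
rewrite -Rpower_mult_distr // (Rmult_comm (Rpower k p)) -Rmult_assoc -Rpower_plus.
rewrite (_ : -1 - p + p = - (1)); last by lra.
by rewrite Rpower_Ropp Rpower_1 // Rmult_comm.
Qed.

(** Meant for u = sin a or a, X = sin A, k the ratio in the sine law, and M d = u L the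
    differentiated cosine law. The weight D is traded for the side velocity D / u^(-1-p), leaving a
    factor common to the three corners. *)
Lemma weighted_term (p M k D d u X L : R) :
  0 < u -> 0 < k -> 0 < M -> X = k * u -> M * d = u * L ->
  D * (d * Rpower X p) = Rpower k p / M * (D / Rpower u (-1 - p) * L).
Proof.
move=> u0 k0 M0 -> EM.
have w0 := Rpower_pos u (-1 - p).
have -> : d = u * L / M by rewrite -EM; field; lra.
have -> : Rpower (k * u) p = Rpower k p / u / Rpower u (-1 - p).
  by rewrite -(Rpower_ratio p u0 k0); field; lra.
by field; lra.
Qed.

Lemma zero_or_nonzero3 (x y z : R) :
  [/\ x = 0, y = 0 & z = 0] \/ (x <> 0 \/ y <> 0 \/ z <> 0).
Proof.
case: (Req_dec x 0) => X; case: (Req_dec y 0) => Y; case: (Req_dec z 0) => Z;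
  by [left | right; tauto].
Qed.

Lemma locally_inside (P : R -> Prop) (t : R) :
  0 < t < 1 -> (forall s, 0 <= s <= 1 -> P s) -> locally t P.
Proof.
move=> Ht H.
have pos : 0 < Rmin t (1 - t) by apply: Rmin_glb_lt; lra.
exists (mkposreal _ pos) => y; rewrite /ball /= /AbsRing_ball /= => By.
have B1 := Rmin_l t (1 - t); have B2 := Rmin_r t (1 - t).
move/Rabs_def2: By; rewrite /minus /plus /opp /= => By.
apply: H; lra.
Qed.

Lemma deriv_pos_injective (f f' : R -> R) (lo hi x y : R) :
  (forall x, lo < x < hi -> is_derive f x (f' x) /\ 0 < f' x) ->
  lo < x < hi -> lo < y < hi -> f x = f y -> x = y.
Proof.
move=> H Hx Hy E; have I := deriv_pos_increasing H.
case: (Rtotal_order x y) => [lt|[//|gt]].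
- have := I x y ltac:(lra) lt ltac:(lra); lra.
- have := I y x ltac:(lra) gt ltac:(lra); lra.
Qed.

(** * Hyperbolic functions *)

Lemma cosh2E (x : R) : cosh x ^ 2 = 1 + sinh x ^ 2.
Proof.
have E : exp x * exp (- x) = 1 by rewrite -exp_plus Rplus_opp_r exp_0.
by rewrite /cosh /sinh; lra.
Qed.

Lemma sinh_pos (x : R) : 0 < x -> 0 < sinh x.
Proof. by move=> Hx; rewrite -sinh_0; exact: sinh_lt. Qed.

Lemma cosh_pos (x : R) : 0 < cosh x.
Proof.
rewrite /cosh; have := exp_pos x; have := exp_pos (- x); lra.
Qed.

Lemma cosh_gt1 (x : R) : 0 < x -> 1 < cosh x.
Proof.
move=> /sinh_pos Hs; have := cosh_pos x; have := cosh2E x; nra.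
Qed.

Lemma cosh_add (x y : R) : cosh (x + y) = cosh x * cosh y + sinh x * sinh y.
Proof.
by rewrite /cosh /sinh Ropp_plus_distr !exp_plus; field.
Qed.

Lemma sinh_add (x y : R) : sinh (x + y) = sinh x * cosh y + cosh x * sinh y.
Proof.
by rewrite /cosh /sinh Ropp_plus_distr !exp_plus; field.
Qed.

Lemma cosh_opp (x : R) : cosh (- x) = cosh x.
Proof. by rewrite /cosh Ropp_involutive; lra. Qed.

Lemma sinh_opp (x : R) : sinh (- x) = - sinh x.
Proof. by rewrite /sinh Ropp_involutive; lra. Qed.

Lemma cosh_lt (x y : R) : 0 <= x < y -> cosh x < cosh y.
Proof.
move=> [Hx xy].
have E : cosh y - cosh x = 2 * sinh ((y + x) / 2) * sinh ((y - x) / 2).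
  have -> : cosh y = cosh ((y + x) / 2 + (y - x) / 2) by congr cosh; lra.
  have -> : cosh x = cosh ((y + x) / 2 + - ((y - x) / 2)) by congr cosh; lra.
  by rewrite !cosh_add cosh_opp sinh_opp; ring.
have s1 := @sinh_pos ((y + x) / 2) ltac:(lra).
have s2 := @sinh_pos ((y - x) / 2) ltac:(lra).
nra.
Qed.

Lemma cosh_lt_rev (x y : R) : 0 <= x -> 0 <= y -> cosh x < cosh y -> x < y.
Proof.
move=> Hx Hy H; case: (Rle_lt_dec y x) => // yx.
case: (Rle_lt_or_eq_dec _ _ yx) => [lt|E]; last by rewrite E in H; lra.
by have := @cosh_lt y x ltac:(lra); lra.
Qed.

Lemma cosh_inj (x y : R) : 0 <= x -> 0 <= y -> cosh x = cosh y -> x = y.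
Proof.
move=> Hx Hy E; case: (Rtotal_order x y) => [lt|[//|gt]].
- by have := @cosh_lt x y ltac:(lra); lra.
- by have := @cosh_lt y x ltac:(lra); lra.
Qed.

Lemma tanh_half (x : R) : tanh (x / 2) = sinh x / (cosh x + 1).
Proof.
have E1 : sinh x = 2 * sinh (x / 2) * cosh (x / 2).
  have -> : sinh x = sinh (x / 2 + x / 2) by congr sinh; lra.
  by rewrite sinh_add; ring.
have E2 : cosh x + 1 = 2 * cosh (x / 2) ^ 2.
  have -> : cosh x = cosh (x / 2 + x / 2) by congr cosh; lra.
  by rewrite cosh_add; have := cosh2E (x / 2); lra.
have c := cosh_pos (x / 2).
by rewrite /tanh E1 E2; field; lra.
Qed.

Lemma tanh_half_pos (x : R) : 0 < x -> 0 < tanh (x / 2).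
Proof.
move=> Hx; rewrite tanh_half; apply: Rdiv_lt_0_compat; first exact: sinh_pos.
by have := cosh_pos x; lra.
Qed.

Lemma is_derive_tanh_half (x : R) :
  is_derive (fun y => tanh (y / 2)) x (/ (cosh x + 1)).
Proof.
have c := cosh_pos x.
apply: (is_derive_ext (fun y => sinh y / (cosh y + 1))).
  by move=> y; rewrite tanh_half.
auto_derive; first lra.
apply: (Rmult_eq_reg_l ((cosh x + 1) ^ 2)); last by nra.
by field_simplify; [rewrite cosh2E; ring | lra | lra].
Qed.

Lemma arcosh_pos (x : R) : 1 < x -> 0 < arcosh x.
Proof.
move=> Hx; rewrite /arcosh -ln_1; apply: ln_increasing; first lra.
by have := sqrt_pos (x ^ 2 - 1); lra.
Qed.

Lemma cosh_arcosh (x : R) : 1 <= x -> cosh (arcosh x) = x.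
Proof.
move=> Hx.
have s0 := sqrt_pos (x ^ 2 - 1).
have s2 : sqrt (x ^ 2 - 1) * sqrt (x ^ 2 - 1) = x ^ 2 - 1 by apply: sqrt_sqrt; nra.
have pos : 0 < x + sqrt (x ^ 2 - 1) by lra.
rewrite /cosh exp_Ropp /arcosh exp_ln //.
have -> : / (x + sqrt (x ^ 2 - 1)) = x - sqrt (x ^ 2 - 1).
  apply: (Rmult_eq_reg_l (x + sqrt (x ^ 2 - 1))); last by lra.
  rewrite Rinv_r; [nra | lra].
lra.
Qed.

Lemma arcosh_cosh (x : R) : 0 < x -> arcosh (cosh x) = x.
Proof.
move=> Hx; have c := cosh_gt1 Hx; have p := arcosh_pos c.
by apply: cosh_inj; try lra; rewrite cosh_arcosh; lra.
Qed.

Lemma ex_derive_arcosh (x : R) : 1 < x -> ex_derive arcosh x.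
Proof.
move=> Hx; rewrite /arcosh; auto_derive.
have s := sqrt_pos (x * (x * 1) + - (1)).
by split; [nra | split => //; lra].
Qed.

(** * Spherical triangles *)

Lemma ex_derive_acos (x : R) : -1 < x < 1 -> ex_derive acos x.
Proof.
by move=> Hx; apply/ex_derive_Reals_1; apply: derivable_pt_acos.
Qed.

Lemma eq_of_sqr_eq (x y : R) : 0 < x -> 0 < y -> x ^ 2 = y ^ 2 -> x = y.
Proof. move=> Hx Hy E; nra. Qed.

Lemma sin2E (x : R) : sin x ^ 2 = 1 - cos x ^ 2.
Proof. have := sin2_cos2 x; rewrite /Rsqr; lra. Qed.

Lemma acos_unique (x y : R) : 0 < x < PI -> cos x = y -> acos y = x.
Proof. by move=> Hx <-; apply: acos_cos; lra. Qed.

Definition spherical_law (a b c A : R) : Prop :=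
  cos a = cos b * cos c + sin b * sin c * cos A.

(** All three ranges and laws are kept, so that a fact about one corner passes to the others by
    cyclic rotation. *)
Record spherical_triangle (a b c A B C : R) : Prop := SphericalTriangle {
  sph_a : 0 < a < PI; sph_b : 0 < b < PI; sph_c : 0 < c < PI;
  sph_A : 0 < A < PI; sph_B : 0 < B < PI; sph_C : 0 < C < PI;
  sph_lawA : spherical_law a b c A;
  sph_lawB : spherical_law b c a B;
  sph_lawC : spherical_law c a b C }.

Lemma spherical_rot a b c A B C :
  spherical_triangle a b c A B C -> spherical_triangle b c a B C A.
Proof. by case=> *; split. Qed.

Lemma sin_pos (x : R) : 0 < x < PI -> 0 < sin x.
Proof. by move=> Hx; apply: sin_gt_0; lra. Qed.

(** The right-hand side is the Gram determinant of three unit vectors at mutual distances a, b, c.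
    Its symmetry in the sides yields the sine law. *)
Lemma spherical_gram a b c A :
  spherical_law a b c A ->
  (sin A * sin b * sin c) ^ 2
  = 1 - cos a ^ 2 - cos b ^ 2 - cos c ^ 2 + 2 * cos a * cos b * cos c.
Proof.
move=> L.
have -> : (sin A * sin b * sin c) ^ 2 = sin A ^ 2 * (sin b ^ 2 * sin c ^ 2) by ring.
have E : sin b ^ 2 * sin c ^ 2 * cos A ^ 2 = (cos a - cos b * cos c) ^ 2.
  by rewrite /spherical_law in L; rewrite L; ring.
have := sin2E A => EA; rewrite EA Rmult_minus_distr_r.
rewrite (Rmult_comm (cos A ^ 2)) E !sin2E; ring.
Qed.

Lemma spherical_sine a b c A B C : spherical_triangle a b c A B C ->
  sin A * sin b * sin c = sin B * sin c * sin a.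
Proof.
case=> Ha Hb Hc HA HB HC LA LB LC.
have [sa sb sc] : [/\ 0 < sin a, 0 < sin b & 0 < sin c] by split; exact: sin_pos.
have [sA sB] : 0 < sin A /\ 0 < sin B by split; exact: sin_pos.
apply: eq_of_sqr_eq; try by do ?[apply: Rmult_lt_0_compat].
rewrite (spherical_gram LA) (spherical_gram LB); ring.
Qed.

(** Once the cosine laws clear the denominators, the product sin B sin C carries two factors which
    the sine law makes equal; their product is the Gram determinant, and a polynomial identity in
    the cosines of the sides remains. *)
Lemma spherical_dual_law a b c A B C : spherical_triangle a b c A B C ->
  cos A = - cos B * cos C + sin B * sin C * cos a.
Proof.
move=> T; have [Ha Hb Hc HA HB HC LA LB LC] := T.
have [sa sb sc] : [/\ 0 < sin a, 0 < sin b & 0 < sin c] by split; exact: sin_pos.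
have S1 := spherical_sine T; have S2 := spherical_sine (spherical_rot T).
have G := spherical_gram LA.
rewrite /spherical_law in LA LB LC.
have m : 0 < sin a ^ 2 * sin b * sin c by do ?[apply: Rmult_lt_0_compat]; lra.
apply: (Rmult_eq_reg_l (sin a ^ 2 * sin b * sin c)); last by lra.
have -> : sin a ^ 2 * sin b * sin c * cos A = sin a ^ 2 * (cos a - cos b * cos c).
  by rewrite LA; ring.
have -> : sin a ^ 2 * sin b * sin c * (- cos B * cos C + sin B * sin C * cos a)
  = - (cos b - cos c * cos a) * (cos c - cos a * cos b)
    + (sin B * sin c * sin a) * (sin C * sin a * sin b) * cos a.
  have -> : cos b - cos c * cos a = sin c * sin a * cos B by lra.
  have -> : cos c - cos a * cos b = sin a * sin b * cos C by lra.
  by ring.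
rewrite -S2 -S1.
have -> : sin A * sin b * sin c * (sin A * sin b * sin c) = (sin A * sin b * sin c) ^ 2.
  by ring.
rewrite G sin2E; ring.
Qed.

(** The polar triangle: its cosine laws are the dual laws of the original one, up to the signs
    produced by the supplements. *)
Lemma spherical_dual a b c A B C : spherical_triangle a b c A B C ->
  spherical_triangle (PI - A) (PI - B) (PI - C) (PI - a) (PI - b) (PI - c).
Proof.
move=> T; have [Ha Hb Hc HA HB HC _ _ _] := T.
have D1 := spherical_dual_law T.
have D2 := spherical_dual_law (spherical_rot T).
have D3 := spherical_dual_law (spherical_rot (spherical_rot T)).
by split; try lra;
  rewrite /spherical_law !Rtrigo_facts.cos_pi_minus !Rtrigo_facts.sin_pi_minus;
  lra.
Qed.

Lemma lt_of_cos_lt (x y : R) : 0 <= x <= PI -> 0 <= y <= PI -> cos y < cos x -> x < y.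
Proof. by move=> Hx Hy H; apply: cos_decreasing_0; lra. Qed.

(** From cos A > -1 the cosine law gives cos (b + c) < cos a. When b + c <= PI this is the triangle
    inequality; beyond PI it bounds the perimeter, after replacing b + c by 2 PI - (b + c). *)
Lemma spherical_inequality a b c A B C :
  spherical_triangle a b c A B C -> a < b + c /\ a + b + c < 2 * PI.
Proof.
case=> Ha Hb Hc HA _ _ L _ _.
have sb := sin_pos Hb; have sc := sin_pos Hc; have sA := sin_pos HA.
have cA : -1 < cos A.
  have := sin2E A; have := COS_bound A; nra.
have H : cos (b + c) < cos a.
  by rewrite cos_plus L; have := Rmult_lt_0_compat _ _ sb sc; nra.
case: (Rle_lt_dec (b + c) PI) => bc.
  by have := @lt_of_cos_lt a (b + c) ltac:(lra) ltac:(lra) H; lra.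
split; first lra.
have E : cos (2 * PI - (b + c)) = cos (b + c).
  by rewrite cos_minus cos_2PI sin_2PI; lra.
rewrite -E in H.
by have := @lt_of_cos_lt a (2 * PI - (b + c)) ltac:(lra) ltac:(lra) H; lra.
Qed.

(** The two bounds amount to cos (b + c) < cos a < cos (b - c); the perimeter condition takes over
    in the first one when b + c exceeds PI. *)
Lemma spherical_angle_bound a b c : 0 < a < PI -> 0 < b < PI -> 0 < c < PI ->
  a < b + c -> b < c + a -> c < a + b -> a + b + c < 2 * PI ->
  -1 < (cos a - cos b * cos c) / (sin b * sin c) < 1.
Proof.
move=> Ha Hb Hc t1 t2 t3 p.
have m := Rmult_lt_0_compat _ _ (sin_pos Hb) (sin_pos Hc).
have H1 : cos (b + c) < cos a.
  case: (Rle_lt_dec (b + c) PI) => bc; first by apply: cos_decreasing_1; lra.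
  have <- : cos (2 * PI - (b + c)) = cos (b + c).
    by rewrite cos_minus cos_2PI sin_2PI; lra.
  by apply: cos_decreasing_1; lra.
have H2 : cos a < cos (b - c).
  case: (Rle_lt_dec c b) => bc; first by apply: cos_decreasing_1; lra.
  have <- : cos (c - b) = cos (b - c) by rewrite !cos_minus; lra.
  by apply: cos_decreasing_1; lra.
rewrite cos_plus in H1; rewrite cos_minus in H2.
by apply: ratio_in_unit => //; lra.
Qed.

Definition spherical_angle (a b c : R) : R :=
  acos ((cos a - cos b * cos c) / (sin b * sin c)).

Lemma spherical_triangle_of_lengths a b c :
  0 < a < PI -> 0 < b < PI -> 0 < c < PI ->
  a < b + c -> b < c + a -> c < a + b -> a + b + c < 2 * PI ->
  spherical_triangle a b c
    (spherical_angle a b c) (spherical_angle b c a) (spherical_angle c a b).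
Proof.
move=> Ha Hb Hc t1 t2 t3 p.
have law x y z : 0 < x < PI -> 0 < y < PI -> 0 < z < PI ->
  x < y + z -> y < z + x -> z < x + y -> x + y + z < 2 * PI ->
  0 < spherical_angle x y z < PI /\ spherical_law x y z (spherical_angle x y z).
  move=> Hx Hy Hz s1 s2 s3 q.
  have Bd := spherical_angle_bound Hx Hy Hz s1 s2 s3 q.
  split; first exact: acos_bound_lt.
  rewrite /spherical_law cos_acos; last by lra.
  by field; split; apply: Rgt_not_eq; exact: sin_pos.
have [||||A1 A2] := @law a b c Ha Hb Hc; try lra.
have [||||B1 B2] := @law b c a Hb Hc Ha; try lra.
have [||||C1 C2] := @law c a b Hc Ha Hb; try lra.
by split.
Qed.

Lemma spherical_angleE a b c A : 0 < b < PI -> 0 < c < PI -> 0 < A < PI ->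
  spherical_law a b c A -> spherical_angle a b c = A.
Proof.
move=> Hb Hc HA L; apply: acos_unique => //.
rewrite L; field; split; apply: Rgt_not_eq; exact: sin_pos.
Qed.

(** Implicit differentiation gives b' and c' coefficients that mix sides and the angle A. The
    projection formulas [F1] and [F2] turn them into sin a cos C and sin a cos B, so that the result
    is a row of the matrix with 1 on the diagonal and minus the cosines of the angles elsewhere. *)
Lemma spherical_law_derivative (a b c A B C : R -> R) (t a' b' c' A' : R) :
  spherical_triangle (a t) (b t) (c t) (A t) (B t) (C t) ->
  locally t (fun s => spherical_law (a s) (b s) (c s) (A s)) ->
  is_derive a t a' -> is_derive b t b' -> is_derive c t c' -> is_derive A t A' ->
  sin (A t) * sin (b t) * sin (c t) * A'
  = sin (a t) * (a' - cos (C t) * b' - cos (B t) * c').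
Proof.
move=> T loc da db dc dA.
have [Ha Hb Hc _ _ _ LA LB LC] := T.
have sb := sin_pos Hb; have sc := sin_pos Hc.
pose F s := cos (b s) * cos (c s) + sin (b s) * sin (c s) * cos (A s) - cos (a s).
have dF0 : is_derive F t 0.
  apply: (is_derive_ext_loc (fun=> 0)).
    by apply: filter_imp loc => s; rewrite /spherical_law /F => ->; lra.
  exact: (@is_derive_const R_AbsRing R_NormedModule).
have dF1 : is_derive F t
  (- sin (b t) * b' * cos (c t) - cos (b t) * sin (c t) * c'
   + (cos (b t) * b' * sin (c t) + sin (b t) * cos (c t) * c') * cos (A t)
   - sin (b t) * sin (c t) * sin (A t) * A' + sin (a t) * a').
  rewrite /F; auto_derive.
    by do ?split; eexists; eassumption.
  rewrite (is_derive_unique _ _ _ da) (is_derive_unique _ _ _ db)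
    (is_derive_unique _ _ _ dc) (is_derive_unique _ _ _ dA); ring.
have E := is_derive_unique _ _ _ dF1.
rewrite (is_derive_unique _ _ _ dF0) in E.
rewrite /spherical_law in LA LB LC.
have F1 : sin (b t) * cos (c t) - cos (A t) * cos (b t) * sin (c t)
    = sin (a t) * cos (C t).
  apply: (Rmult_eq_reg_l (sin (b t))); last by lra.
  have -> : sin (b t) * (sin (b t) * cos (c t) - cos (A t) * cos (b t) * sin (c t))
     = sin (b t) ^ 2 * cos (c t) - cos (b t) * (cos (a t) - cos (b t) * cos (c t)).
    by rewrite LA; ring.
  have -> : sin (b t) * (sin (a t) * cos (C t)) = cos (c t) - cos (a t) * cos (b t).
    by rewrite LC; ring.
  rewrite sin2E; ring.
have F2 : sin (c t) * cos (b t) - cos (A t) * cos (c t) * sin (b t)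
    = sin (a t) * cos (B t).
  apply: (Rmult_eq_reg_l (sin (c t))); last by lra.
  have -> : sin (c t) * (sin (c t) * cos (b t) - cos (A t) * cos (c t) * sin (b t))
     = sin (c t) ^ 2 * cos (b t) - cos (c t) * (cos (a t) - cos (b t) * cos (c t)).
    by rewrite LA; ring.
  have -> : sin (c t) * (sin (a t) * cos (B t)) = cos (b t) - cos (c t) * cos (a t).
    by rewrite LB; ring.
  rewrite sin2E; ring.
have -> : sin (a t) * (a' - cos (C t) * b' - cos (B t) * c')
  = sin (a t) * a' - (sin (a t) * cos (C t)) * b' - (sin (a t) * cos (B t)) * c'.
  by ring.
rewrite -F1 -F2; lra.
Qed.

(** The matrix of this form is the Gram matrix of the polar triangle, since cos (PI - A) = - cos A;
    its leading minors are 1, sin^2 C and a Gram determinant that is a nonzero square. *)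
Lemma spherical_form_pos a b c A B C x y z :
  spherical_triangle a b c A B C -> x <> 0 \/ y <> 0 \/ z <> 0 ->
  0 < x * (x - cos C * y - cos B * z) + y * (y - cos A * z - cos C * x)
      + z * (z - cos B * x - cos A * y).
Proof.
move=> T nz.
have [_ _ Hc _ _ HC _ _ _] := T; have sC := sin_pos HC.
have [Ha' Hb' Hc' HA' _ _ LA' _ _] := spherical_dual T.
have G := spherical_gram LA'.
have m : 0 < (sin (PI - a) * sin (PI - B) * sin (PI - C)) ^ 2.
  by apply: pow_lt; do ?apply: Rmult_lt_0_compat; exact: sin_pos.
rewrite G !Rtrigo_facts.cos_pi_minus in m.
have := @ternary_form_pos 1 1 1 (- cos C) (- cos B) (- cos A) x y z _ _ _ nz.
have := sin2E C; nra.
Qed.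

(** Since cot decreases, x may be replaced by y + z. The difference is then a multiple of Y^2 + Z^2
    - 2 cos (y + z) Y Z with Y = sin z u and Z = sin y v, which is definite because cos^2 (y + z) <
    1. *)
Lemma cot_inequality (x y z u v : R) :
  0 < y -> 0 < z -> y + z <= x -> x < PI -> u <> 0 \/ v <> 0 ->
  cos x / sin x * (u + v) ^ 2 < cos y / sin y * u ^ 2 + cos z / sin z * v ^ 2.
Proof.
move=> Hy Hz Hx HP nz.
have sx : 0 < sin x by apply: sin_pos; lra.
have sy : 0 < sin y by apply: sin_pos; lra.
have sz : 0 < sin z by apply: sin_pos; lra.
have ss : 0 < sin (y + z) by apply: sin_pos; lra.
have cotle : cos x / sin x <= cos (y + z) / sin (y + z).
  have H : 0 <= sin (x - (y + z)) by apply: sin_ge_0; lra.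
  rewrite sin_minus in H.
  apply: (Rmult_le_reg_r (sin x * sin (y + z))); first exact: Rmult_lt_0_compat.
  have -> : cos x / sin x * (sin x * sin (y + z)) = cos x * sin (y + z) by field; lra.
  have -> : cos (y + z) / sin (y + z) * (sin x * sin (y + z)) = cos (y + z) * sin x.
    by field; lra.
  lra.
apply: (@Rle_lt_trans _ (cos (y + z) / sin (y + z) * (u + v) ^ 2)).
  by apply: Rmult_le_compat_r => //; exact: pow2_ge_0.
have c1 : cos (y + z) ^ 2 < 1 by have := sin2E (y + z); nra.
pose Y := sin z * u; pose Z := sin y * v.
have E : cos y / sin y * u ^ 2 + cos z / sin z * v ^ 2
   - cos (y + z) / sin (y + z) * (u + v) ^ 2
   = (Y ^ 2 + Z ^ 2 - 2 * cos (y + z) * Y * Z) / (sin y * sin z * sin (y + z)).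
  have Ey : cos y * sin (y + z) - cos (y + z) * sin y = sin z.
    have -> : sin z = sin ((y + z) - y) by congr sin; lra.
    by rewrite [in RHS]sin_minus; ring.
  have Ez : cos z * sin (y + z) - cos (y + z) * sin z = sin y.
    have -> : sin y = sin ((y + z) - z) by congr sin; lra.
    by rewrite [in RHS]sin_minus; ring.
  have -> : cos y = (sin z + cos (y + z) * sin y) / sin (y + z).
    by rewrite -Ey; field; lra.
  have -> : cos z = (sin y + cos (y + z) * sin z) / sin (y + z).
    by rewrite -Ez; field; lra.
  by rewrite /Y /Z; field; lra.
have nz' : Y <> 0 \/ Z <> 0.
  case: nz => n; [left|right]; apply: Rmult_integral_contrapositive_currified => //; lra.
suff : 0 < (Y ^ 2 + Z ^ 2 - 2 * cos (y + z) * Y * Z) / (sin y * sin z * sin (y + z)) by lra.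
apply: Rdiv_lt_0_compat; last by do ?apply: Rmult_lt_0_compat.
have -> : Y ^ 2 + Z ^ 2 - 2 * cos (y + z) * Y * Z
  = (Y - cos (y + z) * Z) ^ 2 + (1 - cos (y + z) ^ 2) * Z ^ 2 by ring.
case: (Req_dec Z 0) => Z0.
  have Y0 : Y <> 0 by case: nz'.
  by have := pow2_gt_0 Y Y0; rewrite Z0; lra.
have := pow2_ge_0 (Y - cos (y + z) * Z); have := pow2_gt_0 Z Z0.
by move=> Z2; have := @Rmult_lt_0_compat (1 - cos (y + z) ^ 2) _ ltac:(lra) Z2; lra.
Qed.

Lemma spherical_inequality_path (p D1 D2 D3 : R) (l1 l2 l3 : R -> R) :
  let v D (l : R -> R) t := D / Rpower (sin (l t)) p in
  0 <= p ->
  (forall t, 0 <= t <= 1 -> 0 < l1 t < PI /\ is_derive l1 t (v D1 l1 t)) ->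
  (forall t, 0 <= t <= 1 -> 0 < l2 t < PI /\ is_derive l2 t (v D2 l2 t)) ->
  (forall t, 0 <= t <= 1 -> 0 < l3 t < PI /\ is_derive l3 t (v D3 l3 t)) ->
  l1 0 < l2 0 + l3 0 -> l1 1 < l2 1 + l3 1 ->
  forall t, 0 <= t <= 1 -> l1 t < l2 t + l3 t.
Proof.
move=> v p0 H1 H2 H3.
apply: (triangle_inequality_path (g' := cos) p0 _ H1 H2 H3).
  by move=> x Hx; split; [exact: sin_pos | apply/is_derive_Reals/derivable_pt_lim_sin].
move=> t Ht le -> nz; apply: cot_inequality => //.
- by have := H2 t ltac:(lra); lra.
- by have := H3 t ltac:(lra); lra.
- by have := H1 t ltac:(lra); lra.
Qed.

Lemma ex_derive_spherical_angle (a b c : R -> R) (t : R) :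
  0 < b t < PI -> 0 < c t < PI ->
  -1 < (cos (a t) - cos (b t) * cos (c t)) / (sin (b t) * sin (c t)) < 1 ->
  ex_derive a t -> ex_derive b t -> ex_derive c t ->
  ex_derive (fun s => spherical_angle (a s) (b s) (c s)) t.
Proof.
move=> Hb Hc Bd da db dc; rewrite /spherical_angle.
apply: (@ex_derive_comp R_AbsRing R_NormedModule acos); first exact: ex_derive_acos.
have sb := sin_pos Hb; have sc := sin_pos Hc.
auto_derive; do ?split => //.
by apply: Rgt_not_eq; exact: Rmult_lt_0_compat.
Qed.

(** By the sine law both sin A sin b sin c and sin A / sin a are common to the three corners. One
    positive factor splits off, and the form of [spherical_form_pos] at the side velocities is
    left. *)
Lemma spherical_weighted_form_pos (p Da Db Dc dA dB dC : R) a b c A B C :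
  spherical_triangle a b c A B C -> Da <> 0 \/ Db <> 0 \/ Dc <> 0 ->
  let x := Da / Rpower (sin a) (-1 - p) in
  let y := Db / Rpower (sin b) (-1 - p) in
  let z := Dc / Rpower (sin c) (-1 - p) in
  sin A * sin b * sin c * dA = sin a * (x - cos C * y - cos B * z) ->
  sin B * sin c * sin a * dB = sin b * (y - cos A * z - cos C * x) ->
  sin C * sin a * sin b * dC = sin c * (z - cos B * x - cos A * y) ->
  0 < Da * (dA * Rpower (sin A) p) + Db * (dB * Rpower (sin B) p)
      + Dc * (dC * Rpower (sin C) p).
Proof.
move=> T nz x y z.
have S1 := spherical_sine T; have S2 := spherical_sine (spherical_rot T).
have [Ha Hb Hc HA HB HC _ _ _] := T.
have sa := sin_pos Ha; have sb := sin_pos Hb; have sc := sin_pos Hc.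
have sA := sin_pos HA.
rewrite -S2 -S1.
pose k := sin A / sin a; pose M := sin A * sin b * sin c; rewrite -/M => EA EB EC.
have M0 : 0 < M by do ?apply: Rmult_lt_0_compat.
have k0 : 0 < k by exact: Rdiv_lt_0_compat.
have kA : sin A = k * sin a by rewrite /k; field; lra.
have kB : sin B = k * sin b.
  apply: (Rmult_eq_reg_r (sin c * sin a)); last by apply: Rgt_not_eq; exact: Rmult_lt_0_compat.
  by rewrite -Rmult_assoc -S1 kA; ring.
have kC : sin C = k * sin c.
  apply: (Rmult_eq_reg_r (sin a * sin b)); last by apply: Rgt_not_eq; exact: Rmult_lt_0_compat.
  by rewrite -Rmult_assoc -S2 -S1 kA; ring.
rewrite (weighted_term _ _ sa k0 M0 kA EA) (weighted_term _ _ sb k0 M0 kB EB)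
  (weighted_term _ _ sc k0 M0 kC EC).
rewrite -/x -/y -/z -!Rmult_plus_distr_l.
apply: Rmult_lt_0_compat; first by apply: Rdiv_lt_0_compat => //; exact: Rpower_pos.
apply: (spherical_form_pos T).
by case: nz => [n|[n|n]]; [left|right; left|right; right]; exact: div_Rpower_neq0.
Qed.

Lemma spherical_monotone_length (p : R) (U V : R -> R)
    (a b c A B C a' b' c' A' B' C' : R) :
  p <= -1 ->
  (forall x, 0 < x < PI -> is_derive U x (Rpower (sin x) (-1 - p))) ->
  (forall x, 0 < x < PI -> is_derive V x (Rpower (sin x) p)) ->
  spherical_triangle a b c A B C -> spherical_triangle a' b' c' A' B' C' ->
  [/\ a' = a, b' = b & c' = c] \/
  0 < (U a' - U a) * (V A' - V A) + (U b' - U b) * (V B' - V B)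
      + (U c' - U c) * (V C' - V C).
Proof.
move=> p1 dU dV T T'.
have dU' x : 0 < x < PI -> is_derive U x (Rpower (sin x) (-1 - p))
    /\ 0 < Rpower (sin x) (-1 - p).
  by move=> Hx; split; [exact: dU | exact: Rpower_pos].
have [Ha Hb Hc HA HB HC LA LB LC] := T.
have [Ha' Hb' Hc' HA' HB' HC' LA' LB' LC'] := T'.
have [a_ [a0 a1 Pa]] := affine_path Ha Ha' dU'.
have [b_ [b0 b1 Pb]] := affine_path Hb Hb' dU'.
have [c_ [c0 c1 Pc]] := affine_path Hc Hc' dU'.
have inj x x' : 0 < x < PI -> 0 < x' < PI -> U x' - U x = 0 -> x' = x.
  by move=> Hx Hx' E; apply: (deriv_pos_injective dU') => //; lra.
move: Pa Pb Pc inj.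
set Da := U a' - U a; set Db := U b' - U b; set Dc := U c' - U c => Pa Pb Pc inj.
case: (zero_or_nonzero3 Da Db Dc) => [[na nb nc]|nz].
  by left; split; exact: inj.
right.
have [t1 t1'] := spherical_inequality T.
have [t2 _] := spherical_inequality (spherical_rot T).
have [t3 _] := spherical_inequality (spherical_rot (spherical_rot T)).
have [s1 s1'] := spherical_inequality T'.
have [s2 _] := spherical_inequality (spherical_rot T').
have [s3 _] := spherical_inequality (spherical_rot (spherical_rot T')).
have Qa t : 0 <= t <= 1 -> 0 < a_ t < PI
    /\ is_derive a_ t (Da / Rpower (sin (a_ t)) (-1 - p)).
  by move=> /Pa[].
have Qb t : 0 <= t <= 1 -> 0 < b_ t < PI
    /\ is_derive b_ t (Db / Rpower (sin (b_ t)) (-1 - p)).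
  by move=> /Pb[].
have Qc t : 0 <= t <= 1 -> 0 < c_ t < PI
    /\ is_derive c_ t (Dc / Rpower (sin (c_ t)) (-1 - p)).
  by move=> /Pc[].
(* The sides have velocity D / sin^q with q = -1 - p, so this sign is what keeps the path
   non-degenerate. *)
have q0 : 0 <= -1 - p by lra.
have i1 := spherical_inequality_path q0 Qa Qb Qc ltac:(lra) ltac:(lra).
have i2 := spherical_inequality_path q0 Qb Qc Qa ltac:(lra) ltac:(lra).
have i3 := spherical_inequality_path q0 Qc Qa Qb ltac:(lra) ltac:(lra).
(* [l -> PI - l] on two sides turns the bound on the perimeter into a triangle inequality. *)
have refl (l : R -> R) D :
  (forall t, 0 <= t <= 1 -> 0 < l t < PI
     /\ is_derive l t (D / Rpower (sin (l t)) (-1 - p))) ->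
  forall t, 0 <= t <= 1 -> 0 < PI - l t < PI
     /\ is_derive (fun s => PI - l s) t (- D / Rpower (sin (PI - l t)) (-1 - p)).
  move=> H t /H[Hl dl]; split; first by lra.
  rewrite Rtrigo_facts.sin_pi_minus.
  apply: is_derive_eq; first exact: (@is_derive_minus _ R_NormedModule _ _ _ _ _
    (@is_derive_const R_AbsRing R_NormedModule PI t) dl).
  by rewrite /minus /plus /opp /zero /=; lra.
have i4 := spherical_inequality_path q0 Qa (refl _ _ Qb) (refl _ _ Qc)
  ltac:(lra) ltac:(lra).
have TT t : 0 <= t <= 1 -> spherical_triangle (a_ t) (b_ t) (c_ t)
   (spherical_angle (a_ t) (b_ t) (c_ t)) (spherical_angle (b_ t) (c_ t) (a_ t))
   (spherical_angle (c_ t) (a_ t) (b_ t)).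
  move=> Ht; have := i1 t Ht; have := i2 t Ht; have := i3 t Ht; have := i4 t Ht.
  have [? _] := Qa t Ht; have [? _] := Qb t Ht; have [? _] := Qc t Ht.
  by move=> *; apply: spherical_triangle_of_lengths; lra.
have exA t : 0 <= t <= 1 ->
  [/\ ex_derive (fun s => spherical_angle (a_ s) (b_ s) (c_ s)) t,
      ex_derive (fun s => spherical_angle (b_ s) (c_ s) (a_ s)) t &
      ex_derive (fun s => spherical_angle (c_ s) (a_ s) (b_ s)) t].
  move=> Ht; have := i1 t Ht; have := i2 t Ht; have := i3 t Ht; have := i4 t Ht.
  have [? da] := Qa t Ht; have [? db] := Qb t Ht; have [? dc] := Qc t Ht.
  by move=> *; split; apply: ex_derive_spherical_angle => //;
    try (by apply: spherical_angle_bound; lra); eexists; eassumption.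
move: TT exA; set A_ := fun s => spherical_angle (a_ s) (b_ s) (c_ s).
set B_ := fun s => spherical_angle (b_ s) (c_ s) (a_ s).
set C_ := fun s => spherical_angle (c_ s) (a_ s) (b_ s) => TT exA.
have A0 : A_ 0 = A by rewrite /A_ a0 b0 c0; exact: spherical_angleE.
have B0 : B_ 0 = B by rewrite /B_ a0 b0 c0; exact: spherical_angleE.
have C0 : C_ 0 = C by rewrite /C_ a0 b0 c0; exact: spherical_angleE.
have A1 : A_ 1 = A' by rewrite /A_ a1 b1 c1; exact: spherical_angleE.
have B1 : B_ 1 = B' by rewrite /B_ a1 b1 c1; exact: spherical_angleE.
have C1 : C_ 1 = C' by rewrite /C_ a1 b1 c1; exact: spherical_angleE.
have [|||t Ht] := @weighted_mean_value (fun x => 0 < x < PI) V _ Da Db Dc A_ B_ C_ dV.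
- by move=> t Ht; have [] := exA t Ht; have [] := TT t Ht.
- by move=> t Ht; have [] := exA t Ht; have [] := TT t Ht.
- by move=> t Ht; have [] := exA t Ht; have [] := TT t Ht.
rewrite A0 B0 C0 A1 B1 C1 => ->.
have Ht' : 0 <= t <= 1 by lra.
have Tt := TT t Ht'; have [eA eB eC] := exA t Ht'.
have [_ da] := Qa t Ht'; have [_ db] := Qb t Ht'; have [_ dc] := Qc t Ht'.
have EA := @spherical_law_derivative a_ b_ c_ A_ B_ C_ t _ _ _ _ Tt
  (locally_inside Ht (fun s Hs => sph_lawA (TT s Hs))) da db dc (Derive_correct _ _ eA).
have EB := @spherical_law_derivative b_ c_ a_ B_ C_ A_ t _ _ _ _ (spherical_rot Tt)
  (locally_inside Ht (fun s Hs => sph_lawB (TT s Hs))) db dc da (Derive_correct _ _ eB).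
have EC := @spherical_law_derivative c_ a_ b_ C_ A_ B_ t _ _ _ _
  (spherical_rot (spherical_rot Tt))
  (locally_inside Ht (fun s Hs => sph_lawC (TT s Hs))) dc da db (Derive_correct _ _ eC).
move: EA EB EC.
move: (Derive A_ t) (Derive B_ t) (Derive C_ t) => A1' B1' C1'.
exact: (spherical_weighted_form_pos Tt nz).
Qed.

(* Polar duality exchanges the exponents [p] and [-1 - p], sides and angles. *)
Lemma spherical_monotone (p : R) (U V : R -> R)
    (a b c A B C a' b' c' A' B' C' : R) :
  p <= -1 \/ 0 <= p ->
  (forall x, 0 < x < PI -> is_derive U x (Rpower (sin x) (-1 - p))) ->
  (forall x, 0 < x < PI -> is_derive V x (Rpower (sin x) p)) ->
  spherical_triangle a b c A B C -> spherical_triangle a' b' c' A' B' C' ->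
  [/\ a' = a, b' = b & c' = c] \/
  0 < (U a' - U a) * (V A' - V A) + (U b' - U b) * (V B' - V B)
      + (U c' - U c) * (V C' - V C).
Proof.
case=> Hp dU dV T T'; first exact: spherical_monotone_length Hp dU dV T T'.
(* By the symmetry of [sin] about PI / 2, reflecting an antiderivative gives another antiderivative
   of the same function. *)
have refl (W : R -> R) q x : (forall x, 0 < x < PI -> is_derive W x (Rpower (sin x) q)) ->
    0 < x < PI -> is_derive (fun y => - W (PI - y)) x (Rpower (sin x) q).
  move=> dW Hx.
  have dW' : is_derive W (PI - x) (Rpower (sin x) q).
    by rewrite -Rtrigo_facts.sin_pi_minus; apply: dW; lra.
  auto_derive; first by exists (Rpower (sin x) q).
  by rewrite (is_derive_unique _ _ _ dW'); lra.
have D := spherical_dual T; have D' := spherical_dual T'.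
have p' : -1 - p <= -1 by lra.
have dV' x : 0 < x < PI ->
    is_derive (fun y => - V (PI - y)) x (Rpower (sin x) (-1 - (-1 - p))).
  by have -> : -1 - (-1 - p) = p by [lra]; exact: refl.
have dU' x : 0 < x < PI -> is_derive (fun y => - U (PI - y)) x (Rpower (sin x) (-1 - p)).
  exact: refl.
have [[EA EB EC]|] := spherical_monotone_length p' dV' dU' D D'.
- left.
  (* Spherical angles determine the sides: in the polar triangle they are the lengths, and the sides
     are recovered there as angles. *)
  have side x y z X Y Z x' y' z' X' Y' Z' : X' = X -> Y' = Y -> Z' = Z ->
      spherical_triangle x y z X Y Z -> spherical_triangle x' y' z' X' Y' Z' -> x' = x.
    move=> -> -> -> /spherical_dual[_ HY HZ Hx _ _ L _ _] /spherical_dual[_ _ _ Hx' _ _ L' _ _].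
    by have := spherical_angleE HY HZ Hx L; rewrite (spherical_angleE HY HZ Hx' L'); lra.
  have [eA eB eC] : [/\ A' = A, B' = B & C' = C] by split; lra.
  split; first exact: side T T'.
  - exact: side (spherical_rot T) (spherical_rot T').
  - exact: side (spherical_rot (spherical_rot T)) (spherical_rot (spherical_rot T')).
- have K x : PI - (PI - x) = x by lra.
  by rewrite !K => ?; right; lra.
Qed.

(** * Euclidean triangles *)

Definition euclidean_law (a b c A : R) : Prop :=
  a ^ 2 = b ^ 2 + c ^ 2 - 2 * b * c * cos A.

Record euclidean_triangle (a b c A B C : R) : Prop := EuclideanTriangle {
  euc_a : 0 < a; euc_b : 0 < b; euc_c : 0 < c;
  euc_A : 0 < A < PI; euc_B : 0 < B < PI; euc_C : 0 < C < PI;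
  euc_lawA : euclidean_law a b c A;
  euc_lawB : euclidean_law b c a B;
  euc_lawC : euclidean_law c a b C }.

Lemma euclidean_rot a b c A B C :
  euclidean_triangle a b c A B C -> euclidean_triangle b c a B C A.
Proof. by case=> *; split. Qed.

Lemma cos_bound_strict (x : R) : 0 < x < PI -> -1 < cos x < 1.
Proof. move=> Hx; have := sin_pos Hx; have := sin2E x; nra. Qed.

(** Heron's formula: both sides are sixteen times the squared area, and the symmetry of the right
    one gives the sine law. *)
Lemma euclidean_area a b c A : euclidean_law a b c A ->
  4 * (b * c * sin A) ^ 2
  = 2 * (a ^ 2 * b ^ 2 + b ^ 2 * c ^ 2 + c ^ 2 * a ^ 2) - (a ^ 4 + b ^ 4 + c ^ 4).
Proof.
move=> L.
have -> : 4 * (b * c * sin A) ^ 2 = 4 * (b * c) ^ 2 * sin A ^ 2 by ring.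
have E : 4 * (b * c) ^ 2 * cos A ^ 2 = (b ^ 2 + c ^ 2 - a ^ 2) ^ 2.
  by rewrite /euclidean_law in L; rewrite L; ring.
rewrite sin2E Rmult_minus_distr_l E; ring.
Qed.

Lemma euclidean_sine a b c A B C : euclidean_triangle a b c A B C ->
  b * c * sin A = c * a * sin B.
Proof.
case=> Ha Hb Hc /sin_pos sA /sin_pos sB _ LA LB _.
apply: eq_of_sqr_eq; do ?[exact: Rmult_lt_0_compat | apply: Rmult_lt_0_compat => //].
by have := euclidean_area LA; have := euclidean_area LB; lra.
Qed.

Lemma euclidean_inequality a b c A B C : euclidean_triangle a b c A B C -> a < b + c.
Proof.
case=> Ha Hb Hc /cos_bound_strict cA _ _ LA _ _.
rewrite /euclidean_law in LA; have := Rmult_lt_0_compat _ _ Hb Hc; nra.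
Qed.

Definition euclidean_angle (a b c : R) : R :=
  acos ((b ^ 2 + c ^ 2 - a ^ 2) / (2 * b * c)).

Lemma euclidean_angle_bound a b c : 0 < a -> 0 < b -> 0 < c ->
  a < b + c -> b < c + a -> c < a + b ->
  -1 < (b ^ 2 + c ^ 2 - a ^ 2) / (2 * b * c) < 1.
Proof.
move=> Ha Hb Hc t1 t2 t3.
have m : 0 < 2 * b * c by nra.
by apply: ratio_in_unit => //; nra.
Qed.

Lemma euclidean_triangle_of_lengths a b c : 0 < a -> 0 < b -> 0 < c ->
  a < b + c -> b < c + a -> c < a + b ->
  euclidean_triangle a b c
    (euclidean_angle a b c) (euclidean_angle b c a) (euclidean_angle c a b).
Proof.
move=> Ha Hb Hc t1 t2 t3.
have law x y z : 0 < x -> 0 < y -> 0 < z -> x < y + z -> y < z + x -> z < x + y ->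
  0 < euclidean_angle x y z < PI /\ euclidean_law x y z (euclidean_angle x y z).
  move=> Hx Hy Hz s1 s2 s3.
  have Bd := euclidean_angle_bound Hx Hy Hz s1 s2 s3.
  split; first exact: acos_bound_lt.
  by rewrite /euclidean_law cos_acos; [field; lra | lra].
have [A1 A2] := @law a b c Ha Hb Hc t1 t2 t3.
have [B1 B2] := @law b c a Hb Hc Ha t2 t3 t1.
have [C1 C2] := @law c a b Hc Ha Hb t3 t1 t2.
by split.
Qed.

Lemma euclidean_angleE a b c A : 0 < b -> 0 < c -> 0 < A < PI ->
  euclidean_law a b c A -> euclidean_angle a b c = A.
Proof.
move=> Hb Hc HA L; apply: acos_unique => //.
by rewrite L; field; lra.
Qed.

Lemma ex_derive_euclidean_angle (a b c : R -> R) (t : R) :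
  0 < b t -> 0 < c t ->
  -1 < (b t ^ 2 + c t ^ 2 - a t ^ 2) / (2 * b t * c t) < 1 ->
  ex_derive a t -> ex_derive b t -> ex_derive c t ->
  ex_derive (fun s => euclidean_angle (a s) (b s) (c s)) t.
Proof.
move=> Hb Hc Bd da db dc; rewrite /euclidean_angle.
apply: (@ex_derive_comp R_AbsRing R_NormedModule acos); first exact: ex_derive_acos.
auto_derive; do ?split => //.
by apply: Rgt_not_eq; nra.
Qed.

Lemma euclidean_law_derivative (a b c A B C : R -> R) (t a' b' c' A' : R) :
  euclidean_triangle (a t) (b t) (c t) (A t) (B t) (C t) ->
  locally t (fun s => euclidean_law (a s) (b s) (c s) (A s)) ->
  is_derive a t a' -> is_derive b t b' -> is_derive c t c' -> is_derive A t A' ->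
  b t * c t * sin (A t) * A' = a t * (a' - cos (C t) * b' - cos (B t) * c').
Proof.
move=> T loc da db dc dA.
have [Ha Hb Hc _ _ _ LA LB LC] := T.
pose F s := b s ^ 2 + c s ^ 2 - 2 * b s * c s * cos (A s) - a s ^ 2.
have dF0 : is_derive F t 0.
  apply: (is_derive_ext_loc (fun=> 0)).
    by apply: filter_imp loc => s; rewrite /euclidean_law /F => ->; lra.
  exact: (@is_derive_const R_AbsRing R_NormedModule).
have dF1 : is_derive F t
  (2 * (b t * b' + c t * c' - (b' * c t + b t * c') * cos (A t)
     + b t * c t * sin (A t) * A' - a t * a')).
  rewrite /F; auto_derive.
    by do ?split; eexists; eassumption.
  rewrite (is_derive_unique _ _ _ da) (is_derive_unique _ _ _ db)
    (is_derive_unique _ _ _ dc) (is_derive_unique _ _ _ dA); ring.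
have E := is_derive_unique _ _ _ dF1.
rewrite (is_derive_unique _ _ _ dF0) in E.
rewrite /euclidean_law in LA LB LC.
(* The projection formulas of the Euclidean triangle, each obtained from two cosine laws. *)
have F1 : b t - c t * cos (A t) = a t * cos (C t).
  by apply: (Rmult_eq_reg_l (2 * b t)); lra.
have F2 : c t - b t * cos (A t) = a t * cos (B t).
  by apply: (Rmult_eq_reg_l (2 * c t)); lra.
have -> : a t * (a' - cos (C t) * b' - cos (B t) * c')
  = a t * a' - (a t * cos (C t)) * b' - (a t * cos (B t)) * c' by ring.
rewrite -F1 -F2; lra.
Qed.

(** The form is only semidefinite: it is the sum of two squares, and both vanish exactly along the
    vector of side lengths. *)
Lemma euclidean_form_pos a b c A B C x y z :
  euclidean_triangle a b c A B C ->
  (exists k, [/\ x = k * a, y = k * b & z = k * c]) \/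
  0 < x * (x - cos C * y - cos B * z) + y * (y - cos A * z - cos C * x)
      + z * (z - cos B * x - cos A * y).
Proof.
move=> T; have [Ha Hb Hc HA HB HC LA LB LC] := T.
have sA := sin_pos HA; have sB := sin_pos HB; have sC := sin_pos HC.
have S1 := euclidean_sine T; have S2 := euclidean_sine (euclidean_rot T).
have G := euclidean_area LA.
rewrite /euclidean_law in LA LB LC.
(* This is A + B + C = PI in cosine form, derived from the cosine laws and Heron's formula without
   adding angles. *)
have dual : cos A + cos B * cos C = sin B * sin C.
  apply: (Rmult_eq_reg_l (4 * (a ^ 2 * b * c))); last first.
    by apply: Rgt_not_eq; do ?apply: Rmult_lt_0_compat => //; nra.
  have -> : 4 * (a ^ 2 * b * c) * (sin B * sin C) = 4 * ((c * a * sin B) * (a * b * sin C)).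
    by ring.
  rewrite -S2 -S1.
  have -> : 4 * (b * c * sin A * (b * c * sin A)) = 4 * (b * c * sin A) ^ 2 by ring.
  rewrite G.
  have -> : 4 * (a ^ 2 * b * c) * (cos A + cos B * cos C)
    = 2 * a ^ 2 * (2 * b * c * cos A) + (2 * c * a * cos B) * (2 * a * b * cos C) by ring.
  have -> : 2 * b * c * cos A = b ^ 2 + c ^ 2 - a ^ 2 by lra.
  have -> : 2 * c * a * cos B = c ^ 2 + a ^ 2 - b ^ 2 by lra.
  have -> : 2 * a * b * cos C = a ^ 2 + b ^ 2 - c ^ 2 by lra.
  ring.
have -> : x * (x - cos C * y - cos B * z) + y * (y - cos A * z - cos C * x)
      + z * (z - cos B * x - cos A * y)
  = (x - cos C * y - cos B * z) ^ 2 + (sin C * y - sin B * z) ^ 2.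
  have -> : (sin C * y - sin B * z) ^ 2
    = sin C ^ 2 * y ^ 2 + sin B ^ 2 * z ^ 2 - 2 * (sin B * sin C) * y * z by ring.
  by rewrite -dual !sin2E; ring.
have n1 := pow2_ge_0 (x - cos C * y - cos B * z).
have n2 := pow2_ge_0 (sin C * y - sin B * z).
case: (Req_dec (x - cos C * y - cos B * z) 0) => E1; last first.
  by right; have := pow2_gt_0 _ E1; lra.
case: (Req_dec (sin C * y - sin B * z) 0) => E2; last first.
  by right; have := pow2_gt_0 _ E2; lra.
(* With both squares zero, the sine law gives y : z = b : c, and then a = b cos C + c cos B gives
   x. *)
left; exists (z / c).
have Ez : z = z / c * c by field; lra.
have Ey : y = z / c * b.
  apply: (Rmult_eq_reg_l (a * sin C)); last first.
    by apply: Rgt_not_eq; exact: Rmult_lt_0_compat.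
  have -> : a * sin C * y = a * (sin B * z) by rewrite Rmult_assoc; congr (_ * _); lra.
  have -> : a * sin C * (z / c * b) = (a * b * sin C) * z / c by field; lra.
  by rewrite -S2; field; lra.
split => //.
have proj : b * cos C + c * cos B = a by apply: (Rmult_eq_reg_l (2 * a)); lra.
have -> : x = cos C * y + cos B * z by lra.
by rewrite {1}Ey {2}Ez -proj; ring.
Qed.

Lemma euclidean_weighted_form_pos (p Da Db Dc dA dB dC : R) a b c A B C :
  euclidean_triangle a b c A B C ->
  let x := Da / Rpower a (-1 - p) in
  let y := Db / Rpower b (-1 - p) in
  let z := Dc / Rpower c (-1 - p) in
  b * c * sin A * dA = a * (x - cos C * y - cos B * z) ->
  c * a * sin B * dB = b * (y - cos A * z - cos C * x) ->
  a * b * sin C * dC = c * (z - cos B * x - cos A * y) ->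
  (exists k, [/\ x = k * a, y = k * b & z = k * c]) \/
  0 < Da * (dA * Rpower (sin A) p) + Db * (dB * Rpower (sin B) p)
      + Dc * (dC * Rpower (sin C) p).
Proof.
move=> T x y z.
have S1 := euclidean_sine T; have S2 := euclidean_sine (euclidean_rot T).
have [Ha Hb Hc /sin_pos sA /sin_pos sB /sin_pos sC _ _ _] := T.
rewrite -S2 -S1.
pose k := sin A / a; pose M := b * c * sin A; rewrite -/M => EA EB EC.
have M0 : 0 < M by do ?apply: Rmult_lt_0_compat.
have k0 : 0 < k by exact: Rdiv_lt_0_compat.
have kA : sin A = k * a by rewrite /k; field; lra.
have kB : sin B = k * b.
  apply: (Rmult_eq_reg_l (c * a)); last by apply: Rgt_not_eq; exact: Rmult_lt_0_compat.
  by rewrite -S1 kA; ring.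
have kC : sin C = k * c.
  apply: (Rmult_eq_reg_l (a * b)); last by apply: Rgt_not_eq; exact: Rmult_lt_0_compat.
  by rewrite -S2 -S1 kA; ring.
rewrite (weighted_term _ _ Ha k0 M0 kA EA) (weighted_term _ _ Hb k0 M0 kB EB)
  (weighted_term _ _ Hc k0 M0 kC EC).
rewrite -/x -/y -/z -!Rmult_plus_distr_l.
case: (euclidean_form_pos x y z T) => [H|H]; [by left | right].
by apply: Rmult_lt_0_compat => //; apply: Rdiv_lt_0_compat => //; exact: Rpower_pos.
Qed.

Lemma Rpower_scaling (x y q m : R) :
  0 < x -> 0 < y -> 0 < q -> Rpower y q = m * Rpower x q ->
  0 < m /\ y = Rpower m (/ q) * x.
Proof.
move=> Hx Hy Hq E.
have m0 : 0 < m by have := Rpower_pos x q; have := Rpower_pos y q; nra.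
split=> //.
have inv u : 0 < u -> u = Rpower (Rpower u q) (/ q).
  by move=> Hu; rewrite Rpower_mult Rinv_r ?Rpower_1 //; lra.
rewrite (inv y Hy) E -Rpower_mult_distr //; last exact: Rpower_pos.
by rewrite -(inv x Hx).
Qed.

(** Here x and y are positions of one side at times differing by s, on a path whose q-th power is
    affine in time. If the velocity at x is k x, then y^q = (1 + s q k) x^q, and this factor does
    not depend on the side. *)
Lemma power_path_scaling (q x y s D k : R) :
  0 < x -> 0 < y -> 0 < q ->
  Rpower y q / q = Rpower x q / q + s * D -> D / Rpower x (q - 1) = k * x ->
  0 < 1 + s * q * k /\ y = Rpower (1 + s * q * k) (/ q) * x.
Proof.
move=> Hx Hy Hq E ED; apply: Rpower_scaling => //.
have Px : Rpower x q = Rpower x (q - 1) * x.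
  by rewrite -{3}(Rpower_1 x) // -Rpower_plus; congr Rpower; lra.
have P := Rpower_pos x (q - 1).
have -> : Rpower y q = Rpower y q / q * q by field; lra.
rewrite E.
have -> : D = k * Rpower x q.
  by rewrite Px -Rmult_assoc (Rmult_comm k) Rmult_assoc -ED; field; lra.
by field; lra.
Qed.

Lemma euclidean_similar a b c A B C a' b' c' A' B' C' k :
  euclidean_triangle a b c A B C -> euclidean_triangle a' b' c' A' B' C' ->
  0 < k -> a' = k * a -> b' = k * b -> c' = k * c -> A' = A.
Proof.
move=> [Ha Hb Hc HA _ _ L _ _] [Ha' Hb' Hc' HA' _ _ L' _ _] k0 ea eb ec.
rewrite -(euclidean_angleE Hb Hc HA L) -(euclidean_angleE Hb' Hc' HA' L').
by rewrite ea eb ec /euclidean_angle; congr acos; field; lra.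
Qed.

(** The inequality at a critical point is Cauchy-Schwarz for (y2 + y3)^2 / (l2 + l3), with equality
    when the velocities are proportional to the lengths. The explicit formula for the path is
    assumed here in order to exclude that case. *)
Lemma euclidean_inequality_path (q D1 D2 D3 M : R) (l1 l2 l3 : R -> R) :
  let v D (l : R -> R) t := D / Rpower (l t) q in
  let path D l := forall t, 0 <= t <= 1 ->
    [/\ 0 < l t < M, Rpower (l t) (q + 1) / (q + 1) = Rpower (l 0) (q + 1) / (q + 1) + t * D
      & is_derive l t (v D l t)] in
  0 <= q -> path D1 l1 -> path D2 l2 -> path D3 l3 ->
  l1 0 < l2 0 + l3 0 -> l1 1 < l2 1 + l3 1 ->
  forall t, 0 <= t <= 1 -> l1 t < l2 t + l3 t.
Proof.
move=> v path q0 P1 P2 P3 t0 t1.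
have weak D l : path D l ->
    forall t, 0 <= t <= 1 -> 0 < l t < M /\ is_derive l t (v D l t).
  by move=> P t /P[].
apply: (triangle_inequality_path (g := id) (g' := fun=> 1) q0 _
  (weak _ _ P1) (weak _ _ P2) (weak _ _ P3)) => //.
  move=> x [Hx _]; split => //; exact: (@is_derive_id R_AbsRing).
move=> t Ht le E nz.
have I0 : 0 <= 0 <= 1 by lra.
have It : 0 <= t <= 1 by lra.
have [[L1 _] E1 _] := P1 t It; have [[L2 _] E2 _] := P2 t It; have [[L3 _] E3 _] := P3 t It.
have [[K1 _] _ _] := P1 0 I0; have [[K2 _] _ _] := P2 0 I0; have [[K3 _] _ _] := P3 0 I0.
move: E nz E1 E2 E3.
rewrite -/(v D1 l1 t) -/(v D2 l2 t) -/(v D3 l3 t) /id.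
move=> E nz E1 E2 E3.
set y2 := v D2 l2 t in E nz *; set y3 := v D3 l3 t in E nz *.
(* The gap in Cauchy-Schwarz is itself a square, so equality forces y2 l3 = y3 l2. *)
have split_square : 1 / l2 t * y2 ^ 2 + 1 / l3 t * y3 ^ 2 - 1 / (l2 t + l3 t) * (y2 + y3) ^ 2
    = (y2 * l3 t - y3 * l2 t) ^ 2 / (l2 t * l3 t * (l2 t + l3 t)) by field; lra.
have sq_pos : 0 < (y2 + y3) ^ 2 \/ y2 + y3 = 0.
  by case: (Req_dec (y2 + y3) 0) => H; [right | left; exact: pow2_gt_0].
have den : 0 < l2 t * l3 t * (l2 t + l3 t) by do ?apply: Rmult_lt_0_compat; lra.
have inv_le : 1 / l1 t <= 1 / (l2 t + l3 t).
  by rewrite /Rdiv !Rmult_1_l; apply: Rinv_le_contravar; lra.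
have sq_le : 1 / l1 t * (y2 + y3) ^ 2 <= 1 / (l2 t + l3 t) * (y2 + y3) ^ 2.
  by apply: Rmult_le_compat_r => //; exact: pow2_ge_0.
rewrite E.
case: (Req_dec (y2 * l3 t - y3 * l2 t) 0) => cross; last first.
  have := Rdiv_lt_0_compat _ _ (pow2_gt_0 _ cross) den; lra.
case: (Rle_lt_or_eq_dec _ _ le) => [lt|eq].
  have inv_lt : 1 / l1 t < 1 / (l2 t + l3 t).
    by rewrite /Rdiv !Rmult_1_l; apply: Rinv_lt_contravar => //; apply: Rmult_lt_0_compat; lra.
  (* Proportional velocities of zero sum would both vanish, because the lengths are positive. *)
  have n0 : y2 + y3 <> 0.
    move=> s0; have y3E : y3 = - y2 by lra.
    have : y2 * (l2 t + l3 t) = 0 by rewrite y3E in cross; lra.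
    case/Rmult_integral => [y20|]; last by lra.
    by case: nz => n; apply: n; lra.
  have := Rmult_lt_compat_r _ _ _ (pow2_gt_0 _ n0) inv_lt.
  have := Rdiv_le_0_compat _ _ (pow2_ge_0 (y2 * l3 t - y3 * l2 t)) den; lra.
(* Now the velocity is a multiple of the lengths, so the triangle is only rescaled
   along the path and it was already degenerate at time [0]. *)
exfalso.
pose k := y2 / l2 t.
have e2 : y2 = k * l2 t by rewrite /k; field; lra.
have e3 : y3 = k * l3 t.
  by apply: (Rmult_eq_reg_l (l2 t)); [rewrite /k; field_simplify; lra | lra].
have e1 : v D1 l1 t = k * l1 t by rewrite E e2 e3 -eq; ring.
have qq : q = q + 1 - 1 by lra.
have q1 : 0 < q + 1 by lra.
have back D l : path D l -> v D l t = k * l t -> l 0 = Rpower (1 + - t * (q + 1) * k) (/ (q + 1)) * l t.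
  move=> P e; have [[Lt _] EU _] := P t It; have [[Ks _] _ _] := P 0 I0.
  have [||] // := @power_path_scaling (q + 1) (l t) (l 0) (- t) D k Lt Ks q1.
  - by rewrite EU; lra.
  - by rewrite -qq.
rewrite (back _ _ P1 e1) (back _ _ P2 e2) (back _ _ P3 e3) -eq in t0; lra.
Qed.

(** The antiderivative [U] is written as an explicit power, because the scaling alternative uses the
    closed form of the path. *)
Lemma euclidean_monotone (p : R) (V : R -> R)
    (a b c A B C a' b' c' A' B' C' : R) :
  let U x := Rpower x (- p) / - p in
  p <= -1 ->
  (forall x, 0 < x < PI -> is_derive V x (Rpower (sin x) p)) ->
  euclidean_triangle a b c A B C -> euclidean_triangle a' b' c' A' B' C' ->
  (exists2 k, 0 < k & [/\ a' = k * a, b' = k * b & c' = k * c]) \/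
  0 < (U a' - U a) * (V A' - V A) + (U b' - U b) * (V B' - V B)
      + (U c' - U c) * (V C' - V C).
Proof.
move=> U p1 dV T T'.
have q0 : 0 <= -1 - p by lra.
have qE : - p = -1 - p + 1 by lra.
have dU M x : 0 < x < M -> is_derive U x (Rpower x (-1 - p)) /\ 0 < Rpower x (-1 - p).
  move=> [Hx _]; split; last exact: Rpower_pos.
  have d : is_derive (fun t => Rpower t (- p)) x (- p * (1 / x) * Rpower x (- p)).
    exact: (is_derive_Rpower (g := id) _ Hx (@is_derive_id R_AbsRing x)).
  apply: is_derive_eq.
    apply: (is_derive_ext (fun t => / - p * Rpower t (- p))).
      by move=> t; rewrite /U /Rdiv Rmult_comm.
    exact: is_derive_scal d.
  have -> : Rpower x (- p) = Rpower x (-1 - p) * x.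
    by rewrite -{3}(Rpower_1 x) // -Rpower_plus; congr Rpower; lra.
  by field; lra.
have [Ha Hb Hc HA HB HC LA LB LC] := T.
have [Ha' Hb' Hc' HA' HB' HC' LA' LB' LC'] := T'.
(* Any bound larger than all six sides would do; it only supplies a bounded interval to
   [affine_path]. *)
pose M := a + b + c + a' + b' + c'.
have [a_ [a0 a1 Pa]] := @affine_path U _ 0 M a a' ltac:(rewrite /M; lra)
  ltac:(rewrite /M; lra) (dU M).
have [b_ [b0 b1 Pb]] := @affine_path U _ 0 M b b' ltac:(rewrite /M; lra)
  ltac:(rewrite /M; lra) (dU M).
have [c_ [c0 c1 Pc]] := @affine_path U _ 0 M c c' ltac:(rewrite /M; lra)
  ltac:(rewrite /M; lra) (dU M).
move: Pa Pb Pc.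
set Da := U a' - U a; set Db := U b' - U b; set Dc := U c' - U c => Pa Pb Pc.
have t1 := euclidean_inequality T.
have t2 := euclidean_inequality (euclidean_rot T).
have t3 := euclidean_inequality (euclidean_rot (euclidean_rot T)).
have s1 := euclidean_inequality T'.
have s2 := euclidean_inequality (euclidean_rot T').
have s3 := euclidean_inequality (euclidean_rot (euclidean_rot T')).
have path l x D : l 0 = x -> (forall t, 0 <= t <= 1 ->
    [/\ 0 < l t < M, U (l t) = U x + t * D & is_derive l t (D / Rpower (l t) (-1 - p))]) ->
  forall t, 0 <= t <= 1 ->
    [/\ 0 < l t < M,
     Rpower (l t) (-1 - p + 1) / (-1 - p + 1)
       = Rpower (l 0) (-1 - p + 1) / (-1 - p + 1) + t * D
     & is_derive l t (D / Rpower (l t) (-1 - p))].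
  by move=> <- P t /P; rewrite -qE.
have Qa := path _ _ _ a0 Pa; have Qb := path _ _ _ b0 Pb; have Qc := path _ _ _ c0 Pc.
have i1 := euclidean_inequality_path q0 Qa Qb Qc ltac:(lra) ltac:(lra).
have i2 := euclidean_inequality_path q0 Qb Qc Qa ltac:(lra) ltac:(lra).
have i3 := euclidean_inequality_path q0 Qc Qa Qb ltac:(lra) ltac:(lra).
have TT t : 0 <= t <= 1 -> euclidean_triangle (a_ t) (b_ t) (c_ t)
   (euclidean_angle (a_ t) (b_ t) (c_ t)) (euclidean_angle (b_ t) (c_ t) (a_ t))
   (euclidean_angle (c_ t) (a_ t) (b_ t)).
  move=> Ht; have := i1 t Ht; have := i2 t Ht; have := i3 t Ht.
  have [? _ _] := Qa t Ht; have [? _ _] := Qb t Ht; have [? _ _] := Qc t Ht.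
  by move=> *; apply: euclidean_triangle_of_lengths; lra.
have exA t : 0 <= t <= 1 ->
  [/\ ex_derive (fun s => euclidean_angle (a_ s) (b_ s) (c_ s)) t,
      ex_derive (fun s => euclidean_angle (b_ s) (c_ s) (a_ s)) t &
      ex_derive (fun s => euclidean_angle (c_ s) (a_ s) (b_ s)) t].
  move=> Ht; have := i1 t Ht; have := i2 t Ht; have := i3 t Ht.
  have [? _ da] := Qa t Ht; have [? _ db] := Qb t Ht; have [? _ dc] := Qc t Ht.
  by move=> *; split; apply: ex_derive_euclidean_angle; try lra;
    try (by apply: euclidean_angle_bound; lra); eexists; eassumption.
move: TT exA; set A_ := fun s => euclidean_angle (a_ s) (b_ s) (c_ s).
set B_ := fun s => euclidean_angle (b_ s) (c_ s) (a_ s).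
set C_ := fun s => euclidean_angle (c_ s) (a_ s) (b_ s) => TT exA.
have A0 : A_ 0 = A by rewrite /A_ a0 b0 c0; exact: euclidean_angleE.
have B0 : B_ 0 = B by rewrite /B_ a0 b0 c0; exact: euclidean_angleE.
have C0 : C_ 0 = C by rewrite /C_ a0 b0 c0; exact: euclidean_angleE.
have A1 : A_ 1 = A' by rewrite /A_ a1 b1 c1; exact: euclidean_angleE.
have B1 : B_ 1 = B' by rewrite /B_ a1 b1 c1; exact: euclidean_angleE.
have C1 : C_ 1 = C' by rewrite /C_ a1 b1 c1; exact: euclidean_angleE.
have [|||t Ht] := @weighted_mean_value (fun x => 0 < x < PI) V _ Da Db Dc A_ B_ C_ dV.
- by move=> t Ht; have [] := exA t Ht; have [] := TT t Ht.
- by move=> t Ht; have [] := exA t Ht; have [] := TT t Ht.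
- by move=> t Ht; have [] := exA t Ht; have [] := TT t Ht.
rewrite A0 B0 C0 A1 B1 C1 => ->.
have Ht' : 0 <= t <= 1 by lra.
have Tt := TT t Ht'; have [eA eB eC] := exA t Ht'.
have [_ _ da] := Qa t Ht'; have [_ _ db] := Qb t Ht'; have [_ _ dc] := Qc t Ht'.
have EA := @euclidean_law_derivative a_ b_ c_ A_ B_ C_ t _ _ _ _ Tt
  (locally_inside Ht (fun s Hs => euc_lawA (TT s Hs))) da db dc (Derive_correct _ _ eA).
have EB := @euclidean_law_derivative b_ c_ a_ B_ C_ A_ t _ _ _ _ (euclidean_rot Tt)
  (locally_inside Ht (fun s Hs => euc_lawB (TT s Hs))) db dc da (Derive_correct _ _ eB).
have EC := @euclidean_law_derivative c_ a_ b_ C_ A_ B_ t _ _ _ _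
  (euclidean_rot (euclidean_rot Tt))
  (locally_inside Ht (fun s Hs => euc_lawC (TT s Hs))) dc da db (Derive_correct _ _ eC).
have [[k [ka kb kc]]|] := euclidean_weighted_form_pos Tt EA EB EC; last by right.
left.
(* The form vanished, so at the mean-value time t the velocities are k times the lengths. The power
   formula then makes the triangle at every time s a rescaling of the one at time t. *)
have scale l D s : 0 <= s <= 1 -> (forall t, 0 <= t <= 1 ->
    [/\ 0 < l t < M,
     Rpower (l t) (-1 - p + 1) / (-1 - p + 1)
       = Rpower (l 0) (-1 - p + 1) / (-1 - p + 1) + t * D
     & is_derive l t (D / Rpower (l t) (-1 - p))]) ->
  D / Rpower (l t) (-1 - p) = k * l t ->
  0 < 1 + (s - t) * (-1 - p + 1) * k
  /\ l s = Rpower (1 + (s - t) * (-1 - p + 1) * k) (/ (-1 - p + 1)) * l t.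
  move=> Hs P e; have [[Lt _] Et _] := P t Ht'; have [[Ls _] Es _] := P s Hs.
  have q1 : 0 < -1 - p + 1 by lra.
  apply: (@power_path_scaling _ (l t) (l s) (s - t) D k Lt Ls q1).
    by rewrite Es Et; lra.
  by rewrite (_ : -1 - p + 1 - 1 = -1 - p) //; lra.
have I0 : 0 <= 0 <= 1 by lra.
have I1 : 0 <= 1 <= 1 by lra.
have [_ fa0] := scale _ _ 0 I0 Qa ka; have [_ fa1] := scale _ _ 1 I1 Qa ka.
have [_ fb0] := scale _ _ 0 I0 Qb kb; have [_ fb1] := scale _ _ 1 I1 Qb kb.
have [_ fc0] := scale _ _ 0 I0 Qc kc; have [_ fc1] := scale _ _ 1 I1 Qc kc.
move: fa0 fa1 fb0 fb1 fc0 fc1; rewrite a0 a1 b0 b1 c0 c1.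
set k0 := Rpower (1 + (0 - t) * _ * _) _; set k1 := Rpower (1 + (1 - t) * _ * _) _.
move=> -> -> -> -> -> ->.
have P0 : 0 < k0 by exact: Rpower_pos.
have P1 : 0 < k1 by exact: Rpower_pos.
(* Both end triangles are compared with the one at time t, hence the quotient of their two
   factors. *)
by exists (k1 / k0); [exact: Rdiv_lt_0_compat | split; field; lra].
Qed.

(** * Hyperbolic triangles *)

Definition hyperbolic_law (a b c A : R) : Prop :=
  cosh a = cosh b * cosh c - sinh b * sinh c * cos A.

Record hyperbolic_triangle (a b c A B C : R) : Prop := HyperbolicTriangle {
  hyp_a : 0 < a; hyp_b : 0 < b; hyp_c : 0 < c;
  hyp_A : 0 < A < PI; hyp_B : 0 < B < PI; hyp_C : 0 < C < PI;
  hyp_lawA : hyperbolic_law a b c A;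
  hyp_lawB : hyperbolic_law b c a B;
  hyp_lawC : hyperbolic_law c a b C }.

Definition hyperbolic_dual_law (a A B C : R) : Prop :=
  cosh a * sin B * sin C = cos A + cos B * cos C.

(* Keeps only the laws giving the sides from the angles: on a path of angles the sides
   are defined by them. *)
Record hyperbolic_dual_triangle (a b c A B C : R) : Prop := HyperbolicDualTriangle {
  hypd_a : 0 < a; hypd_b : 0 < b; hypd_c : 0 < c;
  hypd_A : 0 < A < PI; hypd_B : 0 < B < PI; hypd_C : 0 < C < PI;
  hypd_lawA : hyperbolic_dual_law a A B C;
  hypd_lawB : hyperbolic_dual_law b B C A;
  hypd_lawC : hyperbolic_dual_law c C A B }.

Lemma hyperbolic_rot a b c A B C :
  hyperbolic_triangle a b c A B C -> hyperbolic_triangle b c a B C A.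
Proof. by case=> *; split. Qed.

Lemma hyperbolic_dual_rot a b c A B C :
  hyperbolic_dual_triangle a b c A B C -> hyperbolic_dual_triangle b c a B C A.
Proof. by case=> *; split. Qed.

Lemma sinh2E (x : R) : sinh x ^ 2 = cosh x ^ 2 - 1.
Proof. by rewrite cosh2E; lra. Qed.

Lemma hyperbolic_gram a b c A : hyperbolic_law a b c A ->
  (sin A * sinh b * sinh c) ^ 2
  = 1 - cosh a ^ 2 - cosh b ^ 2 - cosh c ^ 2 + 2 * cosh a * cosh b * cosh c.
Proof.
move=> L.
have -> : (sin A * sinh b * sinh c) ^ 2 = sin A ^ 2 * (sinh b ^ 2 * sinh c ^ 2) by ring.
have E : sinh b ^ 2 * sinh c ^ 2 * cos A ^ 2 = (cosh b * cosh c - cosh a) ^ 2.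
  by rewrite /hyperbolic_law in L; rewrite L; ring.
rewrite sin2E Rmult_minus_distr_r (Rmult_comm (cos A ^ 2)) E !sinh2E; ring.
Qed.

Lemma hyperbolic_sine a b c A B C : hyperbolic_triangle a b c A B C ->
  sin A * sinh b * sinh c = sin B * sinh c * sinh a.
Proof.
case=> /sinh_pos Ha /sinh_pos Hb /sinh_pos Hc /sin_pos HA /sin_pos HB _ LA LB _.
apply: eq_of_sqr_eq; try by product_pos.
rewrite (hyperbolic_gram LA) (hyperbolic_gram LB); ring.
Qed.

Lemma hyperbolic_dual_lawA a b c A B C : hyperbolic_triangle a b c A B C ->
  hyperbolic_dual_law a A B C.
Proof.
move=> T; have [/sinh_pos sa /sinh_pos sb /sinh_pos sc HA HB HC LA LB LC] := T.
have S1 := hyperbolic_sine T; have S2 := hyperbolic_sine (hyperbolic_rot T).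
have G := hyperbolic_gram LA.
rewrite /hyperbolic_law in LA LB LC.
have m : 0 < sinh a ^ 2 * sinh b * sinh c by product_pos; nra.
apply: (Rmult_eq_reg_l (sinh a ^ 2 * sinh b * sinh c)); last by lra.
have -> : sinh a ^ 2 * sinh b * sinh c * (cos A + cos B * cos C)
  = sinh a ^ 2 * (sinh b * sinh c * cos A)
    + (sinh c * sinh a * cos B) * (sinh a * sinh b * cos C) by ring.
have -> : sinh b * sinh c * cos A = cosh b * cosh c - cosh a by lra.
have -> : sinh c * sinh a * cos B = cosh c * cosh a - cosh b by lra.
have -> : sinh a * sinh b * cos C = cosh a * cosh b - cosh c by lra.
have -> : sinh a ^ 2 * sinh b * sinh c * (cosh a * sin B * sin C)
  = cosh a * ((sin B * sinh c * sinh a) * (sin C * sinh a * sinh b)) by ring.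
rewrite -S2 -S1.
have -> : sin A * sinh b * sinh c * (sin A * sinh b * sinh c)
  = (sin A * sinh b * sinh c) ^ 2 by ring.
rewrite G sinh2E; ring.
Qed.

Lemma hyperbolic_triangle_dual a b c A B C :
  hyperbolic_triangle a b c A B C -> hyperbolic_dual_triangle a b c A B C.
Proof.
move=> T; have [Ha Hb Hc HA HB HC _ _ _] := T.
split => //; first exact: hyperbolic_dual_lawA T.
- exact: hyperbolic_dual_lawA (hyperbolic_rot T).
- exact: hyperbolic_dual_lawA (hyperbolic_rot (hyperbolic_rot T)).
Qed.

Lemma hyperbolic_inequality a b c A B C : hyperbolic_triangle a b c A B C -> a < b + c.
Proof.
case=> Ha Hb Hc /cos_bound_strict cA _ _ LA _ _.
apply: cosh_lt_rev; try lra.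
rewrite cosh_add LA.
have := Rmult_lt_0_compat _ _ (sinh_pos Hb) (sinh_pos Hc); nra.
Qed.

Definition hyperbolic_angle (a b c : R) : R :=
  acos ((cosh b * cosh c - cosh a) / (sinh b * sinh c)).

Lemma hyperbolic_angle_bound a b c : 0 < a -> 0 < b -> 0 < c ->
  a < b + c -> b < c + a -> c < a + b ->
  -1 < (cosh b * cosh c - cosh a) / (sinh b * sinh c) < 1.
Proof.
move=> Ha Hb Hc t1 t2 t3.
have m := Rmult_lt_0_compat _ _ (sinh_pos Hb) (sinh_pos Hc).
have H1 := @cosh_lt a (b + c) ltac:(lra); rewrite cosh_add in H1.
have H2 : cosh b * cosh c - sinh b * sinh c < cosh a.
  case: (Rle_lt_dec c b) => bc.
    have := @cosh_lt (b + - c) a ltac:(lra).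
    by rewrite cosh_add cosh_opp sinh_opp; lra.
  have := @cosh_lt (c + - b) a ltac:(lra).
  by rewrite cosh_add cosh_opp sinh_opp; lra.
by apply: ratio_in_unit => //; lra.
Qed.

Lemma hyperbolic_triangle_of_lengths a b c : 0 < a -> 0 < b -> 0 < c ->
  a < b + c -> b < c + a -> c < a + b ->
  hyperbolic_triangle a b c
    (hyperbolic_angle a b c) (hyperbolic_angle b c a) (hyperbolic_angle c a b).
Proof.
move=> Ha Hb Hc t1 t2 t3.
have law x y z : 0 < x -> 0 < y -> 0 < z -> x < y + z -> y < z + x -> z < x + y ->
  0 < hyperbolic_angle x y z < PI /\ hyperbolic_law x y z (hyperbolic_angle x y z).
  move=> Hx Hy Hz s1 s2 s3.
  have Bd := hyperbolic_angle_bound Hx Hy Hz s1 s2 s3.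
  split; first exact: acos_bound_lt.
  have sy := sinh_pos Hy; have sz := sinh_pos Hz.
  by rewrite /hyperbolic_law cos_acos; [field; lra | lra].
have [A1 A2] := @law a b c Ha Hb Hc t1 t2 t3.
have [B1 B2] := @law b c a Hb Hc Ha t2 t3 t1.
have [C1 C2] := @law c a b Hc Ha Hb t3 t1 t2.
by split.
Qed.

Lemma hyperbolic_angleE a b c A : 0 < b -> 0 < c -> 0 < A < PI ->
  hyperbolic_law a b c A -> hyperbolic_angle a b c = A.
Proof.
move=> /sinh_pos Hb /sinh_pos Hc HA L; apply: acos_unique => //.
by rewrite L; field; lra.
Qed.

Lemma ex_derive_hyperbolic_angle (a b c : R -> R) (t : R) :
  0 < b t -> 0 < c t ->
  -1 < (cosh (b t) * cosh (c t) - cosh (a t)) / (sinh (b t) * sinh (c t)) < 1 ->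
  ex_derive a t -> ex_derive b t -> ex_derive c t ->
  ex_derive (fun s => hyperbolic_angle (a s) (b s) (c s)) t.
Proof.
move=> /sinh_pos Hb /sinh_pos Hc Bd da db dc; rewrite /hyperbolic_angle.
apply: (@ex_derive_comp R_AbsRing R_NormedModule acos); first exact: ex_derive_acos.
auto_derive; do ?split => //.
by apply: Rgt_not_eq; nra.
Qed.

(** Since cosh a > 1, the dual law gives cos A > - cos (B + C): either the sum is below PI, or B + C
    - A exceeds PI. The second alternative cannot hold at two corners, as adding B + C - A and C + A
    - B would give C > PI. *)
Lemma hyperbolic_angle_sum a b c A B C :
  hyperbolic_dual_triangle a b c A B C -> A + B + C < PI.
Proof.
have main x X Y Z : 0 < x -> 0 < X < PI -> 0 < Y < PI -> 0 < Z < PI ->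
    hyperbolic_dual_law x X Y Z -> X + Y + Z < PI \/ PI < Y + Z - X.
  move=> /cosh_gt1 Hx HX HY HZ L.
  have m := Rmult_lt_0_compat _ _ (sin_pos HY) (sin_pos HZ).
  have H : - cos (Y + Z) < cos X.
    rewrite cos_plus; rewrite /hyperbolic_dual_law in L; nra.
  case: (Rle_lt_dec (Y + Z) PI) => YZ.
    left; rewrite -Rtrigo_facts.cos_pi_minus in H.
    by have := @lt_of_cos_lt X (PI - (Y + Z)) ltac:(lra) ltac:(lra) H; lra.
  right.
  have E : cos (Y + Z - PI) = - cos (Y + Z).
    by rewrite cos_minus cos_PI sin_PI; lra.
  rewrite -E in H.
  by have := @lt_of_cos_lt X (Y + Z - PI) ltac:(lra) ltac:(lra) H; lra.
move=> [Ha Hb Hc HA HB HC LA LB _].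
have := main _ _ _ _ Ha HA HB HC LA; have := main _ _ _ _ Hb HB HC HA LB; lra.
Qed.

Lemma hyperbolic_dual_gram a A B C : hyperbolic_dual_law a A B C ->
  (sinh a * sin B * sin C) ^ 2
  = cos A ^ 2 + cos B ^ 2 + cos C ^ 2 + 2 * cos A * cos B * cos C - 1.
Proof.
move=> L.
have -> : (sinh a * sin B * sin C) ^ 2
  = (cosh a * sin B * sin C) ^ 2 - sin B ^ 2 * sin C ^ 2.
  have -> : (sinh a * sin B * sin C) ^ 2 = sinh a ^ 2 * sin B ^ 2 * sin C ^ 2 by ring.
  by rewrite sinh2E; ring.
rewrite L !sin2E; ring.
Qed.

Lemma hyperbolic_dual_sine a b c A B C : hyperbolic_dual_triangle a b c A B C ->
  sinh a * sin B = sinh b * sin A.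
Proof.
case=> /sinh_pos Ha /sinh_pos Hb _ /sin_pos HA /sin_pos HB /sin_pos HC LA LB _.
suff : sinh a * sin B * sin C = sinh b * sin C * sin A.
  move=> E; apply: (Rmult_eq_reg_r (sin C)); lra.
apply: eq_of_sqr_eq; try by product_pos.
rewrite (hyperbolic_dual_gram LA) (hyperbolic_dual_gram LB); ring.
Qed.

(** The dual laws say that the adjugate of the angle matrix is the matrix of cosh of the sides,
    rescaled by sines. The determinant of a 3 by 3 adjugate is the square of the original
    determinant, which is nonzero here. *)
Lemma hyperbolic_length_gram_pos a b c A B C : hyperbolic_dual_triangle a b c A B C ->
  0 < 1 - cosh a ^ 2 - cosh b ^ 2 - cosh c ^ 2 + 2 * cosh a * cosh b * cosh c.
Proof.
case=> /sinh_pos sa _ _ /sin_pos sA /sin_pos sB /sin_pos sC LA LB LC.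
have G := hyperbolic_dual_gram LA.
have D0 : 0 < (sinh a * sin B * sin C) ^ 2.
  by apply: pow_lt; product_pos.
have K : 0 < (sin A * sin B * sin C) ^ 2.
  by apply: pow_lt; product_pos.
apply: (Rmult_lt_reg_l _ _ _ K); rewrite Rmult_0_r.
have -> : (sin A * sin B * sin C) ^ 2
    * (1 - cosh a ^ 2 - cosh b ^ 2 - cosh c ^ 2 + 2 * cosh a * cosh b * cosh c)
  = sin A ^ 2 * sin B ^ 2 * sin C ^ 2
    - sin A ^ 2 * (cosh a * sin B * sin C) ^ 2
    - sin B ^ 2 * (cosh b * sin C * sin A) ^ 2
    - sin C ^ 2 * (cosh c * sin A * sin B) ^ 2
    + 2 * (cosh a * sin B * sin C) * (cosh b * sin C * sin A) * (cosh c * sin A * sin B).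
  ring.
rewrite LA LB LC !sin2E.
suff -> : (1 - cos A ^ 2) * (1 - cos B ^ 2) * (1 - cos C ^ 2)
   - (1 - cos A ^ 2) * (cos A + cos B * cos C) ^ 2
   - (1 - cos B ^ 2) * (cos B + cos C * cos A) ^ 2
   - (1 - cos C ^ 2) * (cos C + cos A * cos B) ^ 2
   + 2 * (cos A + cos B * cos C) * (cos B + cos C * cos A) * (cos C + cos A * cos B)
  = ((sinh a * sin B * sin C) ^ 2) ^ 2 by exact: pow_lt.
by rewrite G; ring.
Qed.

(** x, y, z stand for the velocities of (B + C - A) / 2 and its rotations, and f for one row of the
    differentiated dual laws, weighted by the 1 + cosh a of tanh (a / 2) = sinh a / (1 + cosh a).
    The third minor is 2 (1 + u) (1 + v) (1 + w) times the determinant of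
    [hyperbolic_length_gram_pos]. *)
Lemma hyperbolic_form_pos a b c A B C x y z :
  hyperbolic_dual_triangle a b c A B C -> x <> 0 \/ y <> 0 \/ z <> 0 ->
  let f u v w p q r := (1 + u) * p * (p * (v + w) + q * (1 + v) + r * (1 + w)) in
  0 < f (cosh a) (cosh b) (cosh c) x y z + f (cosh b) (cosh c) (cosh a) y z x
    + f (cosh c) (cosh a) (cosh b) z x y.
Proof.
move=> T nz f.
have G := hyperbolic_length_gram_pos T.
have [/cosh_gt1 + /cosh_gt1 + /cosh_gt1 + _ _ _ _ _ _] := T.
rewrite /f; move: G; move: (cosh a) (cosh b) (cosh c) => u v w G Hu Hv Hw.
have uv : 0 < (1 + u) * (1 + v) by apply: Rmult_lt_0_compat; lra.
have m : 0 < (1 + u) * (1 + v) * (1 + w) by apply: Rmult_lt_0_compat; lra.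
have := @ternary_form_pos ((1 + u) * (v + w)) ((1 + v) * (w + u)) ((1 + w) * (u + v))
  ((1 + u) * (1 + v)) ((1 + u) * (1 + w)) ((1 + v) * (1 + w)) x y z _ _ _ nz.
have M1 : 0 < (1 + u) * (v + w) by apply: Rmult_lt_0_compat; lra.
have M2 : 0 < (1 + u) * (v + w) * ((1 + v) * (w + u)) - ((1 + u) * (1 + v)) ^ 2.
  have -> : (1 + u) * (v + w) * ((1 + v) * (w + u)) - ((1 + u) * (1 + v)) ^ 2
    = (1 + u) * (1 + v) * ((w - 1) * (w + 1 + u + v)) by ring.
  by product_pos; lra.
move/(_ M1 M2); set G3 := (X in (0 < X -> _) -> _).
have -> : G3 = 2 * ((1 + u) * (1 + v) * (1 + w)) *
   (1 - u ^ 2 - v ^ 2 - w ^ 2 + 2 * u * v * w) by rewrite /G3; ring.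
move=> H; have := H ltac:(by apply: Rmult_lt_0_compat; lra); lra.
Qed.

(** Implicit differentiation again; [F1] and [F2] are projection formulas with the roles of sides
    and angles exchanged. *)
Lemma hyperbolic_dual_law_derivative (a b c A B C : R -> R) (t a' A' B' C' : R) :
  hyperbolic_dual_triangle (a t) (b t) (c t) (A t) (B t) (C t) ->
  locally t (fun s => hyperbolic_dual_law (a s) (A s) (B s) (C s)) ->
  is_derive a t a' -> is_derive A t A' -> is_derive B t B' -> is_derive C t C' ->
  sinh (a t) * sin (B t) * sin (C t) * a'
  = - sin (A t) * (A' + cosh (c t) * B' + cosh (b t) * C').
Proof.
move=> T loc da dA dB dC.
have [_ _ _ /sin_pos sA /sin_pos sB /sin_pos sC LA LB LC] := T.
pose F s := cos (A s) + cos (B s) * cos (C s) - cosh (a s) * sin (B s) * sin (C s).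
have dF0 : is_derive F t 0.
  apply: (is_derive_ext_loc (fun=> 0)).
    by apply: filter_imp loc => s; rewrite /hyperbolic_dual_law /F => ->; lra.
  exact: (@is_derive_const R_AbsRing R_NormedModule).
have dF1 : is_derive F t
  (- sin (A t) * A' - sin (B t) * B' * cos (C t) - cos (B t) * sin (C t) * C'
   - (sinh (a t) * a' * sin (B t) * sin (C t)
      + cosh (a t) * (cos (B t) * B' * sin (C t) + sin (B t) * cos (C t) * C'))).
  rewrite /F; auto_derive.
    by do ?split; eexists; eassumption.
  rewrite (is_derive_unique _ _ _ da) (is_derive_unique _ _ _ dA)
    (is_derive_unique _ _ _ dB) (is_derive_unique _ _ _ dC); ring.
have E := is_derive_unique _ _ _ dF1.
rewrite (is_derive_unique _ _ _ dF0) in E.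
rewrite /hyperbolic_dual_law in LA LB LC.
have F1 : cosh (a t) * cos (B t) * sin (C t) + sin (B t) * cos (C t)
    = sin (A t) * cosh (c t).
  apply: (Rmult_eq_reg_l (sin (B t))); last by lra.
  have -> : sin (B t) * (cosh (a t) * cos (B t) * sin (C t) + sin (B t) * cos (C t))
    = cos (B t) * (cosh (a t) * sin (B t) * sin (C t)) + sin (B t) ^ 2 * cos (C t) by ring.
  have -> : sin (B t) * (sin (A t) * cosh (c t)) = cosh (c t) * sin (A t) * sin (B t).
    by ring.
  by rewrite LA LC sin2E; ring.
have F2 : cosh (a t) * sin (B t) * cos (C t) + cos (B t) * sin (C t)
    = sin (A t) * cosh (b t).
  apply: (Rmult_eq_reg_l (sin (C t))); last by lra.
  have -> : sin (C t) * (cosh (a t) * sin (B t) * cos (C t) + cos (B t) * sin (C t))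
    = cos (C t) * (cosh (a t) * sin (B t) * sin (C t)) + sin (C t) ^ 2 * cos (B t) by ring.
  have -> : sin (C t) * (sin (A t) * cosh (b t)) = cosh (b t) * sin (C t) * sin (A t).
    by ring.
  by rewrite LA LB sin2E; ring.
have -> : - sin (A t) * (A' + cosh (c t) * B' + cosh (b t) * C')
  = - (sin (A t) * A' + (sin (A t) * cosh (c t)) * B' + (sin (A t) * cosh (b t)) * C').
  by ring.
rewrite -F1 -F2; lra.
Qed.

(* [tanh (a / 2)] and [cos ((B + C - A) / 2)] play the roles of [sin a] and [sin A] in a
   sine law. *)
Lemma hyperbolic_tanh_half a b c A B C : hyperbolic_dual_triangle a b c A B C ->
  cos ((B + C - A) / 2) * tanh (b / 2) = cos ((C + A - B) / 2) * tanh (a / 2).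
Proof.
move=> T; have sum := hyperbolic_angle_sum T.
have [Ha Hb Hc HA HB HC LA LB LC] := T.
have sA := sin_pos HA; have sB := sin_pos HB; have sC := sin_pos HC.
rewrite /hyperbolic_dual_law in LA LB LC.
(* Sum-to-product formulas in these half sums factor cosh a - 1 and cosh a + 1 into cosines, and
   tanh^2 (a / 2) is the quotient of the two. *)
pose X := (B + C - A) / 2; pose Y := (C + A - B) / 2; pose Z := (A + B - C) / 2.
pose S := (A + B + C) / 2.
have cX : 0 < cos X by apply: cos_gt_0; rewrite /X; lra.
have cY : 0 < cos Y by apply: cos_gt_0; rewrite /Y; lra.
have cZ : 0 < cos Z by apply: cos_gt_0; rewrite /Z; lra.
have cS : 0 < cos S by apply: cos_gt_0; rewrite /S; lra.
have sumprod u v : cos (u + v) + cos (u - v) = 2 * cos u * cos v.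
  by rewrite cos_plus cos_minus; ring.
have half l : 0 < l -> tanh (l / 2) ^ 2 = (cosh l - 1) / (cosh l + 1).
  move=> Hl; have c1 := cosh_gt1 Hl; rewrite tanh_half.
  have -> : (sinh l / (cosh l + 1)) ^ 2 = sinh l ^ 2 / (cosh l + 1) ^ 2 by field; lra.
  by rewrite sinh2E; field; lra.
have am : (cosh a - 1) * (sin B * sin C) = 2 * cos S * cos X.
  rewrite -sumprod.
  have -> : S + X = B + C by rewrite /S /X; lra.
  have -> : S - X = A by rewrite /S /X; lra.
  by rewrite cos_plus; lra.
have ap : (cosh a + 1) * (sin B * sin C) = 2 * cos Y * cos Z.
  rewrite -sumprod.
  have -> : Y + Z = A by rewrite /Y /Z; lra.
  have -> : Y - Z = C - B by rewrite /Y /Z; lra.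
  by rewrite cos_minus; lra.
have bm : (cosh b - 1) * (sin C * sin A) = 2 * cos S * cos Y.
  rewrite -sumprod.
  have -> : S + Y = C + A by rewrite /S /Y; lra.
  have -> : S - Y = B by rewrite /S /Y; lra.
  by rewrite cos_plus; lra.
have bp : (cosh b + 1) * (sin C * sin A) = 2 * cos Z * cos X.
  rewrite -sumprod.
  have -> : Z + X = B by rewrite /Z /X; lra.
  have -> : Z - X = A - C by rewrite /Z /X; lra.
  by rewrite cos_minus; lra.
have ta := tanh_half_pos Ha; have tb := tanh_half_pos Hb.
have ca := cosh_gt1 Ha; have cb := cosh_gt1 Hb.
have mBC := Rmult_lt_0_compat _ _ sB sC; have mCA := Rmult_lt_0_compat _ _ sC sA.
rewrite -/X -/Y; apply: eq_of_sqr_eq; try by product_pos.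
rewrite (Rpow_mult_distr (cos X)) (Rpow_mult_distr (cos Y)) !half //.
have -> : (cosh b - 1) / (cosh b + 1) = (2 * cos S * cos Y) / (2 * cos Z * cos X).
  by rewrite -bm -bp; field; lra.
have -> : (cosh a - 1) / (cosh a + 1) = (2 * cos S * cos X) / (2 * cos Y * cos Z).
  by rewrite -am -ap; field; lra.
by field; lra.
Qed.

(** Two proportionalities are used: [j], from the sine law, gives the three derivatives the same
    denominator [D], and [k], from [hyperbolic_tanh_half], confines the exponent to a common factor.
    The negative sign is that of the differentiated dual law. *)
Lemma hyperbolic_weighted_form_neg p a b c A B C a' b' c' x y z :
  hyperbolic_dual_triangle a b c A B C -> x <> 0 \/ y <> 0 \/ z <> 0 ->
  let w l X := Rpower (tanh (l / 2)) (-1 - p) * Rpower (cos X) p in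
  sinh a * sin B * sin C * a' = - sin A * ((y + z) + cosh c * (z + x) + cosh b * (x + y)) ->
  sinh b * sin C * sin A * b' = - sin B * ((z + x) + cosh a * (x + y) + cosh c * (y + z)) ->
  sinh c * sin A * sin B * c' = - sin C * ((x + y) + cosh b * (y + z) + cosh a * (z + x)) ->
  a' * x * w a ((B + C - A) / 2) + b' * y * w b ((C + A - B) / 2)
    + c' * z * w c ((A + B - C) / 2) < 0.
Proof.
move=> T nz w.
have T2 := hyperbolic_dual_rot T; have T3 := hyperbolic_dual_rot T2.
have sum := hyperbolic_angle_sum T.
have [Ha Hb Hc HA HB HC _ _ _] := T.
have sA := sin_pos HA; have sB := sin_pos HB; have sC := sin_pos HC.
have sa := sinh_pos Ha; have sb := sinh_pos Hb; have sc := sinh_pos Hc.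
have S1 := hyperbolic_dual_sine T; have S2 := hyperbolic_dual_sine T2.
pose j := sin A / sinh a; pose k := cos ((B + C - A) / 2) / tanh (a / 2).
pose D := sinh a * sin B * sin C.
have jA : sin A = j * sinh a by rewrite /j; field; lra.
have jB : sin B = j * sinh b.
  by apply: (Rmult_eq_reg_l (sinh a)); [rewrite S1 jA; ring | lra].
have jC : sin C = j * sinh c.
  by apply: (Rmult_eq_reg_l (sinh b)); [rewrite S2 jB; ring | lra].
have j0 : 0 < j by exact: Rdiv_lt_0_compat.
have ta := tanh_half_pos Ha; have tb := tanh_half_pos Hb; have tc := tanh_half_pos Hc.
have k0 : 0 < k by apply: Rdiv_lt_0_compat => //; apply: cos_gt_0; lra.
have kA : cos ((B + C - A) / 2) = k * tanh (a / 2) by rewrite /k; field; lra.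
have kB : cos ((C + A - B) / 2) = k * tanh (b / 2).
  have := hyperbolic_tanh_half T; rewrite kA => E.
  by apply: (Rmult_eq_reg_r (tanh (a / 2))); lra.
have kC : cos ((A + B - C) / 2) = k * tanh (c / 2).
  have := hyperbolic_tanh_half T2; rewrite kB => E.
  by apply: (Rmult_eq_reg_r (tanh (b / 2))); lra.
have D0 : 0 < D by rewrite /D; product_pos.
have -> : sinh b * sin C * sin A = D by rewrite /D jA jB jC; ring.
have -> : sinh c * sin A * sin B = D by rewrite /D jA jB jC; ring.
rewrite -/D => Ea Eb Ec.
have term l l' X u L : 0 < l -> sin X = j * sinh l -> D * l' = - sin X * L ->
    l' * u * (Rpower (tanh (l / 2)) (-1 - p) * Rpower (k * tanh (l / 2)) p)
    = - (j * Rpower k p / D) * ((1 + cosh l) * u * L).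
  move=> Hl jX El; have tl := tanh_half_pos Hl; have sl := sinh_pos Hl.
  have cl := cosh_pos l.
  rewrite (Rpower_ratio p tl k0) tanh_half.
  have -> : l' = - (j * sinh l) * L / D by rewrite -jX -El; field; lra.
  by field; lra.
rewrite /w kA kB kC (term _ _ _ _ _ Ha jA Ea) (term _ _ _ _ _ Hb jB Eb)
  (term _ _ _ _ _ Hc jC Ec) -!Rmult_plus_distr_l.
have K : 0 < j * Rpower k p / D.
  by apply: Rdiv_lt_0_compat => //; apply: Rmult_lt_0_compat => //; exact: Rpower_pos.
have F := hyperbolic_form_pos T nz; cbv zeta in F.
have F' := Rmult_lt_0_compat _ _ K F; lra.
Qed.

(** Cauchy-Schwarz with denominators sinh y and sinh z. Strict superadditivity of [sinh] makes it
    strict even for proportional velocities, so no scaling case arises as it does in the Euclidean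
    plane. *)
Lemma inv_sinh_inequality (x y z u v : R) :
  0 < y -> 0 < z -> y + z <= x -> u <> 0 \/ v <> 0 ->
  / sinh x * (u + v) ^ 2 < / sinh y * u ^ 2 + / sinh z * v ^ 2.
Proof.
move=> Hy Hz Hx nz.
have sy := sinh_pos Hy; have sz := sinh_pos Hz.
have cy := cosh_gt1 Hy; have cz := cosh_gt1 Hz.
have lt : sinh y + sinh z < sinh x.
  have s1 : sinh y + sinh z < sinh (y + z) by rewrite sinh_add; nra.
  case: (Rle_lt_or_eq_dec _ _ Hx) => [/sinh_lt|<-]; lra.
have inv_lt : / sinh x < / (sinh y + sinh z).
  by apply: Rinv_lt_contravar => //; apply: Rmult_lt_0_compat; lra.
have split_square : / sinh y * u ^ 2 + / sinh z * v ^ 2 - / (sinh y + sinh z) * (u + v) ^ 2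
    = (u * sinh z - v * sinh y) ^ 2 / (sinh y * sinh z * (sinh y + sinh z)).
  by field; lra.
have den : 0 < sinh y * sinh z * (sinh y + sinh z).
  by do ?apply: Rmult_lt_0_compat => //; lra.
have q := Rdiv_le_0_compat _ _ (pow2_ge_0 (u * sinh z - v * sinh y)) den.
case: (Req_dec (u + v) 0) => uv; last first.
  by have := Rmult_lt_compat_r _ _ _ (pow2_gt_0 _ uv) inv_lt; lra.
have u0 : u <> 0 by case: nz => //; lra.
have iy : 0 < / sinh y by exact: Rinv_0_lt_compat.
have iz : 0 < / sinh z by exact: Rinv_0_lt_compat.
have := Rmult_lt_0_compat _ _ iy (pow2_gt_0 _ u0).
have := Rmult_le_pos _ _ (Rlt_le _ _ iz) (pow2_ge_0 v).
by rewrite uv; lra.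
Qed.

(** The logarithmic derivative of tanh (x / 2) is 1 / sinh x, which brings the critical-point
    condition to [inv_sinh_inequality]. *)
Lemma hyperbolic_inequality_path (p D1 D2 D3 M : R) (l1 l2 l3 : R -> R) :
  let v D (l : R -> R) t := D / Rpower (tanh (l t / 2)) p in
  0 <= p ->
  (forall t, 0 <= t <= 1 -> 0 < l1 t < M /\ is_derive l1 t (v D1 l1 t)) ->
  (forall t, 0 <= t <= 1 -> 0 < l2 t < M /\ is_derive l2 t (v D2 l2 t)) ->
  (forall t, 0 <= t <= 1 -> 0 < l3 t < M /\ is_derive l3 t (v D3 l3 t)) ->
  l1 0 < l2 0 + l3 0 -> l1 1 < l2 1 + l3 1 ->
  forall t, 0 <= t <= 1 -> l1 t < l2 t + l3 t.
Proof.
move=> v p0 H1 H2 H3.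
apply: (@triangle_inequality_path (fun x => tanh (x / 2)) (fun x => / (cosh x + 1))
  p 0 M D1 D2 D3 l1 l2 l3 p0 _ H1 H2 H3).
  by move=> x [Hx _]; split; [exact: tanh_half_pos | exact: is_derive_tanh_half].
move=> t Ht le -> nz.
have [[L1 _] _] := H1 t ltac:(lra); have [[L2 _] _] := H2 t ltac:(lra).
have [[L3 _] _] := H3 t ltac:(lra).
have simpl x : 0 < x -> / (cosh x + 1) / tanh (x / 2) = / sinh x.
  move=> Hx; rewrite tanh_half; have := sinh_pos Hx; have := cosh_pos x.
  by move=> *; field; lra.
by rewrite !simpl //; exact: inv_sinh_inequality.
Qed.

Lemma half_angle_range a b c A B C : hyperbolic_dual_triangle a b c A B C ->
  - (PI / 2) < (B + C - A) / 2 < PI / 2.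
Proof.
move=> T; have sum := hyperbolic_angle_sum T; have [_ _ _ HA HB HC _ _ _] := T; lra.
Qed.

Lemma is_derive_half_angle (f g h : R -> R) (t f' g' h' : R) :
  is_derive f t f' -> is_derive g t g' -> is_derive h t h' ->
  is_derive (fun s => (f s + g s - h s) / 2) t ((f' + g' - h') / 2).
Proof.
move=> df dg dh; auto_derive; first by do ?split; eexists; eassumption.
rewrite (is_derive_unique _ _ _ df) (is_derive_unique _ _ _ dg) (is_derive_unique _ _ _ dh).
by field.
Qed.

Lemma hyperbolic_monotone_length (p : R) (U V : R -> R)
    (a b c A B C a' b' c' A' B' C' : R) :
  p <= -1 ->
  (forall x, 0 < x -> is_derive U x (Rpower (tanh (x / 2)) (-1 - p))) ->
  (forall x, - (PI / 2) < x < PI / 2 -> is_derive V x (Rpower (cos x) p)) ->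
  hyperbolic_triangle a b c A B C -> hyperbolic_triangle a' b' c' A' B' C' ->
  [/\ a' = a, b' = b & c' = c] \/
  (U a' - U a) * (V ((B' + C' - A') / 2) - V ((B + C - A) / 2))
    + (U b' - U b) * (V ((C' + A' - B') / 2) - V ((C + A - B) / 2))
    + (U c' - U c) * (V ((A' + B' - C') / 2) - V ((A + B - C) / 2)) < 0.
Proof.
move=> p1 dU dV T T'.
have [Ha Hb Hc HA HB HC LA LB LC] := T.
have [Ha' Hb' Hc' HA' HB' HC' LA' LB' LC'] := T'.
pose M := a + b + c + a' + b' + c'.
have dU' x : 0 < x < M -> is_derive U x (Rpower (tanh (x / 2)) (-1 - p))
    /\ 0 < Rpower (tanh (x / 2)) (-1 - p).
  by move=> [Hx _]; split; [exact: dU | exact: Rpower_pos].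
have [a_ [a0 a1 Pa]] := @affine_path U _ 0 M a a' ltac:(rewrite /M; lra)
  ltac:(rewrite /M; lra) dU'.
have [b_ [b0 b1 Pb]] := @affine_path U _ 0 M b b' ltac:(rewrite /M; lra)
  ltac:(rewrite /M; lra) dU'.
have [c_ [c0 c1 Pc]] := @affine_path U _ 0 M c c' ltac:(rewrite /M; lra)
  ltac:(rewrite /M; lra) dU'.
have inj x x' : 0 < x < M -> 0 < x' < M -> U x' - U x = 0 -> x' = x.
  by move=> Hx Hx' E; apply: (deriv_pos_injective dU') => //; lra.
move: Pa Pb Pc inj.
set Da := U a' - U a; set Db := U b' - U b; set Dc := U c' - U c => Pa Pb Pc inj.
case: (zero_or_nonzero3 Da Db Dc) => [[na nb nc]|nz].
  by left; split; apply: inj => //; rewrite /M; lra.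
right.
have t1 := hyperbolic_inequality T.
have t2 := hyperbolic_inequality (hyperbolic_rot T).
have t3 := hyperbolic_inequality (hyperbolic_rot (hyperbolic_rot T)).
have s1 := hyperbolic_inequality T'.
have s2 := hyperbolic_inequality (hyperbolic_rot T').
have s3 := hyperbolic_inequality (hyperbolic_rot (hyperbolic_rot T')).
have Qa t : 0 <= t <= 1 -> 0 < a_ t < M
    /\ is_derive a_ t (Da / Rpower (tanh (a_ t / 2)) (-1 - p)).
  by move=> /Pa[].
have Qb t : 0 <= t <= 1 -> 0 < b_ t < M
    /\ is_derive b_ t (Db / Rpower (tanh (b_ t / 2)) (-1 - p)).
  by move=> /Pb[].
have Qc t : 0 <= t <= 1 -> 0 < c_ t < M
    /\ is_derive c_ t (Dc / Rpower (tanh (c_ t / 2)) (-1 - p)).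
  by move=> /Pc[].
have q0 : 0 <= -1 - p by lra.
have i1 := hyperbolic_inequality_path q0 Qa Qb Qc ltac:(lra) ltac:(lra).
have i2 := hyperbolic_inequality_path q0 Qb Qc Qa ltac:(lra) ltac:(lra).
have i3 := hyperbolic_inequality_path q0 Qc Qa Qb ltac:(lra) ltac:(lra).
have TT t : 0 <= t <= 1 -> hyperbolic_triangle (a_ t) (b_ t) (c_ t)
   (hyperbolic_angle (a_ t) (b_ t) (c_ t)) (hyperbolic_angle (b_ t) (c_ t) (a_ t))
   (hyperbolic_angle (c_ t) (a_ t) (b_ t)).
  move=> Ht; have := i1 t Ht; have := i2 t Ht; have := i3 t Ht.
  have [? _] := Qa t Ht; have [? _] := Qb t Ht; have [? _] := Qc t Ht.
  by move=> *; apply: hyperbolic_triangle_of_lengths; lra.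
have exA t : 0 <= t <= 1 ->
  [/\ ex_derive (fun s => hyperbolic_angle (a_ s) (b_ s) (c_ s)) t,
      ex_derive (fun s => hyperbolic_angle (b_ s) (c_ s) (a_ s)) t &
      ex_derive (fun s => hyperbolic_angle (c_ s) (a_ s) (b_ s)) t].
  move=> Ht; have := i1 t Ht; have := i2 t Ht; have := i3 t Ht.
  have [? da] := Qa t Ht; have [? db] := Qb t Ht; have [? dc] := Qc t Ht.
  by move=> *; split; apply: ex_derive_hyperbolic_angle; try lra;
    try (by apply: hyperbolic_angle_bound; lra); eexists; eassumption.
move: TT exA; set A_ := fun s => hyperbolic_angle (a_ s) (b_ s) (c_ s).
set B_ := fun s => hyperbolic_angle (b_ s) (c_ s) (a_ s).
set C_ := fun s => hyperbolic_angle (c_ s) (a_ s) (b_ s) => TT exA.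
have A0 : A_ 0 = A by rewrite /A_ a0 b0 c0; exact: hyperbolic_angleE.
have B0 : B_ 0 = B by rewrite /B_ a0 b0 c0; exact: hyperbolic_angleE.
have C0 : C_ 0 = C by rewrite /C_ a0 b0 c0; exact: hyperbolic_angleE.
have A1 : A_ 1 = A' by rewrite /A_ a1 b1 c1; exact: hyperbolic_angleE.
have B1 : B_ 1 = B' by rewrite /B_ a1 b1 c1; exact: hyperbolic_angleE.
have C1 : C_ 1 = C' by rewrite /C_ a1 b1 c1; exact: hyperbolic_angleE.
have dT t (Ht : 0 <= t <= 1) := hyperbolic_triangle_dual (TT t Ht).
have dx (f g h : R -> R) t : ex_derive f t -> ex_derive g t -> ex_derive h t ->
    is_derive (fun s => (f s + g s - h s) / 2) t ((Derive f t + Derive g t - Derive h t) / 2).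
  by move=> *; apply: is_derive_half_angle; exact: Derive_correct.
have [|||t Ht] := @weighted_mean_value (fun x => - (PI / 2) < x < PI / 2) V _ Da Db Dc
  (fun s => (B_ s + C_ s - A_ s) / 2) (fun s => (C_ s + A_ s - B_ s) / 2)
  (fun s => (A_ s + B_ s - C_ s) / 2) dV.
- move=> t Ht; have [eA eB eC] := exA t Ht; split; first exact: half_angle_range (dT t Ht).
  by eexists; exact: dx.
- move=> t Ht; have [eA eB eC] := exA t Ht; split.
    exact: half_angle_range (hyperbolic_dual_rot (dT t Ht)).
  by eexists; exact: dx.
- move=> t Ht; have [eA eB eC] := exA t Ht; split.
    exact: half_angle_range (hyperbolic_dual_rot (hyperbolic_dual_rot (dT t Ht))).
  by eexists; exact: dx.
rewrite A0 B0 C0 A1 B1 C1 => ->.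
have Ht' : 0 <= t <= 1 by lra.
have Tt := dT t Ht'; have [eA eB eC] := exA t Ht'.
have [_ da] := Qa t Ht'; have [_ db] := Qb t Ht'; have [_ dc] := Qc t Ht'.
have dA := Derive_correct _ _ eA; have dB := Derive_correct _ _ eB.
have dC := Derive_correct _ _ eC.
have EA := @hyperbolic_dual_law_derivative a_ b_ c_ A_ B_ C_ t _ _ _ _ Tt
  (locally_inside Ht (fun s Hs => hypd_lawA (dT s Hs))) da dA dB dC.
have EB := @hyperbolic_dual_law_derivative b_ c_ a_ B_ C_ A_ t _ _ _ _
  (hyperbolic_dual_rot Tt)
  (locally_inside Ht (fun s Hs => hypd_lawB (dT s Hs))) db dB dC dA.
have EC := @hyperbolic_dual_law_derivative c_ a_ b_ C_ A_ B_ t _ _ _ _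
  (hyperbolic_dual_rot (hyperbolic_dual_rot Tt))
  (locally_inside Ht (fun s Hs => hypd_lawC (dT s Hs))) dc dC dA dB.
rewrite (is_derive_unique _ _ _ (dx _ _ _ _ eB eC eA)).
rewrite (is_derive_unique _ _ _ (dx _ _ _ _ eC eA eB)).
rewrite (is_derive_unique _ _ _ (dx _ _ _ _ eA eB eC)).
move: EA EB EC; clear dA dB dC.
move: (Derive A_ t) (Derive B_ t) (Derive C_ t) => u v w EA EB EC.
set x := (v + w - u) / 2; set y := (w + u - v) / 2; set z := (u + v - w) / 2.
have uE : u = y + z by rewrite /y /z; lra.
have vE : v = z + x by rewrite /x /z; lra.
have wE : w = x + y by rewrite /x /y; lra.
(* If the angles were stationary, the differentiated dual laws would stop all the sides too,
   although some side has nonzero velocity. *)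
case: (zero_or_nonzero3 x y z) => [[x0 y0 z0]|nzx].
  exfalso; rewrite uE vE wE x0 y0 z0 in EA EB EC.
  have [/sinh_pos ? /sinh_pos ? /sinh_pos ? /sin_pos ? /sin_pos ? /sin_pos ? _ _ _] := Tt.
  have zero K d L : 0 < K -> K * d = L -> L = 0 -> d = 0.
    by move=> K0 <- /Rmult_integral[]; lra.
  case: nz => [/(@div_Rpower_neq0 _ (tanh (a_ t / 2)) (-1 - p))
    |[/(@div_Rpower_neq0 _ (tanh (b_ t / 2)) (-1 - p))
    |/(@div_Rpower_neq0 _ (tanh (c_ t / 2)) (-1 - p))]]; apply.
  - by apply: zero EA _; [product_pos | ring].
  - by apply: zero EB _; [product_pos | ring].
  - by apply: zero EC _; [product_pos | ring].
rewrite uE vE wE in EA EB EC.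
have := @hyperbolic_weighted_form_neg p _ _ _ _ _ _ _ _ _ x y z Tt nzx EA EB EC.
have Wa := Rpower_pos (tanh (a_ t / 2)) (-1 - p).
have Wb := Rpower_pos (tanh (b_ t / 2)) (-1 - p).
have Wc := Rpower_pos (tanh (c_ t / 2)) (-1 - p).
(* D / W is a side velocity; the weight W in the form restores the constant difference D. *)
have cancel D W u1 P : 0 < W -> D / W * u1 * (W * P) = D * (u1 * P).
  by move=> W0; field; lra.
by rewrite !cancel.
Qed.

(** * Hyperbolic triangles given by their angles *)

Definition hyperbolic_side (A B C : R) : R :=
  arcosh ((cos A + cos B * cos C) / (sin B * sin C)).

Lemma hyperbolic_side_bound A B C : 0 < A -> 0 < B -> 0 < C -> A + B + C < PI ->
  1 < (cos A + cos B * cos C) / (sin B * sin C).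
Proof.
move=> HA HB HC sum.
have sB : 0 < sin B by apply: sin_pos; lra.
have sC : 0 < sin C by apply: sin_pos; lra.
have m := Rmult_lt_0_compat _ _ sB sC.
have H : cos (PI - (B + C)) < cos A by apply: cos_decreasing_1; lra.
rewrite Rtrigo_facts.cos_pi_minus cos_plus in H.
apply: (Rmult_lt_reg_r (sin B * sin C)) => //.
have -> : (cos A + cos B * cos C) / (sin B * sin C) * (sin B * sin C)
  = cos A + cos B * cos C by field; lra.
lra.
Qed.

Lemma hyperbolic_dual_triangle_of_angles A B C :
  0 < A -> 0 < B -> 0 < C -> A + B + C < PI ->
  hyperbolic_dual_triangle (hyperbolic_side A B C) (hyperbolic_side B C A)
    (hyperbolic_side C A B) A B C.
Proof.
have law X Y Z : 0 < X -> 0 < Y -> 0 < Z -> X + Y + Z < PI ->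
    0 < hyperbolic_side X Y Z /\ hyperbolic_dual_law (hyperbolic_side X Y Z) X Y Z.
  move=> HX HY HZ sum; have Bd := hyperbolic_side_bound HX HY HZ sum.
  have sY : 0 < sin Y by apply: sin_pos; lra.
  have sZ : 0 < sin Z by apply: sin_pos; lra.
  split; first exact: arcosh_pos.
  by rewrite /hyperbolic_dual_law cosh_arcosh; [field; lra | lra].
move=> HA HB HC sum.
have [||||a1 a2] := @law A B C; try lra.
have [||||b1 b2] := @law B C A; try lra.
have [||||c1 c2] := @law C A B; try lra.
by split => //; lra.
Qed.

Lemma hyperbolic_sideE a A B C : 0 < a -> 0 < B < PI -> 0 < C < PI ->
  hyperbolic_dual_law a A B C -> hyperbolic_side A B C = a.
Proof.
move=> Ha /sin_pos sB /sin_pos sC L; rewrite /hyperbolic_side -L -(arcosh_cosh Ha).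
by congr arcosh; rewrite arcosh_cosh //; field; lra.
Qed.

Lemma ex_derive_hyperbolic_side (A B C : R -> R) (t : R) :
  0 < A t -> 0 < B t -> 0 < C t -> A t + B t + C t < PI ->
  ex_derive A t -> ex_derive B t -> ex_derive C t ->
  ex_derive (fun s => hyperbolic_side (A s) (B s) (C s)) t.
Proof.
move=> HA HB HC sum dA dB dC; rewrite /hyperbolic_side.
apply: (@ex_derive_comp R_AbsRing R_NormedModule arcosh).
  by apply: ex_derive_arcosh; exact: hyperbolic_side_bound.
have sB : 0 < sin (B t) by apply: sin_pos; lra.
have sC : 0 < sin (C t) by apply: sin_pos; lra.
auto_derive; do ?split => //.
by apply: Rgt_not_eq; nra.
Qed.

Lemma sin_shift_pi2 (x : R) : sin (PI / 2 + x) = cos x.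
Proof. by rewrite sin_plus cos_PI2 sin_PI2; lra. Qed.

(** An even derivative makes V - V 0 odd. Consequently u + v > 0 can be read off as V u + V v > 2 V
    0, a condition that is convex along a path affine in [V]. *)
Lemma odd_antiderivative (V v : R -> R) (r : R) :
  (forall x, - r < x < r -> is_derive V x (v x)) -> (forall x, v (- x) = v x) ->
  forall x, - r < x < r -> V x + V (- x) = 2 * V 0.
Proof.
move=> dV even.
have main x : 0 < x < r -> V x + V (- x) = 2 * V 0.
  move=> Hx.
  have [y Hy|c Hc] := @mean_value (fun y => V y + V (- y)) (fun=> 0) 0 x (proj1 Hx).
    have d1 := dV y ltac:(lra); have d2 := dV (- y) ltac:(lra).
    auto_derive; first by do ?split; eexists; eassumption.
    rewrite (is_derive_unique _ _ _ d1) (is_derive_unique _ _ _ d2) even; lra.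
  by rewrite Ropp_0; lra.
move=> x Hx; case: (Rtotal_order x 0) => [lt|[->|gt]].
- by have := main (- x) ltac:(lra); rewrite Ropp_involutive; lra.
- by rewrite Ropp_0; lra.
- by apply: main; lra.
Qed.

(** In the coordinates x = (B + C - A) / 2, y, z the angles are the pairwise sums, and they belong
    to a hyperbolic triangle when these sums are positive and x + y + z < PI / 2. The first
    condition persists by oddness, the second by the spherical argument for defects; the sides are
    then defined from the angles. *)
Lemma hyperbolic_monotone_angle (p : R) (U V : R -> R)
    (a b c A B C a' b' c' A' B' C' : R) :
  0 <= p ->
  (forall x, 0 < x -> is_derive U x (Rpower (tanh (x / 2)) (-1 - p))) ->
  (forall x, - (PI / 2) < x < PI / 2 -> is_derive V x (Rpower (cos x) p)) ->
  hyperbolic_dual_triangle a b c A B C -> hyperbolic_dual_triangle a' b' c' A' B' C' ->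
  [/\ a' = a, b' = b & c' = c] \/
  (U a' - U a) * (V ((B' + C' - A') / 2) - V ((B + C - A) / 2))
    + (U b' - U b) * (V ((C' + A' - B') / 2) - V ((C + A - B) / 2))
    + (U c' - U c) * (V ((A' + B' - C') / 2) - V ((A + B - C) / 2)) < 0.
Proof.
move=> p0 dU dV T T'.
have RX := half_angle_range T; have RX' := half_angle_range T'.
have RY := half_angle_range (hyperbolic_dual_rot T).
have RY' := half_angle_range (hyperbolic_dual_rot T').
have RZ := half_angle_range (hyperbolic_dual_rot (hyperbolic_dual_rot T)).
have RZ' := half_angle_range (hyperbolic_dual_rot (hyperbolic_dual_rot T')).
have sum := hyperbolic_angle_sum T; have sum' := hyperbolic_angle_sum T'.
have [Ha Hb Hc HA HB HC LA LB LC] := T.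
have [Ha' Hb' Hc' HA' HB' HC' LA' LB' LC'] := T'.
move: RX RY RZ RX' RY' RZ'.
set X := (B + C - A) / 2; set Y := (C + A - B) / 2; set Z := (A + B - C) / 2.
set X' := (B' + C' - A') / 2; set Y' := (C' + A' - B') / 2; set Z' := (A' + B' - C') / 2.
move=> RX RY RZ RX' RY' RZ'.
have AE : A = Y + Z by rewrite /Y /Z; lra.
have BE : B = Z + X by rewrite /X /Z; lra.
have CE : C = X + Y by rewrite /X /Y; lra.
have AE' : A' = Y' + Z' by rewrite /Y' /Z'; lra.
have BE' : B' = Z' + X' by rewrite /X' /Z'; lra.
have CE' : C' = X' + Y' by rewrite /X' /Y'; lra.
have dV' x : - (PI / 2) < x < PI / 2 -> is_derive V x (Rpower (cos x) p)
    /\ 0 < Rpower (cos x) p.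
  by move=> Hx; split; [exact: dV | exact: Rpower_pos].
have [x_ [x0 x1 Px]] := affine_path RX RX' dV'.
have [y_ [y0 y1 Py]] := affine_path RY RY' dV'.
have [z_ [z0 z1 Pz]] := affine_path RZ RZ' dV'.
have inj u u' : - (PI / 2) < u < PI / 2 -> - (PI / 2) < u' < PI / 2 -> V u' - V u = 0 -> u' = u.
  by move=> Hu Hu' E; apply: (deriv_pos_injective dV') => //; lra.
move: Px Py Pz inj.
set Dx := V X' - V X; set Dy := V Y' - V Y; set Dz := V Z' - V Z => Px Py Pz inj.
case: (zero_or_nonzero3 Dx Dy Dz) => [[nx ny nz]|nz].
  left.
  have XX : X' = X by exact: inj.
  have YY : Y' = Y by exact: inj.
  have ZZ : Z' = Z by exact: inj.
  have [eA eB eC] : [/\ A' = A, B' = B & C' = C] by split; lra.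
  rewrite eA eB eC in LA' LB' LC'.
  by split; [rewrite -(hyperbolic_sideE Ha HB HC LA) (hyperbolic_sideE Ha' HB HC LA')
   | rewrite -(hyperbolic_sideE Hb HC HA LB) (hyperbolic_sideE Hb' HC HA LB')
   | rewrite -(hyperbolic_sideE Hc HA HB LC) (hyperbolic_sideE Hc' HA HB LC')].
right.
have even x : Rpower (cos (- x)) p = Rpower (cos x) p by rewrite cos_neg.
have odd := @odd_antiderivative V (fun x => Rpower (cos x) p) _ dV even.
have incr := deriv_pos_increasing dV'.
have sum_pos u v : - (PI / 2) < u < PI / 2 -> - (PI / 2) < v < PI / 2 ->
    0 < u + v -> 2 * V 0 < V u + V v.
  by move=> Hu Hv uv; have := odd v Hv; have := incr (- v) u ltac:(lra) ltac:(lra) ltac:(lra); lra.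
have sum_pos_rev u v : - (PI / 2) < u < PI / 2 -> - (PI / 2) < v < PI / 2 ->
    2 * V 0 < V u + V v -> 0 < u + v.
  move=> Hu Hv H; case: (Rlt_le_dec 0 (u + v)) => // neg.
  have := odd v Hv; case: (Rle_lt_or_eq_dec _ _ neg) => [lt|E].
  - by have := incr u (- v) ltac:(lra) ltac:(lra) ltac:(lra); lra.
  - by have uv : u = - v by [lra]; rewrite uv in H; lra.
have pair (f g : R -> R) F G F' G' :
    - (PI / 2) < F < PI / 2 -> - (PI / 2) < G < PI / 2 ->
    - (PI / 2) < F' < PI / 2 -> - (PI / 2) < G' < PI / 2 -> 0 < F + G -> 0 < F' + G' ->
    (forall t, 0 <= t <= 1 -> [/\ - (PI / 2) < f t < PI / 2, V (f t) = V F + t * (V F' - V F)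
       & is_derive f t ((V F' - V F) / Rpower (cos (f t)) p)]) ->
    (forall t, 0 <= t <= 1 -> [/\ - (PI / 2) < g t < PI / 2, V (g t) = V G + t * (V G' - V G)
       & is_derive g t ((V G' - V G) / Rpower (cos (g t)) p)]) ->
    forall t, 0 <= t <= 1 -> 0 < f t + g t.
  move=> RF RG RF' RG' s s' Pf Pg t Ht.
  have [Rf Ef _] := Pf t Ht; have [Rg Eg _] := Pg t Ht.
  apply: sum_pos_rev => //; rewrite Ef Eg.
  have := sum_pos _ _ RF RG s; have := sum_pos _ _ RF' RG' s'.
  by move=> H' H; have := segment_lower H H' Ht; lra.
have i1 := pair _ _ _ _ _ _ RY RZ RY' RZ' ltac:(lra) ltac:(lra) Py Pz.
have i2 := pair _ _ _ _ _ _ RZ RX RZ' RX' ltac:(lra) ltac:(lra) Pz Px.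
have i3 := pair _ _ _ _ _ _ RX RY RX' RY' ltac:(lra) ltac:(lra) Px Py.
(* [x + y + z < PI / 2] is a triangle inequality for
   [PI / 2 + x], [PI / 2 - y] and [PI / 2 - z]. *)
have shift l D : (forall t, 0 <= t <= 1 -> - (PI / 2) < l t < PI / 2
     /\ is_derive l t (D / Rpower (cos (l t)) p)) ->
  forall t, 0 <= t <= 1 -> 0 < PI / 2 + l t < PI
     /\ is_derive (fun s => PI / 2 + l s) t (D / Rpower (sin (PI / 2 + l t)) p).
  move=> H t /H[Hl dl]; split; first by lra.
  rewrite sin_shift_pi2; apply: is_derive_eq; first exact: (@is_derive_plus _ R_NormedModule
    _ _ _ _ _ (@is_derive_const R_AbsRing R_NormedModule (PI / 2) t) dl).
  by rewrite /plus /zero /=; lra.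
have opp l D : (forall t, 0 <= t <= 1 -> - (PI / 2) < l t < PI / 2
     /\ is_derive l t (D / Rpower (cos (l t)) p)) ->
  forall t, 0 <= t <= 1 -> - (PI / 2) < - l t < PI / 2
     /\ is_derive (fun s => - l s) t (- D / Rpower (cos (- l t)) p).
  move=> H t /H[Hl dl]; split; first by lra.
  rewrite cos_neg; apply: is_derive_eq; first exact: (@is_derive_opp _ R_NormedModule _ _ _ dl).
  by rewrite /opp /=; lra.
have weak l D K : (forall t, 0 <= t <= 1 -> [/\ - (PI / 2) < l t < PI / 2, V (l t) = K + t * D
       & is_derive l t (D / Rpower (cos (l t)) p)]) ->
  forall t, 0 <= t <= 1 -> - (PI / 2) < l t < PI / 2
     /\ is_derive l t (D / Rpower (cos (l t)) p).
  by move=> P t /P[].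
have Qx := weak _ _ _ Px; have Qy := weak _ _ _ Py; have Qz := weak _ _ _ Pz.
have i4 := spherical_inequality_path p0 (shift _ _ Qx) (shift _ _ (opp _ _ Qy))
  (shift _ _ (opp _ _ Qz)) ltac:(lra) ltac:(lra).
pose A_ s := y_ s + z_ s; pose B_ s := z_ s + x_ s; pose C_ s := x_ s + y_ s.
have sumlt t : 0 <= t <= 1 -> A_ t + B_ t + C_ t < PI.
  by move=> Ht; have := i4 t Ht; rewrite /A_ /B_ /C_; lra.
pose a_ s := hyperbolic_side (A_ s) (B_ s) (C_ s).
pose b_ s := hyperbolic_side (B_ s) (C_ s) (A_ s).
pose c_ s := hyperbolic_side (C_ s) (A_ s) (B_ s).
have TT t (Ht : 0 <= t <= 1) : hyperbolic_dual_triangle (a_ t) (b_ t) (c_ t) (A_ t) (B_ t) (C_ t).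
  exact: hyperbolic_dual_triangle_of_angles (i1 t Ht) (i2 t Ht) (i3 t Ht) (sumlt t Ht).
have dsum (f g : R -> R) t f' g' : is_derive f t f' -> is_derive g t g' ->
    is_derive (fun s => f s + g s) t (f' + g').
  exact: (@is_derive_plus _ R_NormedModule).
have ex t : 0 <= t <= 1 -> [/\ ex_derive a_ t, ex_derive b_ t & ex_derive c_ t].
  move=> Ht; have [_ dx] := Qx t Ht; have [_ dy] := Qy t Ht; have [_ dz] := Qz t Ht.
  have := i1 t Ht; have := i2 t Ht; have := i3 t Ht; have := sumlt t Ht.
  have eA : ex_derive A_ t by eexists; exact: dsum dy dz.
  have eB : ex_derive B_ t by eexists; exact: dsum dz dx.
  have eC : ex_derive C_ t by eexists; exact: dsum dx dy.
  by rewrite -/(A_ t) -/(B_ t) -/(C_ t) => *; split; apply: ex_derive_hyperbolic_side => //; lra.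
have A0 : A_ 0 = A by rewrite /A_ y0 z0.
have B0 : B_ 0 = B by rewrite /B_ z0 x0.
have C0 : C_ 0 = C by rewrite /C_ x0 y0.
have A1 : A_ 1 = A' by rewrite /A_ y1 z1.
have B1 : B_ 1 = B' by rewrite /B_ z1 x1.
have C1 : C_ 1 = C' by rewrite /C_ x1 y1.
have [|||t Ht] := @weighted_mean_value (Rlt 0) U _ Dx Dy Dz a_ b_ c_ dU.
- by move=> t Ht; have [] := ex t Ht; have [] := TT t Ht.
- by move=> t Ht; have [] := ex t Ht; have [] := TT t Ht.
- by move=> t Ht; have [] := ex t Ht; have [] := TT t Ht.
rewrite /a_ /b_ /c_ A0 B0 C0 A1 B1 C1.
rewrite (hyperbolic_sideE Ha HB HC LA) (hyperbolic_sideE Ha' HB' HC' LA')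
  (hyperbolic_sideE Hb HC HA LB) (hyperbolic_sideE Hb' HC' HA' LB')
  (hyperbolic_sideE Hc HA HB LC) (hyperbolic_sideE Hc' HA' HB' LC').
rewrite -/a_ -/b_ -/c_ -/(a_ t) -/(b_ t) -/(c_ t).
(* The roles are exchanged: the differences of [V] are the constant weights, and the sides are the
   moving quantities. *)
rewrite (Rmult_comm (U a' - U a)) (Rmult_comm (U b' - U b)) (Rmult_comm (U c' - U c)) => ->.
have Ht' : 0 <= t <= 1 by lra.
have Tt := TT t Ht'; have [ea eb ec] := ex t Ht'.
have [_ dx] := Qx t Ht'; have [_ dy] := Qy t Ht'; have [_ dz] := Qz t Ht'.
have da := Derive_correct _ _ ea; have db := Derive_correct _ _ eb.
have dc := Derive_correct _ _ ec.
have dA : is_derive A_ t _ := dsum _ _ _ _ _ dy dz.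
have dB : is_derive B_ t _ := dsum _ _ _ _ _ dz dx.
have dC : is_derive C_ t _ := dsum _ _ _ _ _ dx dy.
have EA := @hyperbolic_dual_law_derivative a_ b_ c_ A_ B_ C_ t _ _ _ _ Tt
  (locally_inside Ht (fun s Hs => hypd_lawA (TT s Hs))) da dA dB dC.
have EB := @hyperbolic_dual_law_derivative b_ c_ a_ B_ C_ A_ t _ _ _ _
  (hyperbolic_dual_rot Tt)
  (locally_inside Ht (fun s Hs => hypd_lawB (TT s Hs))) db dB dC dA.
have EC := @hyperbolic_dual_law_derivative c_ a_ b_ C_ A_ B_ t _ _ _ _
  (hyperbolic_dual_rot (hyperbolic_dual_rot Tt))
  (locally_inside Ht (fun s Hs => hypd_lawC (TT s Hs))) dc dC dA dB.
have nzv : Dx / Rpower (cos (x_ t)) p <> 0 \/ Dy / Rpower (cos (y_ t)) p <> 0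
    \/ Dz / Rpower (cos (z_ t)) p <> 0.
  by case: nz => [n|[n|n]]; [left|right; left|right; right]; exact: div_Rpower_neq0.
have := @hyperbolic_weighted_form_neg p _ _ _ _ _ _ _ _ _ _ _ _ Tt nzv EA EB EC.
have -> : (B_ t + C_ t - A_ t) / 2 = x_ t by rewrite /A_ /B_ /C_; lra.
have -> : (C_ t + A_ t - B_ t) / 2 = y_ t by rewrite /A_ /B_ /C_; lra.
have -> : (A_ t + B_ t - C_ t) / 2 = z_ t by rewrite /A_ /B_ /C_; lra.
have Wx := Rpower_pos (cos (x_ t)) p.
have Wy := Rpower_pos (cos (y_ t)) p.
have Wz := Rpower_pos (cos (z_ t)) p.
have cancel D W d P : 0 < W -> d * (D / W) * (P * W) = D * (d * P).
  by move=> W0; field; lra.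
by rewrite !cancel.
Qed.

Lemma hyperbolic_monotone (p : R) (U V : R -> R)
    (a b c A B C a' b' c' A' B' C' : R) :
  p <= -1 \/ 0 <= p ->
  (forall x, 0 < x -> is_derive U x (Rpower (tanh (x / 2)) (-1 - p))) ->
  (forall x, - (PI / 2) < x < PI / 2 -> is_derive V x (Rpower (cos x) p)) ->
  hyperbolic_triangle a b c A B C -> hyperbolic_triangle a' b' c' A' B' C' ->
  [/\ a' = a, b' = b & c' = c] \/
  (U a' - U a) * (V ((B' + C' - A') / 2) - V ((B + C - A) / 2))
    + (U b' - U b) * (V ((C' + A' - B') / 2) - V ((C + A - B) / 2))
    + (U c' - U c) * (V ((A' + B' - C') / 2) - V ((A + B - C) / 2)) < 0.
Proof.
case=> Hp dU dV T T'; first exact: hyperbolic_monotone_length Hp dU dV T T'.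
exact: hyperbolic_monotone_angle Hp dU dV (hyperbolic_triangle_dual T)
  (hyperbolic_triangle_dual T').
Qed.

(** * Gluings *)

Fact RplusA : associative Rplus.
Proof. by move=> x y z; rewrite Rplus_assoc. Qed.

HB.instance Definition _ := Monoid.isComLaw.Build R 0 Rplus RplusA Rplus_comm Rplus_0_l.

Lemma Rsum_sub (I : finType) (P : pred I) (F G : I -> R) :
  \big[Rplus/0]_(i | P i) (F i - G i)
  = \big[Rplus/0]_(i | P i) F i - \big[Rplus/0]_(i | P i) G i.
Proof.
by elim/big_rec3: _ => [|i x y z _ ->]; lra.
Qed.

Lemma Rsum_ge0 (I : finType) (P : pred I) (F : I -> R) :
  (forall i, P i -> 0 <= F i) -> 0 <= \big[Rplus/0]_(i | P i) F i.
Proof. by move=> H; elim/big_ind: _ => *; [lra | lra | exact: H]. Qed.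

Lemma Rsum_eq0 (I : finType) (P : pred I) (F : I -> R) :
  (forall i, P i -> 0 <= F i) -> \big[Rplus/0]_(i | P i) F i = 0 ->
  forall i, P i -> F i = 0.
Proof.
move=> H + i Pi; rewrite (bigD1 i) //=.
have := H i Pi.
have : 0 <= \big[Rplus/0]_(j | P j && (j != i)) F j.
  by apply: Rsum_ge0 => j /andP[/H].
lra.
Qed.

Lemma exists_argmax (I : finType) (i0 : I) (f : I -> R) :
  exists i, forall j, f j <= f i.
Proof.
suff [i _ Hi] : exists2 i, i \in i0 :: enum I & forall j, j \in i0 :: enum I -> f j <= f i.
  by exists i => j; apply: Hi; rewrite in_cons mem_enum orbT.
elim: (enum I) i0 => [|y s IH] x.
  by exists x => [|j]; rewrite ?mem_head // inE => /eqP ->; lra.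
have [i Hi Hm] := IH y.
case: (Rle_lt_dec (f x) (f i)) => le.
  exists i => [|j]; first by rewrite in_cons Hi orbT.
  by rewrite in_cons => /orP[/eqP -> //|/Hm].
exists x => [|j]; first exact: mem_head.
by rewrite in_cons => /orP[/eqP ->|/Hm]; lra.
Qed.

Lemma ordS_ordS (i : 'I_3) : ordS (ordS i) = ord_pred i.
Proof. by apply: val_inj; case: i => [[|[|[|]]]]. Qed.

Lemma ord_pred_ord_pred (i : 'I_3) : ord_pred (ord_pred i) = ordS i.
Proof. by apply: val_inj; case: i => [[|[|[|]]]]. Qed.

Lemma next_next T (s : corner T) : next (next s) = prev s.
Proof. by rewrite /next /prev /= ordS_ordS. Qed.

Lemma prev_prev T (s : corner T) : prev (prev s) = next s.
Proof. by rewrite /next /prev /= ord_pred_ord_pred. Qed.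

Lemma nextK T (s : corner T) : prev (next s) = s.
Proof. by case: s => t i; rewrite /next /prev /= ordSK. Qed.

Lemma prevK T (s : corner T) : next (prev s) = s.
Proof. by case: s => t i; rewrite /next /prev /= ord_predK. Qed.

Lemma corner_cases T (c : corner T) (i : 'I_3) : [\/ (c.1, i) = c, (c.1, i) = next c | (c.1, i) = prev c].
Proof.
case: c => t j /=; rewrite /next /prev /=.
have : [\/ i = j, i = ordS j | i = ord_pred j].
  by case: i j => [[|[|[|//]]] Hi] [[|[|[|//]]] Hj];
    first [by constructor 1; apply: val_inj | by constructor 2; apply: val_inj
          | by constructor 3; apply: val_inj].
by case=> ->; [constructor 1 | constructor 2 | constructor 3].
Qed.

Lemma edge_class_glue T (s : corner T) : edge_class (glue s) = edge_class s.
Proof. by rewrite /edge_class glueK setUC. Qed.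

Lemma edge_of_glue T (s : corner T) : edge_of (glue s) = edge_of s.
Proof. by apply: val_inj; rewrite /= edge_class_glue. Qed.

Lemma edge_surj T (e : edge T) : exists s, e = edge_of s.
Proof.
have /imsetP[s _ E] := valP e.
by exists s; apply: val_inj; rewrite /= -E.
Qed.

Lemma in_edge T (e : edge T) c : (c \in val e) = (edge_of c == e).
Proof.
have [s ->] := edge_surj e.
apply/idP/eqP => [|<-]; last by rewrite /= /edge_class !inE eqxx.
by rewrite /= /edge_class !inE => /orP[] /eqP -> //; rewrite edge_of_glue.
Qed.

Lemma glued_corners_sym T : symmetric (@glued_corners T).
Proof.
suff imp (c c' : corner T) : glued_corners c c' -> glued_corners c' c.
  by move=> c c'; apply/idP/idP; exact: imp.
case/existsP=> s /existsP[b /andP[/eqP -> /eqP ->]].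
apply/existsP; exists (glue s); apply/existsP; exists (b (+) twist s).
by rewrite glueK twist_glue -addbA addbb addbF !eqxx.
Qed.

Lemma vertex_surj T (v : vertex T) : exists c, v = vertex_of c.
Proof.
have /imsetP[c _ E] := valP v.
by exists c; apply: val_inj; rewrite /= -E.
Qed.

Lemma vertex_of_connect T (c c' : corner T) : connect (@glued_corners T) c c' -> vertex_of c' = vertex_of c.
Proof.
move=> cc'; apply: val_inj; apply/setP => d; rewrite /= /vertex_class !inE.
by rewrite (same_connect (sym_connect_sym (@glued_corners_sym T)) cc').
Qed.

Lemma in_vertex T (v : vertex T) c : (c \in val v) = (vertex_of c == v).
Proof.
have [d ->] := vertex_surj v.
apply/idP/eqP => [|<-]; last by rewrite /= /vertex_class inE connect0.
by rewrite /= /vertex_class inE => /vertex_of_connect.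
Qed.

Lemma vertex_of_side_end T (s : corner T) b :
  vertex_of (side_end (glue s) (b (+) twist s)) = vertex_of (side_end s b).
Proof.
apply: vertex_of_connect; apply: connect1.
by apply/existsP; exists s; apply/existsP; exists b; rewrite !eqxx.
Qed.

(** Connectedness of the surface, as propagation of a property across one side at a time. *)
Lemma triangle_induction T (Q : triangle T -> Prop) (t0 : triangle T) :
  Q t0 -> (forall s, Q s.1 -> Q (glue s).1) -> forall t, Q t.
Proof.
move=> Q0 step t; have /connectP[p + ->] := triangle_connected t0 t.
elim: p t0 Q0 => [|x p IH] //= y Qy /andP[/existsP[i /eqP E] pth].
by apply: (IH x) => //; rewrite -E; exact: (step (y, i)).
Qed.

Lemma corner_sum T (F : corner T -> R) :
  \big[Rplus/0]_(c : corner T) F c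
  = \big[Rplus/0]_(t : triangle T)
      (F (t, ord0) + F (next (t, ord0)) + F (prev (t, ord0))).
Proof.
rewrite (eq_bigr (fun c => F (c.1, c.2))); last by case.
rewrite -(pair_big xpredT xpredT (fun t i => F (t, i))) /=.
apply: eq_bigr => t _; rewrite !big_ord_recl big_ord0.
have -> : next (t, ord0) = (t, lift ord0 ord0) by congr pair; apply: val_inj.
have -> : prev (t, ord0) = (t, lift ord0 (lift ord0 ord0)).
  by congr pair; apply: val_inj.
lra.
Qed.

(** Grouping the corners by the edge they face makes the weight constant within each group. *)
Lemma edge_weighted_sum T (u : edge T -> R) (f : corner T -> R) :
  (forall e : edge T, \big[Rplus/0]_(c in val e) f c = 0) ->
  \big[Rplus/0]_(c : corner T) (u (edge_of c) * f c) = 0.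
Proof.
move=> H; rewrite (partition_big (@edge_of T) xpredT) //=.
apply: big1 => e _.
rewrite (eq_bigr (fun c => u e * f c)); last by move=> c /eqP ->.
rewrite -(big_morph (Rmult (u e)) (Rmult_plus_distr_l (u e)) (Rmult_0_r (u e))).
rewrite (eq_bigl (fun c => c \in val e)); last by move=> c; rewrite in_edge.
by rewrite H Rmult_0_r.
Qed.

(* [S] is the share of one triangle in [\sum_e u e * (f'(e) - f(e)) = 0]. *)
Lemma edge_rigidity T (u : edge T -> R) (f f' : corner T -> R) (good : triangle T -> Prop) :
  (forall e : edge T, \big[Rplus/0]_(c in val e) f c = \big[Rplus/0]_(c in val e) f' c) ->
  (let F c := u (edge_of c) * (f' c - f c) in
   forall t, let S := F (t, ord0) + F (next (t, ord0)) + F (prev (t, ord0)) in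
    good t /\ S = 0 \/ 0 < S) ->
  forall t, good t.
Proof.
move=> H; set F := fun c => u (edge_of c) * (f' c - f c) => /= mono t.
have Z : \big[Rplus/0]_(c : corner T) F c = 0.
  by apply: edge_weighted_sum => e; rewrite Rsum_sub H; lra.
rewrite corner_sum in Z.
(* The shares are nonnegative with sum zero, so each vanishes and the strict alternative occurs in
   no triangle. *)
have Z' := Rsum_eq0 _ Z.
case: (mono t) => [[]//|]; rewrite Z' //; first by lra.
by move=> t' _; case: (mono t') => [[_ ->]|]; lra.
Qed.

(** * The cosine laws in the three models *)

(** u, v and w are the squared norms and the inner product of two tangent vectors; strict
    Cauchy-Schwarz makes the angle between them non-degenerate. *)
Lemma angle_of_gram (u v w : R) : 0 <= u -> 0 <= v -> w ^ 2 < u * v ->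
  let A := acos (w / (sqrt u * sqrt v)) in
  0 < A < PI /\ sqrt u * sqrt v * cos A = w.
Proof.
move=> u0 v0 H A.
have uv : 0 < u * v by have := pow2_ge_0 w; lra.
have m : 0 < sqrt u * sqrt v by rewrite -sqrt_mult //; exact: sqrt_lt_R0.
have m2 : (sqrt u * sqrt v) ^ 2 = u * v by rewrite -sqrt_mult // pow2_sqrt //; lra.
have Bd : -1 < w / (sqrt u * sqrt v) < 1.
  by apply: ratio_in_unit => //; rewrite -m2 in H; split; nra.
split; first exact: acos_bound_lt.
by rewrite /A cos_acos; [field; split => E; rewrite E in m; lra | lra].
Qed.

Lemma form_sub_scale (K : geometry) (p q r : point) (a b : R) :
  form K (sub_scale q a p) (sub_scale r b p)
  = form K q r - b * form K q p - a * form K p r + a * b * form K p p.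
Proof. by case: K => /=; ring. Qed.

Lemma form_sym (K : geometry) (p q : point) : form K p q = form K q p.
Proof. by case: K => /=; ring. Qed.

Lemma form_ge0 (p : point) : 0 <= form Spherical p p.
Proof. by rewrite /=; nra. Qed.

(** Used with d = [det3]: in each model the gap in Cauchy-Schwarz for the two directions at a corner
    is the square of that determinant. *)
Lemma lt_of_gap (x y d : R) : d <> 0 -> y - x = d ^ 2 -> x < y.
Proof. by move=> /pow2_gt_0; lra. Qed.

Lemma euclidean_model_law p q r : is_triangle Euclidean p q r ->
  0 < angle Euclidean p q r < PI /\
  euclidean_law (dist Euclidean q r) (dist Euclidean r p) (dist Euclidean p q)
    (angle Euclidean p q r).
Proof.
case=> Mp Mq Mr D; rewrite /= in Mp Mq Mr.
rewrite /euclidean_law /angle /dist /direction.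
set U := form Euclidean (sub_scale q 1 p) (sub_scale q 1 p).
set V := form Euclidean (sub_scale r 1 p) (sub_scale r 1 p).
set W := form Euclidean (sub_scale q 1 p) (sub_scale r 1 p).
have -> : form Euclidean (sub_scale p 1 r) (sub_scale p 1 r) = V.
  by rewrite /V /=; ring.
have -> : form Euclidean (sub_scale r 1 q) (sub_scale r 1 q) = U + V - 2 * W.
  by rewrite /U /V /W /=; ring.
have U0 : 0 <= U by exact: form_ge0.
have V0 : 0 <= V by exact: form_ge0.
have G : W ^ 2 < U * V.
  by apply: (lt_of_gap D); rewrite /U /V /W /det3 /= Mp Mq Mr; ring.
have := angle_of_gram U0 V0 G; cbv zeta.
move: (acos _) => A [A1 A2]; split=> //.
rewrite !pow2_sqrt //; first by rewrite -A2; ring.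
have -> : U + V - 2 * W = form Spherical (sub_scale r 1 q) (sub_scale r 1 q).
  by rewrite /U /V /W /=; ring.
exact: form_ge0.
Qed.

Lemma spherical_model_law p q r : is_triangle Spherical p q r ->
  [/\ 0 < dist Spherical q r < PI, 0 < angle Spherical p q r < PI &
  spherical_law (dist Spherical q r) (dist Spherical r p) (dist Spherical p q)
    (angle Spherical p q r)].
Proof.
case=> Mp Mq Mr D; rewrite /in_model in Mp Mq Mr.
rewrite /spherical_law /angle /dist /direction !form_sub_scale.
rewrite Mp Mq Mr (form_sym _ q p) (form_sym _ r p).
set a := form _ q r; set b := form _ p r; set c := form _ p q.
have U : 1 - c * c - c * c + c * c * 1 = 1 - c ^ 2 by ring.
have V : 1 - b * b - b * b + b * b * 1 = 1 - b ^ 2 by ring.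
have W : a - b * c - c * b + c * b * 1 = a - b * c by ring.
rewrite U V W.
have gram : (1 - c ^ 2) * (1 - b ^ 2) - (a - b * c) ^ 2 = det3 p q r ^ 2.
  have -> : (1 - c ^ 2) * (1 - b ^ 2) - (a - b * c) ^ 2
    = form Spherical p p * form Spherical q q * form Spherical r r
      - form Spherical p p * a ^ 2 - form Spherical q q * b ^ 2
      - form Spherical r r * c ^ 2 + 2 * a * b * c by rewrite Mp Mq Mr; ring.
  by rewrite /a /b /c /det3 /=; ring.
have cauchy x y : form Spherical x x = 1 -> form Spherical y y = 1 ->
    0 <= 1 - form Spherical x y ^ 2.
  move=> Ex Ey; have := form_ge0 (sub_scale y (form Spherical x y) x).
  by rewrite form_sub_scale Ex Ey (form_sym _ y x); lra.
have U0 := cauchy _ _ Mp Mq; have V0 := cauchy _ _ Mp Mr; rewrite -/c -/b in U0 V0.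
have G : (a - b * c) ^ 2 < (1 - c ^ 2) * (1 - b ^ 2) by apply: (lt_of_gap D).
have := angle_of_gram U0 V0 G; cbv zeta.
move: (acos (_ / _)) => A [A1 A2].
have n := pow2_ge_0 (a - b * c).
have unit_lt x : 0 < 1 - x ^ 2 -> -1 < x < 1 by nra.
have Bc : -1 < c < 1 by apply: unit_lt; case: U0 => // E; rewrite -E in G; lra.
have Bb : -1 < b < 1 by apply: unit_lt; case: V0 => // E; rewrite -E in G; lra.
(* The side opposite to p enters neither norm, but the Gram determinant is symmetric and may be
   expanded at another vertex: a^2 = 1 would make it nonpositive. *)
have Ba : -1 < a < 1.
  apply: unit_lt; have := cauchy _ _ Mq Mr; rewrite -/a; case=> // E.
  have m : 0 < 1 - b ^ 2 by nra.
  have := pow2_gt_0 _ D; rewrite -gram.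
  have -> : (1 - c ^ 2) * (1 - b ^ 2) - (a - b * c) ^ 2
    = (1 - a ^ 2) * (1 - b ^ 2) - (c - a * b) ^ 2 by ring.
  by rewrite -E; have := pow2_ge_0 (c - a * b); lra.
split=> //; first exact: acos_bound_lt.
rewrite !sin_acos; try lra.
rewrite !cos_acos; try lra.
rewrite /Rsqr; move: A2.
rewrite (_ : 1 - b * b = 1 - b ^ 2); last by ring.
rewrite (_ : 1 - c * c = 1 - c ^ 2); last by ring.
by rewrite (Rmult_comm (sqrt (1 - b ^ 2))) => ->; ring.
Qed.

(** Reversed Cauchy-Schwarz on the upper sheet: the difference of squares below is a sum of squares,
    and positivity of both heights selects the sign. *)
Lemma hyperbolic_form_le (p q : point) : in_model Hyperbolic p -> in_model Hyperbolic q ->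
  1 <= - form Hyperbolic p q.
Proof.
case=> Ep zp [Eq zq]; move: Ep Eq; rewrite /= => Ep Eq.
set h := px p * px q + py p * py q.
have zz := Rmult_lt_0_compat _ _ zp zq.
have E : (pz p * pz q) ^ 2 - (1 + h) ^ 2
   = (px p - px q) ^ 2 + (py p - py q) ^ 2 + (px p * py q - py p * px q) ^ 2.
  have -> : (pz p * pz q) ^ 2 = (pz p * pz p) * (pz q * pz q) by ring.
  have -> : pz p * pz p = 1 + px p * px p + py p * py p by lra.
  have -> : pz q * pz q = 1 + px q * px q + py q * py q by lra.
  by rewrite /h; ring.
have := pow2_ge_0 (px p - px q); have := pow2_ge_0 (py p - py q).
have := pow2_ge_0 (px p * py q - py p * px q).
by rewrite -/h; case: (Rle_lt_dec (1 + h) (pz p * pz q)) => [|lt]; [lra | nra].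
Qed.

Lemma sinh_arcosh (x : R) : 1 < x -> sinh (arcosh x) = sqrt (x ^ 2 - 1).
Proof.
move=> Hx; have s := sinh_pos (arcosh_pos Hx).
rewrite -{2}(@cosh_arcosh x) -?sinh2E ?sqrt_pow2 //; lra.
Qed.

Lemma hyperbolic_model_law p q r : is_triangle Hyperbolic p q r ->
  0 < angle Hyperbolic p q r < PI /\
  hyperbolic_law (dist Hyperbolic q r) (dist Hyperbolic r p) (dist Hyperbolic p q)
    (angle Hyperbolic p q r).
Proof.
case=> Mp Mq Mr D.
have La := hyperbolic_form_le Mq Mr; have Lb := hyperbolic_form_le Mp Mr.
have Lc := hyperbolic_form_le Mp Mq.
have [Ep _] := Mp; have [Eq _] := Mq; have [Er _] := Mr.
rewrite /hyperbolic_law /angle /dist /direction !form_sub_scale.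
rewrite Ep Eq Er (form_sym _ q p) (form_sym _ r p).
set a := - form _ q r in La *; set b := - form _ p r in Lb *; set c := - form _ p q in Lc *.
have -> : form Hyperbolic q r = - a by rewrite /a; lra.
have -> : form Hyperbolic p r = - b by rewrite /b; lra.
have -> : form Hyperbolic p q = - c by rewrite /c; lra.
have -> : -1 - c * - c - c * - c + c * c * -1 = c ^ 2 - 1 by ring.
have -> : -1 - b * - b - b * - b + b * b * -1 = b ^ 2 - 1 by ring.
have -> : - a - b * - c - c * - b + c * b * -1 = b * c - a by ring.
have gram : (c ^ 2 - 1) * (b ^ 2 - 1) - (b * c - a) ^ 2 = det3 p q r ^ 2.
  have -> : (c ^ 2 - 1) * (b ^ 2 - 1) - (b * c - a) ^ 2
    = - (form Hyperbolic p p * form Hyperbolic q q * form Hyperbolic r r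
      - form Hyperbolic p p * a ^ 2 - form Hyperbolic q q * b ^ 2
      - form Hyperbolic r r * c ^ 2 - 2 * a * b * c) by rewrite Ep Eq Er; ring.
  by rewrite /a /b /c /det3 /=; ring.
have U0 : 0 <= c ^ 2 - 1 by nra.
have V0 : 0 <= b ^ 2 - 1 by nra.
have G : (b * c - a) ^ 2 < (c ^ 2 - 1) * (b ^ 2 - 1) by apply: (lt_of_gap D).
have := angle_of_gram U0 V0 G; cbv zeta.
move: (acos (_ / _)) => A [A1 A2].
have n := pow2_ge_0 (b * c - a).
split=> //.
have Bc : 1 < c by case: Lc => // E; rewrite -E in G n; lra.
have Bb : 1 < b by case: Lb => // E; rewrite -E in G n; lra.
rewrite !cosh_arcosh // ?sinh_arcosh //; lra.
Qed.

Lemma corner_realized K T (M : polyhedral_metric K T) (s : corner T) : exists p q r, [/\ is_triangle K p q r,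
  len M (edge_of s) = dist K q r, len M (edge_of (next s)) = dist K r p,
  len M (edge_of (prev s)) = dist K p q & ang M s = angle K p q r].
Proof.
case: s => t i; have [P tri E] := realized M t.
exists (P i), (P (ordS i)), (P (ord_pred i)); split=> //.
- by have [] := E i.
- by have [-> _] := E (ordS i); rewrite ordS_ordS ordSK.
- by have [-> _] := E (ord_pred i); rewrite ord_predK ord_pred_ord_pred.
- by have [] := E i.
Qed.

Lemma euclidean_corner T (M : polyhedral_metric Euclidean T) (s : corner T) :
  euclidean_triangle (len M (edge_of s)) (len M (edge_of (next s)))
    (len M (edge_of (prev s))) (ang M s) (ang M (next s)) (ang M (prev s)).
Proof.
have main c : 0 < ang M c < PI /\ euclidean_law (len M (edge_of c))
    (len M (edge_of (next c))) (len M (edge_of (prev c))) (ang M c).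
  by have [p [q [r [/euclidean_model_law H -> -> -> ->]]]] := corner_realized M c.
have [A1 A2] := main s; have [B1 B2] := main (next s); have [C1 C2] := main (prev s).
rewrite next_next nextK in B2; rewrite prevK prev_prev in C2.
by split => //; exact: len_pos.
Qed.

Lemma hyperbolic_corner T (M : polyhedral_metric Hyperbolic T) (s : corner T) :
  hyperbolic_triangle (len M (edge_of s)) (len M (edge_of (next s)))
    (len M (edge_of (prev s))) (ang M s) (ang M (next s)) (ang M (prev s)).
Proof.
have main c : 0 < ang M c < PI /\ hyperbolic_law (len M (edge_of c))
    (len M (edge_of (next c))) (len M (edge_of (prev c))) (ang M c).
  by have [p [q [r [/hyperbolic_model_law H -> -> -> ->]]]] := corner_realized M c.
have [A1 A2] := main s; have [B1 B2] := main (next s); have [C1 C2] := main (prev s).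
rewrite next_next nextK in B2; rewrite prevK prev_prev in C2.
by split => //; exact: len_pos.
Qed.

Lemma spherical_corner T (M : polyhedral_metric Spherical T) (s : corner T) :
  spherical_triangle (len M (edge_of s)) (len M (edge_of (next s)))
    (len M (edge_of (prev s))) (ang M s) (ang M (next s)) (ang M (prev s)).
Proof.
have main c : [/\ 0 < len M (edge_of c) < PI, 0 < ang M c < PI & spherical_law
    (len M (edge_of c)) (len M (edge_of (next c))) (len M (edge_of (prev c))) (ang M c)].
  by have [p [q [r [/spherical_model_law H -> -> -> ->]]]] := corner_realized M c.
have [A0 A1 A2] := main s; have [B0 B1 B2] := main (next s).
have [C0 C1 C2] := main (prev s).
by rewrite next_next nextK in B2; rewrite prevK prev_prev in C2; split.
Qed.

(** * Circle packings *)

Lemma is_derive_sin_power (p x : R) : 0 < x < PI ->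
  is_derive (fun y => RInt (fun t => Rpower (sin t) p) (PI / 2) y) x (Rpower (sin x) p).
Proof.
move=> Hx; apply: (@is_derive_RInt_Rpower sin p 0 PI) => //; last by lra.
by move=> y Hy; split; [exact: sin_pos | auto_derive].
Qed.

Lemma is_derive_cos_power (p x : R) : - (PI / 2) < x < PI / 2 ->
  is_derive (fun y => RInt (fun t => Rpower (cos t) p) 0 y) x (Rpower (cos x) p).
Proof.
move=> Hx; apply: (@is_derive_RInt_Rpower cos p (- (PI / 2)) (PI / 2)) => //.
  by move=> y Hy; split; [apply: cos_gt_0; lra | auto_derive].
by have := PI_RGT_0; lra.
Qed.

Lemma is_derive_tan_half_power (p x : R) : 0 < x < PI ->
  is_derive (fun y => RInt (fun t => Rpower (tan (t / 2)) p) (PI / 2) y) x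
    (Rpower (tan (x / 2)) p).
Proof.
move=> Hx; apply: (@is_derive_RInt_Rpower (fun t => tan (t / 2)) p 0 PI) => //; last by lra.
move=> y Hy; split; first by apply: tan_gt_0; lra.
rewrite /tan; auto_derive.
by apply: Rgt_not_eq; apply: cos_gt_0; lra.
Qed.

Lemma is_derive_tanh_half_power (p x : R) : 0 < x ->
  is_derive (fun y => RInt (fun t => Rpower (tanh (t / 2)) p) 1 y) x
    (Rpower (tanh (x / 2)) p).
Proof.
(* The upper end x + 2 is chosen to exceed both x and the base point 1. *)
move=> Hx; apply: (@is_derive_RInt_Rpower (fun t => tanh (t / 2)) p 0 (x + 2)); try lra.
move=> y [Hy _]; split; first exact: tanh_half_pos.
by eexists; exact: is_derive_tanh_half.
Qed.

Definition curvature_integral (p x : R) : R :=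
  RInt (fun t => Rpower (tan (t / 2)) p) (PI / 2) x.

Lemma curvature_integral_lt (p x y : R) : 0 < x -> x < y -> y < PI ->
  curvature_integral p x < curvature_integral p y.
Proof.
apply: (@deriv_pos_increasing (curvature_integral p) (fun t => Rpower (tan (t / 2)) p)).
by move=> t Ht; split; [exact: is_derive_tan_half_power | exact: Rpower_pos].
Qed.

Lemma curvature_integral_le (p x y : R) : 0 < x -> x <= y -> y < PI ->
  curvature_integral p x <= curvature_integral p y.
Proof.
move=> Hx Hxy Hy; case: (Rle_lt_or_eq_dec _ _ Hxy) => [lt|->]; last by lra.
exact/Rlt_le/curvature_integral_lt.
Qed.

(** For mutually tangent Euclidean circles of radii u, v, w, the angle A at the centre of the first
    satisfies sin^2 (A / 2) = chord u v times chord u w. Each factor depends only on v / u and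
    increases with it, which is what a comparison of ratios of radii requires. *)
Definition chord (u v : R) : R := v / (u + v).

Lemma chord_le (k u v u' v' : R) : 0 < u -> 0 < v -> 0 < v' -> 0 < k ->
  u' = k * u -> v' <= k * v -> chord u' v' <= chord u v.
Proof.
move=> Hu Hv Hv' Hk -> le; rewrite /chord.
have m1 : 0 < k * u + v' by nra.
have E : v / (u + v) - v' / (k * u + v') = u * (k * v - v') / ((u + v) * (k * u + v')).
  by field; lra.
have : 0 <= u * (k * v - v') / ((u + v) * (k * u + v')).
  by apply: Rdiv_le_0_compat; [apply: Rmult_le_pos; lra | apply: Rmult_lt_0_compat; lra].
lra.
Qed.

Lemma chord_eq (k u v u' v' : R) : 0 < u -> 0 < v -> 0 < v' -> 0 < k ->
  u' = k * u -> chord u' v' = chord u v -> v' = k * v.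
Proof.
move=> Hu Hv Hv' Hk -> E; rewrite /chord in E.
have m1 : 0 < k * u + v' by nra.
have : v' * (u + v) = v * (k * u + v').
  have -> : v' * (u + v) = v' / (k * u + v') * ((u + v) * (k * u + v')) by field; lra.
  by rewrite E; field; lra.
move=> E'; apply: (Rmult_eq_reg_l u); lra.
Qed.

Lemma chord_pos (u v : R) : 0 < u -> 0 < v -> 0 < chord u v.
Proof. by move=> Hu Hv; apply: Rdiv_lt_0_compat; lra. Qed.

Lemma euclidean_packing_cos (u v w A : R) : 0 < u -> 0 < v -> 0 < w ->
  euclidean_law (v + w) (w + u) (u + v) A -> 1 - cos A = 2 * (chord u v * chord u w).
Proof.
move=> Hu Hv Hw L; rewrite /euclidean_law in L.
have m : 0 < (w + u) * (u + v) by apply: Rmult_lt_0_compat; lra.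
apply: (Rmult_eq_reg_l ((w + u) * (u + v))); last by lra.
have -> : (w + u) * (u + v) * (2 * (chord u v * chord u w)) = 2 * v * w.
  by rewrite /chord; field; lra.
lra.
Qed.

(** Here sin^2 (A / 2) = sinh v sinh w / (sinh (u + v) sinh (u + w)). In the tanh of the radii this
    is again a product of chords, with an extra factor 1 / cosh^2 u that decreases in u and breaks
    the scaling symmetry. *)
Lemma hyperbolic_packing_cos (u v w A : R) : 0 < u -> 0 < v -> 0 < w ->
  hyperbolic_law (v + w) (w + u) (u + v) A ->
  1 - cos A = 2 * (chord (tanh u) (tanh v) * chord (tanh u) (tanh w)) * (1 - tanh u ^ 2).
Proof.
move=> Hu Hv Hw L; rewrite /hyperbolic_law in L.
have su := sinh_pos Hu; have sv := sinh_pos Hv; have sw := sinh_pos Hw.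
have cu := cosh_pos u; have cv := cosh_pos v; have cw := cosh_pos w.
have s1 : 0 < sinh (w + u) by apply: sinh_pos; lra.
have s2 : 0 < sinh (u + v) by apply: sinh_pos; lra.
have m : 0 < sinh (w + u) * sinh (u + v) by exact: Rmult_lt_0_compat.
apply: (Rmult_eq_reg_l (sinh (w + u) * sinh (u + v))); last by lra.
have T2 : 1 - tanh u ^ 2 = / cosh u ^ 2.
  rewrite /tanh; apply: (Rmult_eq_reg_l (cosh u ^ 2)); last by nra.
  rewrite Rinv_r; last by nra.
  have -> : cosh u ^ 2 * (1 - (sinh u / cosh u) ^ 2) = cosh u ^ 2 - sinh u ^ 2.
    by field; lra.
  by rewrite cosh2E; ring.
have ch x : 0 < x -> chord (tanh u) (tanh x) = sinh x * cosh u / sinh (u + x).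
  move=> Hx; have sx := sinh_pos Hx; have cx := cosh_pos x.
  by rewrite /chord /tanh sinh_add; field; repeat split; try lra; nra.
rewrite T2 !ch // (Rplus_comm u w).
have -> : sinh (w + u) * sinh (u + v) * (2 * (sinh v * cosh u / sinh (u + v)
    * (sinh w * cosh u / sinh (w + u))) * / cosh u ^ 2) = 2 * sinh v * sinh w.
  by field; lra.
have E : cosh (w + u) * cosh (u + v) - sinh (w + u) * sinh (u + v) = cosh (v - w).
  have -> : v - w = (u + v) + - (w + u) by lra.
  by rewrite (cosh_add (u + v)) cosh_opp sinh_opp; ring.
have E1 : cosh (v + w) - cosh (v - w) = 2 * sinh v * sinh w.
  have -> : v - w = v + - w by lra.
  by rewrite !cosh_add cosh_opp sinh_opp; ring.
lra.
Qed.

Lemma tanh_bounds (x : R) : 0 < x -> 0 < tanh x < 1.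
Proof.
move=> Hx; have s := sinh_pos Hx; have c := cosh_pos x; have E := cosh2E x.
have lt : sinh x < cosh x by nra.
have := @ratio_in_unit (sinh x) (cosh x) c ltac:(lra).
by have := Rdiv_lt_0_compat _ _ s c; rewrite /tanh; lra.
Qed.

Lemma tanh_inj (x y : R) : 0 < x -> 0 < y -> tanh x = tanh y -> x = y.
Proof.
move=> Hx Hy E.
have cx := cosh_pos x; have cy := cosh_pos y.
have H : sinh (x - y) = 0.
  have -> : x - y = x + - y by lra.
  rewrite sinh_add cosh_opp sinh_opp.
  have -> : sinh x = tanh x * cosh x by rewrite /tanh; field; lra.
  have -> : sinh y = tanh y * cosh y by rewrite /tanh; field; lra.
  by rewrite E; ring.
case: (Rtotal_order x y) => [lt|[//|gt]].
- by have := @sinh_pos (y - x) ltac:(lra);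
    have -> : y - x = - (x - y) by [lra]; rewrite sinh_opp; lra.
- by have := @sinh_pos (x - y) ltac:(lra); lra.
Qed.

(** Each summand of the curvature is at least as large for [M] while the sums agree, so every
    summand agrees; strict monotonicity of the integral returns the angle. *)
Lemma angle_eq_of_curvature_eq (lambda : R) K T (M M' : polyhedral_metric K T)
    (c : corner T) :
  (forall d, 0 < ang M d < PI) -> (forall d, 0 < ang M' d < PI) ->
  curvature lambda M (vertex_of c) = curvature lambda M' (vertex_of c) ->
  (forall d, vertex_of d = vertex_of c -> ang M' d <= ang M d) ->
  ang M' c = ang M c.
Proof.
move=> HM HM' Ek le; pose k := curvature_integral lambda.
have nonneg d : d \in val (vertex_of c) -> 0 <= k (ang M d) - k (ang M' d).
  rewrite in_vertex => /eqP /le ad.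
  by have := curvature_integral_le lambda (proj1 (HM' d)) ad (proj2 (HM d)); rewrite /k; lra.
have zero := Rsum_eq0 nonneg.
rewrite Rsum_sub in zero.
have {}zero : k (ang M c) - k (ang M' c) = 0.
  apply: zero; last by rewrite in_vertex.
  have E (N : polyhedral_metric K T) : \big[Rplus/0]_(d in val (vertex_of c)) k (ang N d)
    = curvature lambda N (vertex_of c) by [].
  by rewrite (E M) (E M') Ek; lra.
case: (Rle_lt_or_eq_dec _ _ (le c (erefl _))) => // lt.
have := curvature_integral_lt lambda (proj1 (HM' c)) lt (proj2 (HM c)).
by rewrite -/k; lra.
Qed.

Lemma packing_sides K T (M : polyhedral_metric K T) (r : vertex T -> R) :
  (forall s, len M (edge_of s) = r (vertex_of (next s)) + r (vertex_of (prev s))) ->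
  forall s, [/\ len M (edge_of s) = r (vertex_of (next s)) + r (vertex_of (prev s)),
    len M (edge_of (next s)) = r (vertex_of (prev s)) + r (vertex_of s)
    & len M (edge_of (prev s)) = r (vertex_of s) + r (vertex_of (next s))].
Proof. by move=> lenE s; rewrite !lenE next_next nextK prevK prev_prev. Qed.

Lemma le_of_cos_le (x y : R) : 0 < x < PI -> 0 < y < PI -> cos x <= cos y -> y <= x.
Proof.
by move=> Hx Hy H; case: (Rle_lt_dec y x) => // lt; have := cos_decreasing_1 x y; lra.
Qed.

Lemma euclidean_packing_rigidity (lambda : R) T (M M' : polyhedral_metric Euclidean T) :
  is_circle_packing M -> is_circle_packing M' ->
  (forall v, curvature lambda M v = curvature lambda M' v) ->
  exists2 c : R, 0 < c & forall e, len M' e = c * len M e.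
Proof.
case=> r r0 rE [r' r0' rE'] Ek.
have [t0] := triangle_inhabited T.
have [v0 Hmax] := exists_argmax (vertex_of (t0, ord0)) (fun v => r' v / r v).
set k := r' v0 / r v0 in Hmax.
have k0 : 0 < k by exact: Rdiv_lt_0_compat.
have le v : r' v <= k * r v.
  have -> : r' v = r' v / r v * r v by field; have := r0 v; lra.
  by apply: Rmult_le_compat_r; [exact/Rlt_le | exact: Hmax].
have cosE (N : polyhedral_metric Euclidean T) (rho : vertex T -> R) : (forall v, 0 < rho v) ->
    (forall s, len N (edge_of s) = rho (vertex_of (next s)) + rho (vertex_of (prev s))) ->
    forall s, 1 - cos (ang N s) = 2 * (chord (rho (vertex_of s)) (rho (vertex_of (next s)))
      * chord (rho (vertex_of s)) (rho (vertex_of (prev s)))).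
  move=> rho0 rhoE s; have [E1 E2 E3] := packing_sides rhoE s.
  have L := euc_lawA (euclidean_corner N s); rewrite E1 E2 E3 in L.
  exact: euclidean_packing_cos L.
have range (N : polyhedral_metric Euclidean T) s : 0 < ang N s < PI.
  exact: euc_A (euclidean_corner N s).
(* Corners whose vertex attains the maximal ratio k; the aim is to show that every corner is one. *)
pose extremal c := r' (vertex_of c) = k * r (vertex_of c).
have chle c d : extremal c ->
    chord (r' (vertex_of c)) (r' d) <= chord (r (vertex_of c)) (r d).
  by move=> Hc; apply: chord_le k0 Hc _.
have angle_le c : extremal c -> ang M' c <= ang M c.
  move=> Hc; apply: le_of_cos_le => //.
  have p1 : 0 < chord (r' (vertex_of c)) (r' (vertex_of (next c))) by exact: chord_pos.
  have p2 : 0 < chord (r' (vertex_of c)) (r' (vertex_of (prev c))) by exact: chord_pos.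
  have := Rmult_le_compat _ _ _ _ (Rlt_le _ _ p1) (Rlt_le _ _ p2)
    (chle c (vertex_of (next c)) Hc) (chle c (vertex_of (prev c)) Hc).
  by have := cosE M r r0 rE c; have := cosE M' r' r0' rE' c; lra.
(* Equal angles mean equal products of chords. As neither chord can increase, both are equal, and
   the two other vertices of the triangle attain the maximum as well. *)
have spread c : extremal c -> extremal (next c) /\ extremal (prev c).
  move=> Hc.
  have E : ang M' c = ang M c.
    apply: (angle_eq_of_curvature_eq _ _ (Ek _)) => // d Ed; apply: angle_le.
    by rewrite /extremal Ed.
  have E1 := cosE M r r0 rE c; have E2 := cosE M' r' r0' rE' c.
  rewrite E E1 in E2.
  have l1 := chle c (vertex_of (next c)) Hc; have l2 := chle c (vertex_of (prev c)) Hc.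
  have p1 : 0 < chord (r' (vertex_of c)) (r' (vertex_of (next c))) by exact: chord_pos.
  have p2 : 0 < chord (r' (vertex_of c)) (r' (vertex_of (prev c))) by exact: chord_pos.
  split; apply: (chord_eq (r0 (vertex_of c)) (r0 _) (r0' _) k0 Hc); nra.
have all_extremal t : forall i, extremal (t, i).
  have fill c : extremal c -> forall i, extremal (c.1, i).
    by move=> Hc i; have [Hn Hp] := spread c Hc; case: (corner_cases c i) => ->.
  have [c0 Ec0] := vertex_surj v0.
  move: t; apply: (@triangle_induction _ _ c0.1).
    by apply: fill; rewrite /extremal -Ec0 /k; field; have := r0 v0; lra.
  move=> s Hs; have Hn : extremal (side_end s true) := Hs _.
  (* The glued triangle has a corner at the same vertex; which end of its side that is depends on
     the twist. *)
  have Hg : extremal (side_end (glue s) (true (+) twist s)).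
    by rewrite /extremal vertex_of_side_end.
  by move: Hg; rewrite /side_end; case: ifP => _ /fill.
exists k => // e; have [s ->] := edge_surj e.
rewrite rE rE'.
have E1 : extremal (next s) := all_extremal _ _.
have E2 : extremal (prev s) := all_extremal _ _.
by rewrite E1 E2; ring.
Qed.

(** If the maximal ratio k exceeded 1, the chords at that vertex could not increase while the factor
    1 - tanh^2 would strictly decrease. All its angles would shrink strictly, against the equality
    of curvatures. Exchanging the two metrics gives the opposite bound. *)
Lemma hyperbolic_packing_le (lambda : R) T (M M' : polyhedral_metric Hyperbolic T)
    (r r' : vertex T -> R) :
  (forall v, 0 < r v) -> (forall v, 0 < r' v) ->
  (forall s, len M (edge_of s) = r (vertex_of (next s)) + r (vertex_of (prev s))) ->
  (forall s, len M' (edge_of s) = r' (vertex_of (next s)) + r' (vertex_of (prev s))) ->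
  (forall v, curvature lambda M v = curvature lambda M' v) ->
  forall v, tanh (r' v) <= tanh (r v).
Proof.
move=> r0 r0' rE rE' Ek.
have th v := tanh_bounds (r0 v); have th' v := tanh_bounds (r0' v).
have [t0] := triangle_inhabited T.
have [v0 Hmax] := exists_argmax (vertex_of (t0, ord0)) (fun v => tanh (r' v) / tanh (r v)).
set k := tanh (r' v0) / tanh (r v0) in Hmax.
have k0 : 0 < k by apply: Rdiv_lt_0_compat; [apply th' | apply th].
have le v : tanh (r' v) <= k * tanh (r v).
  have -> : tanh (r' v) = tanh (r' v) / tanh (r v) * tanh (r v).
    by field; have := th v; lra.
  by apply: Rmult_le_compat_r; [have := th v; lra | exact: Hmax].
case: (Rle_lt_dec k 1) => k1 => [v|]; first by have := le v; have := th v; nra.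
exfalso.
have cosE (N : polyhedral_metric Hyperbolic T) (rho : vertex T -> R) : (forall v, 0 < rho v) ->
    (forall s, len N (edge_of s) = rho (vertex_of (next s)) + rho (vertex_of (prev s))) ->
    forall s, 1 - cos (ang N s)
      = 2 * (chord (tanh (rho (vertex_of s))) (tanh (rho (vertex_of (next s))))
         * chord (tanh (rho (vertex_of s))) (tanh (rho (vertex_of (prev s)))))
         * (1 - tanh (rho (vertex_of s)) ^ 2).
  move=> rho0 rhoE s; have [E1 E2 E3] := packing_sides rhoE s.
  have L := hyp_lawA (hyperbolic_corner N s); rewrite E1 E2 E3 in L.
  exact: hyperbolic_packing_cos L.
have range (N : polyhedral_metric Hyperbolic T) s : 0 < ang N s < PI.
  exact: hyp_A (hyperbolic_corner N s).
have v0E : tanh (r' v0) = k * tanh (r v0) by rewrite /k; field; have := th v0; lra.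
have cos_lt c : vertex_of c = v0 -> cos (ang M c) < cos (ang M' c).
  move=> Ec; have := cosE M r r0 rE c; have := cosE M' r' r0' rE' c; rewrite Ec.
  have cle d : chord (tanh (r' v0)) (tanh (r' d)) <= chord (tanh (r v0)) (tanh (r d)).
    by apply: chord_le k0 v0E _; [apply th | apply th | apply th' | ].
  have cpos d : 0 < chord (tanh (r' v0)) (tanh (r' d)).
    by apply: chord_pos; apply th'.
  have l1 := cle (vertex_of (next c)); have l2 := cle (vertex_of (prev c)).
  have p1 := cpos (vertex_of (next c)); have p2 := cpos (vertex_of (prev c)).
  have := Rmult_le_compat _ _ _ _ (Rlt_le _ _ p1) (Rlt_le _ _ p2) l1 l2.
  have := Rmult_lt_0_compat _ _ p1 p2.
  set P' := chord (tanh (r' v0)) _ * _; set P := chord (tanh (r v0)) _ * _.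
  move=> P'0 PP.
  have t1 := th v0; have t2 := th' v0.
  have lt : tanh (r v0) < tanh (r' v0) by rewrite v0E; nra.
  have sq : tanh (r v0) ^ 2 < tanh (r' v0) ^ 2 by nra.
  have s1 : 0 < 1 - tanh (r' v0) ^ 2 by nra.
  have := Rmult_le_compat_r _ _ _ (Rlt_le _ _ s1) PP.
  have P0 : 0 < P by lra.
  have := Rmult_lt_compat_l P (1 - tanh (r' v0) ^ 2) (1 - tanh (r v0) ^ 2) P0.
  lra.
have angle_lt c : vertex_of c = v0 -> ang M' c < ang M c.
  by move=> /cos_lt H; apply: lt_of_cos_lt H; have := range M c; have := range M' c; lra.
have [c Ec] := vertex_surj v0; have := angle_lt c (esym Ec).
rewrite (@angle_eq_of_curvature_eq lambda _ _ M M' c) //; first by lra.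
by move=> d; rewrite -Ec => /angle_lt; lra.
Qed.

Lemma hyperbolic_packing_rigidity (lambda : R) T (M M' : polyhedral_metric Hyperbolic T) :
  is_circle_packing M -> is_circle_packing M' ->
  (forall v, curvature lambda M v = curvature lambda M' v) ->
  forall e, len M' e = len M e.
Proof.
case=> r r0 rE [r' r0' rE'] Ek e.
have radius v : r' v = r v.
  apply: tanh_inj => //.
  have := @hyperbolic_packing_le lambda T M M' r r' r0 r0' rE rE' Ek v.
  by have := @hyperbolic_packing_le lambda T M' M r' r r0' r0 rE' rE (fun w => esym (Ek w)) v; lra.
by have [s ->] := edge_surj e; rewrite rE rE' !radius.
Qed.

(** * Edge invariants *)

Lemma euclidean_edge_rigidity (lambda : R) T (M M' : polyhedral_metric Euclidean T) :
  lambda <= -1 -> (forall e, phi lambda M e = phi lambda M' e) ->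
  exists2 c : R, 0 < c & forall e, len M' e = c * len M e.
Proof.
move=> Hl Ephi.
pose V x := RInt (fun t => Rpower (sin t) lambda) (PI / 2) x.
pose U x := Rpower x (- lambda) / - lambda.
pose scaled k t := forall i : 'I_3,
  len M' (edge_of (t, i) : edge T) = k * len M (edge_of (t, i)).
(* At this stage the factor k may vary with the triangle. *)
have H : forall t, exists2 k, 0 < k & scaled k t.
  apply: (@edge_rigidity T (fun e => U (len M' e) - U (len M e))
    (fun c => V (ang M c)) (fun c => V (ang M' c))) => [e|F t S]; first exact: Ephi.
  rewrite {}/S {}/F.
  set s : corner T := (t, ord0).
  have C := euclidean_corner M s; have C' := euclidean_corner M' s.
  case: (euclidean_monotone Hl (@is_derive_sin_power lambda) C C') => [[k k0 [Ea Eb Ec]]|];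
    last by right.
  left; split.
    by exists k => // i; case: (corner_cases s i) => ->.
  have -> : ang M' s = ang M s := euclidean_similar C C' k0 Ea Eb Ec.
  have -> : ang M' (next s) = ang M (next s) :=
    euclidean_similar (euclidean_rot C) (euclidean_rot C') k0 Eb Ec Ea.
  have -> : ang M' (prev s) = ang M (prev s) :=
    euclidean_similar (euclidean_rot (euclidean_rot C)) (euclidean_rot (euclidean_rot C'))
      k0 Ec Ea Eb.
  lra.
have [t0] := triangle_inhabited T.
have [k k0 Hk] := H t0; exists k => //.
(* Neighbouring triangles share a side of positive length, which forces their scale factors to
   agree. *)
have all_scaled : forall t, scaled k t.
  apply: (@triangle_induction T _ t0) => // [[t i]] /= Ht.
  have [k' _ Hk'] := H (glue (t, i)).1.
  suff <- : k' = k by [].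
  have := Hk' (glue (t, i)).2; rewrite -surjective_pairing edge_of_glue Ht => E.
  by apply: (Rmult_eq_reg_r (len M (edge_of (t, i)))); [lra | have := len_pos M (edge_of (t, i)); lra].
by move=> e; have [[t i] ->] := edge_surj e; exact: all_scaled.
Qed.

Lemma spherical_edge_rigidity (lambda : R) T (M M' : polyhedral_metric Spherical T) :
  lambda <= -1 \/ 0 <= lambda -> (forall e, phi lambda M e = phi lambda M' e) ->
  forall e, len M' e = len M e.
Proof.
move=> Hl Ephi e.
pose V p x := RInt (fun t => Rpower (sin t) p) (PI / 2) x.
suff H : forall t, forall i : 'I_3,
    len M' (edge_of (t, i) : edge T) = len M (edge_of (t, i)).
  by have [[t i] ->] := edge_surj e.
apply: (@edge_rigidity T (fun e => V (-1 - lambda) (len M' e) - V (-1 - lambda) (len M e))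
  (fun c => V lambda (ang M c)) (fun c => V lambda (ang M' c))) => [d|F t S]; first exact: Ephi.
rewrite {}/S {}/F.
set s : corner T := (t, ord0).
case: (spherical_monotone Hl (@is_derive_sin_power (-1 - lambda))
  (@is_derive_sin_power lambda) (spherical_corner M s) (spherical_corner M' s))
  => [[Ea Eb Ec]|]; last by right.
left; split; last by rewrite Ea Eb Ec; lra.
by move=> i; case: (corner_cases s i) => ->.
Qed.

Lemma hyperbolic_edge_rigidity (lambda : R) T (M M' : polyhedral_metric Hyperbolic T) :
  lambda <= -1 \/ 0 <= lambda -> (forall e, psi lambda M e = psi lambda M' e) ->
  forall e, len M' e = len M e.
Proof.
move=> Hl Epsi e.
pose V x := RInt (fun t => Rpower (cos t) lambda) 0 x.
pose U x := RInt (fun t => Rpower (tanh (t / 2)) (-1 - lambda)) 1 x.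
pose x (N : polyhedral_metric Hyperbolic T) c :=
  (ang N (next c) + ang N (prev c) - ang N c) / 2.
suff H : forall t, forall i : 'I_3,
    len M' (edge_of (t, i) : edge T) = len M (edge_of (t, i)).
  by have [[t i] ->] := edge_surj e.
(* The weight has the opposite sign to the other two geometries, because the hyperbolic share of a
   triangle is negative. *)
apply: (@edge_rigidity T (fun e => U (len M e) - U (len M' e))
  (fun c => V (x M c)) (fun c => V (x M' c))) => [d|F t S]; first exact: Epsi.
rewrite {}/S {}/F.
rewrite /x !next_next !nextK !prevK !prev_prev; set s : corner T := (t, ord0).
case: (hyperbolic_monotone Hl (@is_derive_tanh_half_power (-1 - lambda))
  (@is_derive_cos_power lambda) (hyperbolic_corner M s) (hyperbolic_corner M' s))
  => [[Ea Eb Ec]|neg]; last by right; rewrite /U /V; lra.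
left; split; last by rewrite Ea Eb Ec; lra.
by move=> i; case: (corner_cases s i) => ->.
Qed.

Theorem theorem1p2 (lambda : R) (T : closed_triangulated_surface) :
  (forall M M' : polyhedral_metric Euclidean T,
      is_circle_packing M -> is_circle_packing M' ->
      (forall v, curvature lambda M v = curvature lambda M' v) ->
      exists2 c : R, 0 < c & forall e, len M' e = c * len M e)
  /\
  (forall M M' : polyhedral_metric Hyperbolic T,
      is_circle_packing M -> is_circle_packing M' ->
      (forall v, curvature lambda M v = curvature lambda M' v) ->
      forall e, len M' e = len M e)
  /\
  (lambda <= -1 ->
    forall M M' : polyhedral_metric Euclidean T,
      (forall e, phi lambda M e = phi lambda M' e) ->
      exists2 c : R, 0 < c & forall e, len M' e = c * len M e)
  /\
  (lambda <= -1 \/ 0 <= lambda ->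
    forall M M' : polyhedral_metric Spherical T,
      (forall e, phi lambda M e = phi lambda M' e) ->
      forall e, len M' e = len M e)
  /\
  (lambda <= -1 \/ 0 <= lambda ->
    forall M M' : polyhedral_metric Hyperbolic T,
      (forall e, psi lambda M e = psi lambda M' e) ->
      forall e, len M' e = len M e).
Proof.
split; first exact: euclidean_packing_rigidity.
split; first exact: hyperbolic_packing_rigidity.
split; first by move=> Hl M M'; exact: euclidean_edge_rigidity.
split; first by move=> Hl M M'; exact: spherical_edge_rigidity.
by move=> Hl M M'; exact: hyperbolic_edge_rigidity.
Qed.
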